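(* Let $q$ be a squarefree positive integer and fix a sign $\pm$. Write the dual $q$-nonmaximal Shintani zeta function as $\widehat{\xi}^{\pm}_q(s)=\sum_{\mu}b_q^{\pm}(\mu)\mu^{-s}$, where $\mu$ runs over positive elements of $q^{-8}\mathbb{Z}$ and \[ b_q^{\pm}(\mu) = \sum_{\substack{x\in\mathrm{SL}_2(\mathbb{Z})\backslash\widehat{V}_{\mathbb{Z}}\\ \pm\mathrm{Disc}(x)>0,\ |\mathrm{Disc}(x)|/q^8=\mu}}\frac{\widehat{\Phi}_q(x)}{|\mathrm{Stab}(x)|}. \] Then for every $\epsilon>0$, $\sum_{\mu<X}|b^{\pm}_q(\mu)|\ll_\epsilon q^{1+\epsilon}X$ uniformly in $q$ and $X>0$.
   Context: $V_{\mathbb{Z}}$ is the lattice of integral binary cubic forms $au^3+bu^2v+cuv^2+dv^3$ ($a,b,c,d\in\mathbb{Z}$), and $\widehat V_{\mathbb{Z}}\subset V_{\mathbb{Z}}$ the sublattice with $b,c\in3\mathbb{Z}$. $\mathrm{Disc}(f)=b^2c^2-4ac^3-4b^3d-27a^2d^2+18abcd$. $\mathrm{SL}_2(\mathbb{Z})$ acts by $(\gamma f)(u,v)=f((u,v)\gamma)$, and $\mathrm{Stab}(x)$ is the stabilizer of $x$ in $\mathrm{SL}_2(\mathbb{Z})$. For a prime $p$, $U_p\subset V_{\mathbb{Z}}$ is the set of forms $f$ such that $f$ is not a multiple of $p$ and there is no $\mathrm{GL}_2(\mathbb{Z})$-transform of $f$ whose $u^3$-coefficient is divisible by $p^2$ and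 whose $u^2v$-coefficient is divisible by $p$ (equivalently, the cubic ring attached to $f$ by the Delone–Faddeev correspondence is maximal at $p$); membership depends only on $f$ mod $p^2$. $\Phi_q$ is the characteristic function, on $V_{\mathbb{Z}/q^2\mathbb{Z}}$, of forms not in $U_p$ for every prime $p\mid q$. For $x\in\widehat V_{\mathbb{Z}}$ with coordinates $(x_1,\dots,x_4)$ and $y$ with coordinates $(y_1,\dots,y_4)$, $[x,y]=x_4y_1-\tfrac13x_3y_2+\tfrac13x_2y_3-x_1y_4$, and $\widehat\Phi_q(x)=q^{-8}\sum_{y\in V_{\mathbb{Z}/q^2\mathbb{Z}}}\Phi_q(y)\exp(2\pi i[x,y]/q^2)$. *)

(* Defs.v *)
From HB Require Import structures.
From mathcomp Require Import all_boot all_order all_algebra.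
From mathcomp Require Import complex ring.
From mathcomp Require Import finmap.
From mathcomp Require Import all_classical all_reals all_analysis.

Set Implicit Arguments.
Unset Strict Implicit.
Unset Printing Implicit Defensive.

Import Order.TTheory GRing.Theory Num.Theory.

Local Open Scope classical_set_scope.
Local Open Scope ring_scope.

(* The binary cubic form a u^3 + b u^2 v + c u v^2 + d v^3 is (a, b, c, d). *)
Definition form (T : Type) : Type := (T * T * T * T)%type.

Definition feval (f : form int) (u v : int) : int :=
  let: (a, b, c, d) := f in
  a * u ^+ 3 + b * u ^+ 2 * v + c * u * v ^+ 2 + d * v ^+ 3.

Definition Disc (f : form int) : int :=
  let: (a, b, c, d) := f in
  b ^+ 2 * c ^+ 2 - 4 * a * c ^+ 3 - 4 * b ^+ 3 * d - 27 * a ^+ 2 * d ^+ 2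
  + 18 * a * b * c * d.

(* Coefficients of f((u, v)g); see [feval_act]. *)
Definition act (g : 'M[int]_2) (f : form int) : form int :=
  let: (a, b, c, d) := f in
  let r := g 0 0 in let s := g 0 1 in let t := g 1 0 in let w := g 1 1 in
  (a * r ^+ 3 + b * r ^+ 2 * s + c * r * s ^+ 2 + d * s ^+ 3,
   3 * a * r ^+ 2 * t + b * (r ^+ 2 * w + 2 * r * s * t)
     + c * (2 * r * s * w + s ^+ 2 * t) + 3 * d * s ^+ 2 * w,
   3 * a * r * t ^+ 2 + b * (2 * r * t * w + s * t ^+ 2)
     + c * (r * w ^+ 2 + 2 * s * t * w) + 3 * d * s * w ^+ 2,
   a * t ^+ 3 + b * t ^+ 2 * w + c * t * w ^+ 2 + d * w ^+ 3).

Lemma feval_act (g : 'M[int]_2) (f : form int) (u v : int) :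
  let uvg := \row_(j < 2) [:: u; v]`_j *m g in
  feval (act g f) u v = feval f (uvg 0 0) (uvg 0 1).
Proof.
case: f => [[[a b] c] d]; rewrite /= !mxE !big_ord_recl !big_ord0 !mxE /=.
have -> : lift ord0 ord0 = 1 :> 'I_2 by exact/val_inj.
by ring.
Qed.

Definition dual_lattice : set (form int) :=
  [set x | let: (_, b, c, _) := x in (3 %| b)%Z && (3 %| c)%Z].

Definition SL2Z : set 'M[int]_2 := [set g | \det g = 1].

Definition Stab (x : form int) : set 'M[int]_2 :=
  [set g | SL2Z g /\ act g x = x].

Definition SL2Z_orbit (x : form int) : set (form int) :=
  [set act g x | g in SL2Z].

Definition multiple_of (p : nat) (f : form int) : Prop :=
  let: (a, b, c, d) := f in
  [&& (p %| a)%Z, (p %| b)%Z, (p %| c)%Z & (p %| d)%Z].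

Definition U (p : nat) : set (form int) :=
  [set f | ~ multiple_of p f /\
     ~ exists2 g : 'M[int]_2, g \in unitmx &
       let: (a, b, _, _) := act g f in
       ((p ^ 2)%N %| a)%Z && (p %| b)%Z].

(* A residue class modulo n is represented by an element of 'I_n (and not of
   'Z_n, which is Z/2Z when n = 1), and lifted to {0, ..., n - 1}. *)
Definition lift_form (n : nat) (y : form 'I_n) : form int :=
  let: (a, b, c, d) := y in (a%:Z, b%:Z, c%:Z, d%:Z).

Lemma U_mod (p : nat) (f f' : form int) :
  let: (a, b, c, d) := f in
  let: (a', b', c', d') := f' in
  ((p ^ 2)%N %| a - a')%Z -> ((p ^ 2)%N %| b - b')%Z ->
  ((p ^ 2)%N %| c - c')%Z -> ((p ^ 2)%N %| d - d')%Z ->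
  U p f' -> U p f.
Proof.
case: f => [[[a b] c] d]; case: f' => [[[a' b'] c'] d'] ha hb hc hd.
have dp (x : int) : ((p ^ 2)%N %| x)%Z -> (p %| x)%Z.
  by apply: dvdz_trans; rewrite dvdzE /= dvdn_exp.
have dB (m x x' : int) : (m %| x - x')%Z -> (m %| x)%Z -> (m %| x')%Z.
  move=> h hx; have -> : x' = x - (x - x') by ring.
  exact: rpredB.
move=> [nm ng]; split.
  apply: contra_not nm => /and4P[pa pb pc pd]; apply/and4P; split.
  - exact: dB (dp _ ha) pa.
  - exact: dB (dp _ hb) pb.
  - exact: dB (dp _ hc) pc.
  - exact: dB (dp _ hd) pd.
apply: contra_not ng => -[g ug /= /andP[h1 h2]]; exists g => //=.
apply/andP; split.
  apply: (dB _ _ _ _ h1); set r := g 0 0; set s := g 0 1.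
  have -> : a * r ^+ 3 + b * r ^+ 2 * s + c * r * s ^+ 2 + d * s ^+ 3 -
    (a' * r ^+ 3 + b' * r ^+ 2 * s + c' * r * s ^+ 2 + d' * s ^+ 3) =
    r ^+ 3 * (a - a') + (r ^+ 2 * s) * (b - b') + (r * s ^+ 2) * (c - c')
    + s ^+ 3 * (d - d') by ring.
  by do 3?[apply: rpredD]; apply: dvdz_mull.
apply: (dB _ _ _ _ h2); set r := g 0 0; set s := g 0 1; set t := g 1 0; set w := g 1 1.
have -> : 3 * a * r ^+ 2 * t + b * (r ^+ 2 * w + 2 * r * s * t)
     + c * (2 * r * s * w + s ^+ 2 * t) + 3 * d * s ^+ 2 * w -
    (3 * a' * r ^+ 2 * t + b' * (r ^+ 2 * w + 2 * r * s * t)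
     + c' * (2 * r * s * w + s ^+ 2 * t) + 3 * d' * s ^+ 2 * w) =
    (3 * r ^+ 2 * t) * (a - a') + (r ^+ 2 * w + 2 * r * s * t) * (b - b')
    + (2 * r * s * w + s ^+ 2 * t) * (c - c') + (3 * s ^+ 2 * w) * (d - d').
  by ring.
by do 3?[apply: rpredD]; apply/dvdz_mull/dp.
Qed.

Section Coefficients.
Variable R : realType.

(* The choice of lift is immaterial: by [U_mod], membership in U p for p | q
   depends only on the class modulo q^2. *)
Definition Phi (q : nat) (y : form 'I_(q ^ 2)) : R :=
  \1_[set y : form 'I_(q ^ 2) |
      forall p : nat, prime p -> (p %| q)%N -> ~ U p (lift_form y)] y.

Definition pairing (x y : form int) : R :=
  let: (x1, x2, x3, x4) := x in
  let: (y1, y2, y3, y4) := y in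
  x4%:~R * y1%:~R - 3^-1 * x3%:~R * y2%:~R
  + 3^-1 * x2%:~R * y3%:~R - x1%:~R * y4%:~R.

Definition expi (t : R) : R[i] := (cos t +i* sin t)%C.

Definition Phihat (q : nat) (x : form int) : R[i] :=
  (q%:R ^+ 8)^-1 *
  \sum_(y : form 'I_(q ^ 2))
    (Phi y)%:C%C * expi (2 * pi * pairing x (lift_form y) / q%:R ^+ 2).

(* The sign is (-1) ^ e. *)
Definition forms_at (q : nat) (e : bool) (mu : R) : set (form int) :=
  [set x | [/\ dual_lattice x, 0 < (-1) ^+ e * Disc x &
               `|Disc x|%:~R / q%:R ^+ 8 = mu]].

(* There are finitely many orbits, and finite stabilizers, since Disc x != 0.
   Both factors of the summand are constant on orbits, so it is computed at
   a chosen representative. *)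
Definition bcoef (q : nat) (e : bool) (mu : R) : R[i] :=
  \sum_(O \in [set SL2Z_orbit x | x in forms_at q e mu])
    let x := xget (0, 0, 0, 0) O in
    Phihat q x / #|` fset_set (Stab x)|%:R.

Definition positive_multiples (q : nat) : set R :=
  [set mu | 0 < mu /\ exists k : int, mu = k%:~R / q%:R ^+ 8].

Definition cmod (z : R[i]) : R := complex.Re `|z|.

End Coefficients.

Definition squarefree (q : nat) : Prop :=
  forall d : nat, (d ^ 2 %| q)%N -> d = 1%N.

(* Main.v *)
(* Write a form of the dual lattice as x = (a, 3b, 3c, d). Its Hessian A u^2 + B u v + C v^2, with A = b^2 - ac,
   B = bc - ad and C = c^2 - bd, is an SL2-covariant of discriminant -Disc(x)/27; call gcd(A, B, C) the content
   of x.

   A form is nonmaximal at p iff it is divisible by p or, at some point of the projective line over F_p,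
   vanishes modulo p^2 together with its derivative modulo p. By inclusion-exclusion the indicator function of
   these forms is a combination of indicators of lattices whose duals consist of x with p | content(x); hence
   |Phihat_q(x)| is at most the product over p | q of weights of size p^-2, p^-3, p^-3, p^-5, 0 according as p^2
   | x, p | x, p^2 | content(x), p | content(x), or none of these.

   By Davenport's reduction there are O(Y) classes with 0 < |Disc| <= Y. Two classes with the same discriminant,
   the same content n and the same local data at n compose, in the manner of Dirichlet, to a class of content 1
   and discriminant Disc/n^2, and composing with a fixed class is injective. So there are O(4^omega(Q) Y/Q^2)
   classes whose content is divisible by Q. By induction on the primes of q, dividing x by p or replacing a form
   (p^2 a, p^2 b, p c, d) by (a, p b, p c, p d), the sum of the weights over the classes with |Disc| <= Y is
   O(22^omega(q) Y/q^7). Take Y = q^8 X. *)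

From mathcomp Require Import ring lra zify.
From mathcomp Require Import all_boot all_order all_algebra all_field.
From mathcomp Require Import boolp classical_sets reals.
Require Import Defs.

Set Implicit Arguments.
Unset Strict Implicit.
Unset Printing Implicit Defensive.

Import Order.TTheory GRing.Theory Num.Theory.

Local Open Scope ring_scope.

(** * Binary cubic forms and their Hessians *)

(** The exponents leave no slack: at a prime with p | content the weight p^-5 must be matched by a
    proportion p^-2 of such classes, uniformly in the modulus, whereas reduction theory bounds only
    the number of all classes. Composition supplies the proportion because it trades the content n
    for a factor n^2 of the discriminant. Ideal classes are avoided. If S^2 = [disc4 x] and sigma =
    (B + S) / 2, then a sigma - b A has norm A^3; cube roots of this number and of its conjugate are
    the coordinates of a [frame], in which equivalence of forms becomes equality of lattices of rank
    two, up to a cube root of unity. The same coordinates, taken real, serve in reduction theory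
    when the Hessian is indefinite. A class is not a product of local objects, so primes are removed
    one at a time by maps preserving the data at the other primes. One of these maps produces forms
    with p | content; hence the induction runs over two lists of primes, one for the weights and one
    for divisibility of the content. *)

(* Below, (a, b, c, d) stands for the form (a, 3b, 3c, d) of the dual lattice: see [act_emb]. *)
Definition sub4 (r s t w : int) (x : form int) : form int :=
  let: (a, b, c, d) := x in
  (a * r ^+ 3 + 3 * b * r ^+ 2 * s + 3 * c * r * s ^+ 2 + d * s ^+ 3,
   a * r ^+ 2 * t + b * (r ^+ 2 * w + 2 * r * s * t)
     + c * (2 * r * s * w + s ^+ 2 * t) + d * s ^+ 2 * w,
   a * r * t ^+ 2 + b * (2 * r * t * w + s * t ^+ 2)
     + c * (r * w ^+ 2 + 2 * s * t * w) + d * s * w ^+ 2,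
   a * t ^+ 3 + 3 * b * t ^+ 2 * w + 3 * c * t * w ^+ 2 + d * w ^+ 3).

Definition eqv (x y : form int) : Prop :=
  exists r s t w : int, r * w - s * t = 1 /\ y = sub4 r s t w x.

Definition hA (x : form int) : int := let: (a, b, c, d) := x in b ^+ 2 - a * c.
Definition hB (x : form int) : int := let: (a, b, c, d) := x in b * c - a * d.
Definition hC (x : form int) : int := let: (a, b, c, d) := x in c ^+ 2 - b * d.
Definition disc4 (x : form int) : int := hB x ^+ 2 - 4 * hA x * hC x.
Definition coef0 (x : form int) : int := let: (a, b, c, d) := x in a.
Definition coef1 (x : form int) : int := let: (a, b, c, d) := x in b.

Lemma sub4_comp r s t w r' s' t' w' x :
  sub4 r' s' t' w' (sub4 r s t w x) =
  sub4 (r' * r + s' * t) (r' * s + s' * w) (t' * r + w' * t) (t' * s + w' * w) x.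
Proof. case: x => [[[a b] c] d]; rewrite /sub4; congr (_, _, _, _); ring. Qed.

Lemma sub4_1 x : sub4 1 0 0 1 x = x.
Proof. case: x => [[[a b] c] d]; rewrite /sub4; congr (_, _, _, _); ring. Qed.

Lemma eqv_refl x : eqv x x.
Proof. by exists 1, 0, 0, 1; rewrite sub4_1; split => //; ring. Qed.

Lemma eqv_trans y x z : eqv x y -> eqv y z -> eqv x z.
Proof.
move=> [r [s [t [w [e ->]]]]] [r' [s' [t' [w' [e' ->]]]]].
rewrite sub4_comp; do 4!eexists; split; last by [].
transitivity ((r * w - s * t) * (r' * w' - s' * t')); [by ring|by rewrite e e' mulr1].
Qed.

Lemma eqv_sym x y : eqv x y -> eqv y x.
Proof.
move=> [r [s [t [w [e ->]]]]]; exists w, (- s), (- t), r; split.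
  by rewrite -e; ring.
rewrite sub4_comp -[LHS]sub4_1; congr (sub4 _ _ _ _ _); try ring.
  by rewrite -e; ring.
by rewrite -e; ring.
Qed.

(** The covariance identities below hold only modulo r w - s t = 1; multiplying one side by the
    square of the determinant turns them into polynomial identities. *)
Lemma det1_sqr (r s t w u v : int) :
  r * w - s * t = 1 -> u = v * (r * w - s * t) ^+ 2 -> u = v.
Proof. by move=> -> ->; rewrite expr1n mulr1. Qed.

Section Hessian.
Variables (r s t w : int).
Hypothesis det1 : r * w - s * t = 1.

Lemma hA_sub4 x : hA (sub4 r s t w x) = hA x * r ^+ 2 + hB x * r * s + hC x * s ^+ 2.
Proof.
case: x => [[[a b] c] d]; apply: (det1_sqr det1); rewrite /=; ring.
Qed.

Lemma hB_sub4 x : hB (sub4 r s t w x) =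
  2 * hA x * r * t + hB x * (r * w + s * t) + 2 * hC x * s * w.
Proof.
case: x => [[[a b] c] d]; apply: (det1_sqr det1); rewrite /=; ring.
Qed.

Lemma hC_sub4 x : hC (sub4 r s t w x) = hA x * t ^+ 2 + hB x * t * w + hC x * w ^+ 2.
Proof.
case: x => [[[a b] c] d]; apply: (det1_sqr det1); rewrite /=; ring.
Qed.

Lemma disc4_sub4 x : disc4 (sub4 r s t w x) = disc4 x.
Proof.
rewrite /disc4 hA_sub4 hB_sub4 hC_sub4; apply: (det1_sqr det1); ring.
Qed.
End Hessian.

Lemma disc4_eqv x y : eqv x y -> disc4 y = disc4 x.
Proof. by move=> [r [s [t [w [e ->]]]]]; exact: disc4_sub4. Qed.

(** A linear recurrence for the coefficients: when A is nonzero, a, b and the Hessian determine c,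
    and then d. *)
Lemma coef2_hess (a b c d : int) :
  c * hA (a, b, c, d) = b * hB (a, b, c, d) - a * hC (a, b, c, d).
Proof. rewrite /=; ring. Qed.

Lemma coef3_hess (a b c d : int) :
  d * hA (a, b, c, d) = c * hB (a, b, c, d) - b * hC (a, b, c, d).
Proof. rewrite /=; ring. Qed.

(** Leading coefficients of the classical syzygy G^2 - D f^2 = 4 H^3 between a cubic f, its Hessian
    H and its cubic covariant G. *)
Lemma syzygy x :
  (coef0 x * hB x - 2 * coef1 x * hA x) ^+ 2 - disc4 x * coef0 x ^+ 2 = 4 * hA x ^+ 3.
Proof. case: x => [[[a b] c] d]; rewrite /disc4 /=; ring. Qed.

(* Over F, S x = (x1 u + x2 v)^3 - (e1 u + e2 v)^3, the Hessian being the product of the two linear forms. *)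
Definition frame (F : fieldType) (S x1 x2 e1 e2 : F) (x : form int) : Prop :=
  let: (a, b, c, d) := x in
  [/\ x1 * e2 - x2 * e1 = S,
      S * a%:~R = x1 ^+ 3 - e1 ^+ 3,
      S * b%:~R = x1 ^+ 2 * x2 - e1 ^+ 2 * e2,
      S * c%:~R = x1 * x2 ^+ 2 - e1 * e2 ^+ 2 &
      S * d%:~R = x2 ^+ 3 - e2 ^+ 3].

Section Frames.
Variable F : numFieldType.
Implicit Types S : F.

Lemma frame_sub4 S x1 x2 e1 e2 x (r s t w : int) :
  r * w - s * t = 1 -> frame S x1 x2 e1 e2 x ->
  frame S (r%:~R * x1 + s%:~R * x2) (t%:~R * x1 + w%:~R * x2)
    (r%:~R * e1 + s%:~R * e2) (t%:~R * e1 + w%:~R * e2) (sub4 r s t w x).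
Proof.
case: x => [[[a b] c] d] det1 [eS ea eb ec ed]; rewrite /sub4 /frame.
rewrite !(intrD, intrM, rmorphXn) /=.
have {}det1 : (r%:~R * w%:~R - s%:~R * t%:~R : F) = 1.
  by rewrite -!intrM -intrB det1.
set r' := r%:~R in det1 *; set s' := s%:~R in det1 *.
set t' := t%:~R in det1 *; set w' := w%:~R in det1 *.
split.
- by transitivity (S * (r' * w' - s' * t')); [rewrite -eS; ring|rewrite det1 mulr1].
- transitivity (r' ^+ 3 * (S * a%:~R) + 3 * r' ^+ 2 * s' * (S * b%:~R)
    + 3 * r' * s' ^+ 2 * (S * c%:~R) + s' ^+ 3 * (S * d%:~R)); first ring.
  rewrite ea eb ec ed; ring.
- transitivity (r' ^+ 2 * t' * (S * a%:~R) + (r' ^+ 2 * w' + 2 * r' * s' * t') * (S * b%:~R)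
    + (2 * r' * s' * w' + s' ^+ 2 * t') * (S * c%:~R) + s' ^+ 2 * w' * (S * d%:~R));
    first ring.
  rewrite ea eb ec ed; ring.
- transitivity (r' * t' ^+ 2 * (S * a%:~R) + (2 * r' * t' * w' + s' * t' ^+ 2) * (S * b%:~R)
    + (r' * w' ^+ 2 + 2 * s' * t' * w') * (S * c%:~R) + s' * w' ^+ 2 * (S * d%:~R));
    first ring.
  rewrite ea eb ec ed; ring.
- transitivity (t' ^+ 3 * (S * a%:~R) + 3 * t' ^+ 2 * w' * (S * b%:~R)
    + 3 * t' * w' ^+ 2 * (S * c%:~R) + w' ^+ 3 * (S * d%:~R)); first ring.
  rewrite ea eb ec ed; ring.
Qed.

Lemma frame_det S x1 x2 e1 e2 x : frame S x1 x2 e1 e2 x -> x1 * e2 - x2 * e1 = S.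
Proof. by case: x => [[[a b] c] d] []. Qed.

Lemma frame_coef0 S x1 x2 e1 e2 x :
  frame S x1 x2 e1 e2 x -> S * (coef0 x)%:~R = x1 ^+ 3 - e1 ^+ 3.
Proof. by case: x => [[[a b] c] d] []. Qed.

Lemma frame_hess S x1 x2 e1 e2 x : S != 0 -> frame S x1 x2 e1 e2 x ->
  [/\ (hA x)%:~R = x1 * e1, (hB x)%:~R = x1 * e2 + x2 * e1 & (hC x)%:~R = x2 * e2].
Proof.
case: x => [[[a b] c] d] S0 [eS ea eb ec ed].
have S20 : S ^+ 2 != 0 by rewrite expf_neq0.
split; apply: (mulfI S20); rewrite !(intrB, intrM, rmorphXn) /=.
- transitivity ((S * b%:~R) ^+ 2 - (S * a%:~R) * (S * c%:~R)); first ring.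
  rewrite ea eb ec -eS; ring.
- transitivity ((S * b%:~R) * (S * c%:~R) - (S * a%:~R) * (S * d%:~R)); first ring.
  rewrite ea eb ec ed -eS; ring.
- transitivity ((S * c%:~R) ^+ 2 - (S * b%:~R) * (S * d%:~R)); first ring.
  rewrite eb ec ed -eS; ring.
Qed.

Lemma frame_inj S x1 x2 e1 e2 x y : S != 0 ->
  frame S x1 x2 e1 e2 x -> frame S x1 x2 e1 e2 y -> x = y.
Proof.
case: x => [[[a b] c] d]; case: y => [[[a' b'] c'] d'] S0.
move=> [eS ea eb ec ed] [_ ea' eb' ec' ed'].
by congr (_, _, _, _); apply/eqP; rewrite -(eqr_int F); apply/eqP/(mulfI S0);
  rewrite ?ea ?eb ?ec ?ed ?ea' ?eb' ?ec' ?ed'.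
Qed.

(** Only x1 has to be chosen: the relations x1 e1 = A, x1 e2 = (B + S) / 2 and x2 e1 = (B - S) / 2
    force the rest. *)
Lemma frame_exists S x1 x : hA x != 0 -> S ^+ 2 = (disc4 x)%:~R ->
  x1 ^+ 3 = (coef0 x)%:~R * (((hB x)%:~R + S) / 2) - (coef1 x)%:~R * (hA x)%:~R ->
  exists x2 e1 e2, frame S x1 x2 e1 e2 x.
Proof.
case: x => [[[a b] c] d] A0 hS hx1.
have := congr1 (fun z : int => z%:~R : F) (coef2_hess a b c d).
have := congr1 (fun z : int => z%:~R : F) (coef3_hess a b c d).
have := congr1 (fun z : int => z%:~R : F) (syzygy (a, b, c, d)).
have {A0} : ((hA (a, b, c, d))%:~R : F) != 0 by rewrite intr_eq0.
move: hS hx1; rewrite /disc4 /coef0 /coef1.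
move: (hA _) (hB _) (hC _) => A B C.
rewrite !(intrB, intrM, rmorphXn, intrD) /=.
move: (A%:~R) (B%:~R) (C%:~R) => {}A {}B {}C.
rewrite /frame.
move: (a%:~R) (b%:~R) (c%:~R) (d%:~R) => {}a {}b {}c {}d.
move=> hS hx1 A0 syz hd hc.
have two0 : (2 : F) != 0 by rewrite pnatr_eq0.
set sg := (B + S) / 2; set sb := (B - S) / 2.
have eN : sg * sb = A * C.
  apply: (mulfI two0); apply: (mulfI two0).
  have -> : 2 * (2 * (sg * sb)) = B ^+ 2 - S ^+ 2 by rewrite /sg /sb; field.
  rewrite hS; ring.
have eT : sg + sb = B by rewrite /sg /sb; field.
have eD : sg - sb = S by rewrite /sg /sb; field.
(* The syzygy read as a norm equation; it makes A / x1 a cube root of the conjugate of x1 ^ 3. *)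
have syz' : (a * sg - b * A) * (a * sb - b * A) = A ^+ 3.
  apply: (mulfI two0); apply: (mulfI two0).
  have -> : 2 * (2 * A ^+ 3) = 4 * A ^+ 3 by ring.
  by rewrite -syz -hS /sg /sb; field.
rewrite -/sg in hx1.
have x10 : x1 != 0.
  have := expf_neq0 3 A0; rewrite -syz' -hx1 mulf_eq0 expf_eq0 negb_or.
  by case/andP.
have e13 : (A / x1) ^+ 3 = a * sb - b * A.
  apply: (mulfI (expf_neq0 3 x10)); rewrite [in RHS]hx1 syz'; by field.
exists (x1 * sb / A), (A / x1), (A / x1 * sg / A).
have -> : A / x1 * sg / A = sg / x1 by field; apply/andP.
split.
- by rewrite -eD; field; apply/andP.
- rewrite hx1 e13 -eD; ring.
- transitivity (x1 ^+ 3 * sb / A - (A / x1) ^+ 3 * sg / A).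
    by rewrite hx1 e13 -eD; field.
  by field; apply/andP.
- have ec : c = (b * B - a * C) / A by rewrite -hc; field.
  transitivity (x1 ^+ 3 * sb ^+ 2 / A ^+ 2 - (A / x1) ^+ 3 * sg ^+ 2 / A ^+ 2).
    apply: (mulfI (expf_neq0 2 A0)).
    rewrite ec hx1 e13 -eD -eT.
    transitivity (A * (sg - sb) * (b * (sg + sb)) - a * (A * C) * (sg - sb)); first by field.
    by rewrite -eN; field.
  by field; apply/andP.
- have ec : c = (b * B - a * C) / A by rewrite -hc; field.
  have ed : d = (c * B - b * C) / A by rewrite -hd; field.
  transitivity (x1 ^+ 3 * sb ^+ 3 / A ^+ 3 - (A / x1) ^+ 3 * sg ^+ 3 / A ^+ 3).
    apply: (mulfI (expf_neq0 3 A0)).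
    rewrite ed ec hx1 e13 -eD -eT.
    transitivity (A * (sg - sb) * (b * (sg + sb) ^+ 2) - a * (A * C) * (sg - sb) * (sg + sb) - b * A * (A * C) * (sg - sb)); first by field.
    by rewrite -eN; field.
  by field; apply/andP.
Qed.
End Frames.

Lemma hA_neq0_eqv x : disc4 x != 0 -> exists2 y, eqv x y & hA y != 0.
Proof.
move=> D0; have [A0|A0] := eqVneq (hA x) 0; last by exists x => //; exact: eqv_refl.
have B0 : hB x != 0.
  by apply: contra_neq D0 => B0; rewrite /disc4 A0 B0; ring.
have ex (r : int) : r * 0 - 1 * (-1) = 1 by ring.
(* The Hessian is B u v + C v^2; its values at (1, 1) and (-1, 1) differ by 2 B, so one of them is
   nonzero. *)
have [E|E] := eqVneq (hB x + hC x) 0.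
- exists (sub4 (-1) 1 (-1) 0 x); first by exists (-1), 1, (-1), 0.
  rewrite hA_sub4 ?ex // A0.
  apply: contra_neq B0 => h; lia.
- exists (sub4 1 1 (-1) 0 x); first by exists 1, 1, (-1), 0.
  rewrite hA_sub4 ?ex // A0.
  apply: contra_neq E => h; lia.
Qed.

(** * Reduction of forms of nonzero discriminant *)

Section Reduction.
Variable R : realType.

(* Gauss reduction: each step at least halves the leading coefficient as long as its square exceeds 4 D. *)
Lemma posdef_reduction (k : nat) (p q r D : R) : 0 < p -> 0 < D ->
  p * r - q ^+ 2 = D -> p ^+ 2 <= 4 ^+ k * (4 * D) ->
  exists u v t w : int, u * w - v * t = 1 /\
    (p * u%:~R ^+ 2 + 2 * q * u%:~R * v%:~R + r * v%:~R ^+ 2) ^+ 2 <= 4 * D.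
Proof.
elim: k p q r => [|k IH] p q r p0 D0 eD hp.
  exists 1, 0, 0, 1; split; first ring.
  by rewrite expr0 mul1r in hp; rewrite (_ : p * _ + _ + _ = p) //; ring.
have [hle|hgt] := leP (p ^+ 2) (4 * D).
  exists 1, 0, 0, 1; split; first ring.
  by rewrite (_ : p * _ + _ + _ = p) //; ring.
(* - q / p rounded to a nearest integer, so that the new middle coefficient is at most p / 2 in
   absolute value; as 4 D < p^2, the other end coefficient r' is then at most p / 2 too. *)
pose j : int := Num.floor (2^-1 - q / p).
have /andP[j1] := floor_itv (2^-1 - q / p); rewrite -/j intrD => j2.
have q1 : q + j%:~R * p <= p / 2.
  have := ler_wpM2r (ltW p0) j1; rewrite mulrBl divfK ?gt_eqF //; lra.
have q2 : - (p / 2) <= q + j%:~R * p.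
  have := ler_wpM2r (ltW p0) (ltW j2); rewrite mulrBl divfK ?gt_eqF //; lra.
pose q' := q + j%:~R * p; pose r' := p * j%:~R ^+ 2 + 2 * q * j%:~R + r.
have eD' : p * r' - q' ^+ 2 = D by rewrite -eD /r' /q'; ring.
have hq' : q' ^+ 2 <= p ^+ 2 / 4.
  rewrite -/q' in q1 q2; have : 0 <= (p / 2 - q') * (p / 2 + q').
    by apply: mulr_ge0; lra.
  lra.
have hr' : p * r' <= p ^+ 2 / 2 by lra.
have r'0 : 0 < r'.
  have : 0 < p * r' by have := sqr_ge0 q'; lra.
  by rewrite pmulr_rgt0.
have r'p : r' <= p / 2.
  by rewrite -(ler_pM2l p0) (le_trans hr') // expr2; lra.
have [||||u [v [t [w [det1 h]]]]] := IH r' (- q') p.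
- by [].
- by [].
- by rewrite -eD'; ring.
- have : r' ^+ 2 <= p ^+ 2 / 4.
    have : 0 <= (p / 2 - r') * (p / 2 + r') by apply: mulr_ge0; lra.
    lra.
  by move: hp; rewrite [4 ^+ _]exprS -mulrA; move: (4 ^+ k * (4 * D)) => E; lra.
exists (u * j - v), u, (t * j - w), t; split; first by rewrite -det1; ring.
rewrite !(intrB, intrM); move: h; apply: le_trans; rewrite le_eqVlt; apply/orP; left.
by apply/eqP; rewrite /r' /q'; ring.
Qed.

Lemma posdef_small_value (p q r D : R) : 0 < p -> 0 < D ->
  p * r - q ^+ 2 = D ->
  exists u v t w : int, u * w - v * t = 1 /\
    (p * u%:~R ^+ 2 + 2 * q * u%:~R * v%:~R + r * v%:~R ^+ 2) ^+ 2 <= 4 * D.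
Proof.
move=> p0 D0 eD; have D40 : 0 < 4 * D by lra.
apply: (@posdef_reduction (Num.bound (p ^+ 2 / (4 * D)))) => //.
rewrite -ler_pdivrMr // ltW // (lt_le_trans (upper_nthrootP (leqnn _))) //.
by rewrite lerXn2r ?nnegrE ?ler_nat.
Qed.

Lemma real_cbrt (c : R) : exists x : R, x ^+ 3 = c.
Proof.
pose p : {poly R} := 'X^3 - c%:P; pose M := `|c| + 1.
have pE x : p.[x] = x ^+ 3 - c by rewrite /p !hornerE.
have M1 : 1 <= M by rewrite lerDr.
have M3 : M <= M ^+ 3 by rewrite -[leLHS]expr1 ler_weXn2l.
have h1 := ler_norm c; have := ler_norm (- c); rewrite normrN => h2.
have [||x _ /eqP hx] := @Num.poly_ivt R p (- M) M.
- lra.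
- rewrite !pE exprNn -signr_odd /= expr1 mulN1r /M in M3 *; lra.
- by exists x; apply/eqP; rewrite -subr_eq0 -pE hx.
Qed.

End Reduction.

Section SmallRepresentative.
Variable R : realType.

(** The Hessian is indefinite here and is not reduced itself. In real frame coordinates it is the
    product X E, and the definite form X^2 + E^2, of determinant D, is reduced instead: a small
    value T of it bounds both A = X E and S a = X^3 - E^3. *)
Lemma small_rep_pos x : hA x != 0 -> 0 < disc4 x ->
  exists2 y, eqv x y & (coef0 y ^+ 4 <= 256 * disc4 x) && (hA y ^+ 2 <= disc4 x).
Proof.
move=> A0 D0; pose D : R := (disc4 x)%:~R.
have DR0 : 0 < D by rewrite ltr0z.
have S0 : 0 < Num.sqrt D by rewrite sqrtr_gt0.
have eS : Num.sqrt D ^+ 2 = D by rewrite sqr_sqrtr // ltW.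
have [x1 hx1] := real_cbrt ((coef0 x)%:~R * (((hB x)%:~R + Num.sqrt D) / 2)
  - (coef1 x)%:~R * (hA x)%:~R).
have [x2 [e1 [e2 fr]]] := frame_exists A0 eS hx1.
have det := frame_det fr.
have p0 : 0 < x1 ^+ 2 + e1 ^+ 2.
  rewrite lt_neqAle addr_ge0 ?sqr_ge0 // andbT eq_sym paddr_eq0 ?sqr_ge0 //.
  rewrite !expf_eq0 /=; apply: contraTN S0 => /andP[/eqP h1 /eqP h2].
  by rewrite -det h1 h2 mul0r mulr0 subrr ltxx.
have [|u [v [t [w [det1 h]]]]] :=
  @posdef_small_value R _ (x1 * x2 + e1 * e2) (x2 ^+ 2 + e2 ^+ 2) D p0 DR0 _.
  by rewrite -eS -det; ring.
exists (sub4 u v t w x); first by exists u, v, t, w.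
have fr' := frame_sub4 det1 fr.
move: h; set X := u%:~R * x1 + v%:~R * x2 in fr'; set E := u%:~R * e1 + v%:~R * e2 in fr'.
rewrite (_ : _ + _ = X ^+ 2 + E ^+ 2); last by rewrite /X /E; ring.
have [hA' _ _] := frame_hess (lt0r_neq0 S0) fr'.
have ha := frame_coef0 fr'.
set T := X ^+ 2 + E ^+ 2 => hT.
have T0 : 0 <= T by rewrite addr_ge0 ?sqr_ge0.
apply/andP; split; rewrite -(ler_int R) rmorphXn /= ?intrM -/D; last first.
  by rewrite hA'; have := sqr_ge0 (X ^+ 2 - E ^+ 2); rewrite /T in hT; lra.
set a := (coef0 _)%:~R in ha *.
(* Together with T^2 <= 4 D this gives D^2 a^4 <= 4 T^6 <= 256 D^3, the origin of 256. *)
have h1 : D * a ^+ 2 <= 2 * T ^+ 3.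
  rewrite -eS -exprMn ha -subr_ge0.
  have -> : 2 * T ^+ 3 - (X ^+ 3 - E ^+ 3) ^+ 2 =
     (X ^+ 3 + E ^+ 3) ^+ 2 + 6 * ((X * E) ^+ 2 * T) by rewrite /T; ring.
  by rewrite addr_ge0 ?sqr_ge0 // mulr_ge0 // mulr_ge0 ?sqr_ge0.
have D0' := ltW DR0.
have h2 : (D * a ^+ 2) ^+ 2 <= (2 * T ^+ 3) ^+ 2.
  have h0 : 0 <= D * a ^+ 2 by exact: mulr_ge0 D0' (sqr_ge0 _).
  by rewrite lerXn2r ?nnegrE // (le_trans h0).
have h3 : (T ^+ 2) ^+ 3 <= (4 * D) ^+ 3.
  by rewrite lerXn2r ?nnegrE ?sqr_ge0 // (le_trans (sqr_ge0 T)).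
rewrite -(ler_pM2l (exprn_gt0 2 DR0)).
have -> : D ^+ 2 * a ^+ 4 = (D * a ^+ 2) ^+ 2 by ring.
apply: (le_trans h2).
have -> : (2 * T ^+ 3) ^+ 2 = 4 * (T ^+ 2) ^+ 3 by ring.
lra.
Qed.

(** The Hessian is definite and is reduced directly. The leading coefficient is then controlled by
    the syzygy, where G^2 and E a^2 have the same sign, E being - [disc4 x]. *)
Lemma small_rep_neg x : disc4 x < 0 ->
  exists2 y, eqv x y & (coef0 y ^+ 4 <= 256 * - disc4 x) && (hA y ^+ 2 <= - disc4 x).
Proof.
move=> D0.
have AC : 4 * hA x * hC x > hB x ^+ 2 by move: D0; rewrite /disc4; lia.
have [e he p0] : exists2 e : int, e = 1 \/ e = -1 & 0 < e * hA x.
  have : hA x != 0.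
    by apply: contraTneq AC => ->; rewrite mulr0 mul0r -leNgt sqr_ge0.
  rewrite neq_lt => /orP[h|h]; [exists (-1) | exists 1]; rewrite ?mulN1r ?mul1r ?oppr_gt0 //.
    by right.
  by left.
pose c (n : int) : R := n%:~R.
have [|||u [v [t [w [det1 h]]]]] :=
  @posdef_small_value R (c (e * hA x)) (c (e * hB x) / 2) (c (e * hC x)) (c (- disc4 x) / 4) _ _ _.
- by rewrite ltr0z.
- by rewrite divr_gt0 // ltr0z oppr_gt0.
- by case: he => ->; rewrite /c /disc4 !(intrN, intrM, intrB, rmorphXn) /=; field.
exists (sub4 u v t w x); first by exists u, v, t, w.
have hA2 : hA (sub4 u v t w x) ^+ 2 <= - disc4 x.
  rewrite -(ler_int R); move: h; rewrite [4 * _]mulrC divfK ?pnatr_eq0 //.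
  apply: le_trans; rewrite le_eqVlt; apply/orP; left; apply/eqP.
  rewrite hA_sub4 //.
  by case: he => ->; rewrite /c !(intrN, intrM, intrD, rmorphXn) /=; field.
rewrite hA2 andbT.
have := syzygy (sub4 u v t w x); rewrite disc4_sub4 //.
set G := coef0 _ * _ - _ => syz.
pose E := - disc4 x; have E0 : 0 < E by rewrite oppr_gt0.
have {syz} h1 : E * coef0 (sub4 u v t w x) ^+ 2 <= 4 * hA (sub4 u v t w x) ^+ 3.
  by rewrite -syz mulNr lerDr sqr_ge0.
move: hA2 E0 h1; rewrite -/E.
move: (hA (sub4 _ _ _ _ _)) (coef0 (sub4 _ _ _ _ _)) E => A a {D0 AC h}E hA2 E0 h1.
have h2 : (E * a ^+ 2) ^+ 2 <= (4 * A ^+ 3) ^+ 2.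
  have h0 : 0 <= E * a ^+ 2 by rewrite mulr_ge0 ?sqr_ge0 // ltW.
  by rewrite lerXn2r ?nnegrE // (le_trans h0).
have h3 : (A ^+ 2) ^+ 3 <= E ^+ 3.
  by rewrite lerXn2r ?nnegrE ?sqr_ge0 // ltW.
rewrite -(ler_pM2l (exprn_gt0 2 E0)).
have -> : E ^+ 2 * a ^+ 4 = (E * a ^+ 2) ^+ 2 by ring.
apply: (le_trans h2).
have -> : (4 * A ^+ 3) ^+ 2 = 16 * (A ^+ 2) ^+ 3 by ring.
have -> : E ^+ 2 * (256 * E) = 256 * E ^+ 3 by ring.
move: h3 (exprn_gt0 3 E0); move: ((A ^+ 2) ^+ 3) (E ^+ 3) => m n; lia.
Qed.

Lemma small_rep x : disc4 x != 0 ->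
  exists2 y, eqv x y & (coef0 y ^+ 4 <= 256 * `|disc4 x|) && (hA y ^+ 2 <= `|disc4 x|).
Proof.
move=> D0; move: (D0); rewrite neq_lt => /orP[h|h].
  by rewrite ltr0_norm //; exact: small_rep_neg.
have [y xy A0] := hA_neq0_eqv D0.
rewrite gtr0_norm // -(disc4_eqv xy).
have [|z yz hz] := small_rep_pos A0; first by rewrite (disc4_eqv xy).
by exists z => //; exact: eqv_trans xy yz.
Qed.
End SmallRepresentative.

(** * Davenport's bound for the number of classes *)

(** A bound for the number of classes is stated as a bound for the size of every list of pairwise
    inequivalent forms. *)
Definition ineqs (s : seq (form int)) : bool := pairwise (fun x y => ~~ `[< eqv x y >]) s.

Lemma ineqs_uniq s : ineqs s -> uniq s.
Proof.
rewrite uniq_pairwise; apply: sub_pairwise => x y /= /asboolPn h.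
by apply: contra_notN h => /eqP ->; exact: eqv_refl.
Qed.

Lemma ineqs_filter p s : ineqs s -> ineqs (filter p s).
Proof. exact: pairwise_filter. Qed.

Lemma ineqs_map f s : {in s &, forall x y, eqv (f x) (f y) -> eqv x y} ->
  ineqs s -> ineqs (map f s).
Proof.
elim: s => [//|x s IH] h /=; rewrite /ineqs /= => /andP[/allP hx hs].
apply/andP; split.
  apply/allP => _ /mapP[y ys ->]; have /asboolPn hxy := hx _ ys.
  by apply/asboolPn; apply: contra_not hxy; apply: h; rewrite ?mem_head // in_cons ys orbT.
by apply: IH => // y z ys zs; apply: h; rewrite in_cons ?ys ?zs orbT.
Qed.

Lemma ineqs_rep (P : form int -> Prop) s :
  {in s, forall x, exists2 y, eqv x y & P y} -> ineqs s ->
  exists s', [/\ ineqs s', size s' = size s & {in s', forall y, P y /\ exists2 x, x \in s & eqv x y}].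
Proof.
move=> h si; have /choice[f hf] x : exists y, x \in s -> eqv x y /\ P y.
  have [xs|xs] := boolP (x \in s); last by exists x.
  by have [y xy Py] := h x xs; exists y.
exists (map f s); split; rewrite ?size_map //.
  apply: ineqs_map si => x y xs ys e; have [ex _] := hf x xs; have [ey _] := hf y ys.
  exact: eqv_trans ex (eqv_trans e (eqv_sym ey)).
by move=> _ /mapP[x xs ->]; have [e p] := hf x xs; split => //; exists x.
Qed.

(** * Counting integers in windows *)

Section Counting.
Variable R : realType.

Lemma size_le_sum (T K : eqType) (f : T -> K) (ks : seq K) (s : seq T) :
  {in s, forall x, f x \in ks} ->
  (size s)%:R <= \sum_(k <- ks) (size [seq x <- s | f x == k])%:R :> R.
Proof.
move=> h; rewrite -natr_sum ler_nat.
elim: s h => [//|x s IH] h /=.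
have -> : (\sum_(k <- ks) size (if f x == k then x :: [seq y <- s | f y == k]
    else [seq y <- s | f y == k]) =
  \sum_(k <- ks) (f x == k) + \sum_(k <- ks) size [seq y <- s | f y == k])%N.
  by rewrite -big_split /=; apply: eq_bigr => k _; case: (f x == k).
rewrite -add1n leq_add ?IH // => [|y ys]; last by apply: h; rewrite in_cons ys orbT.
have : f x \in ks by apply: h; rewrite mem_head.
by move=> hk; rewrite (big_rem (f x)) //= eqxx leq_addr.
Qed.

Lemma size_le_mul (T K : eqType) (f : T -> K) (s : seq T) (ks : seq K) (L B : R) :
  {in s, forall x, f x \in ks} -> 0 <= B -> (size ks)%:R <= L ->
  (forall k, k \in ks -> (size [seq x <- s | f x == k])%:R <= B) ->
  (size s)%:R <= L * B.
Proof.
move=> h B0 hL hB; apply: (le_trans (size_le_sum h)).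
apply: (@le_trans _ _ (\sum_(k <- ks) B)); first by rewrite !big_seq; apply: ler_sum => k /hB.
by rewrite big_const_seq count_predT iter_addr_0 -mulr_natl ler_wpM2r.
Qed.

(** Distinct integers within L of each other have distinct residues modulo floor(L) + 1. *)
Lemma size_spread (s : seq int) (L : R) : uniq s -> 0 <= L ->
  {in s &, forall x y, `|x - y|%:~R <= L} -> (size s)%:R <= L + 1.
Proof.
move=> us L0 hs; pose N := `|Num.floor L|%N.
have NE : (N : int) = Num.floor L by rewrite gez0_abs // floor_ge0.
have NL : N%:R <= L by rewrite pmulrn NE floor_le.
pose f (x : int) := `|(x %% N.+1)%Z|%N.
have fE x : (f x : int) = (x %% N.+1)%Z by rewrite gez0_abs // modz_ge0.
have fi : {in s &, injective f}.
  move=> x y xs ys /(congr1 Posz); rewrite !fE => e.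
  have hN : `|x - y| <= N by rewrite NE floor_ge_int hs.
  have : ((N.+1 : int) %| x - y)%Z by rewrite -eqz_mod_dvd; apply/eqP.
  case/dvdzP => k hk; apply/eqP; rewrite -subr_eq0 hk mulf_eq0.
  have {}hN : `|k| * N.+1%:Z <= N%:Z by rewrite -[N.+1%:Z]ger0_norm // -normrM -hk.
  have [//|k0] := eqVneq k 0.
  have : 1 <= `|k| by rewrite -gtz0_ge1 normr_gt0.
  by nia.
have : (size (map f s) <= size (iota 0 N.+1))%N.
  apply: uniq_leq_size; first by rewrite map_inj_in_uniq.
  move=> _ /mapP[x _ ->]; rewrite mem_iota /= add0n -ltz_nat fE.
  by rewrite ltz_pmod.
rewrite size_map size_iota -(ler_nat R) -addn1 natrD => h.
by apply: (le_trans h); rewrite lerD2r.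
Qed.

(** A condition on the square of al x + be cuts out two windows, one for each sign of al x + be;
    each holds at most L + 1 integers. *)
Lemma size_square_window (s : seq int) (al be L : R) : uniq s -> 0 < al -> 0 <= L ->
  {in s &, forall x y, 0 <= al * x%:~R + be -> 0 <= al * y%:~R + be ->
     al * `|x%:~R - y%:~R| <= al * L} ->
  {in s &, forall x y, al * x%:~R + be <= 0 -> al * y%:~R + be <= 0 ->
     al * `|x%:~R - y%:~R| <= al * L} ->
  (size s)%:R <= 2 * (L + 1).
Proof.
move=> us al0 L0 hp hn.
pose key (x : int) := 0 <= al * x%:~R + be.
apply: (@size_le_mul _ _ key s [:: true; false]) => //.
- by move=> x _; case: (key x); rewrite !inE.
- by rewrite addr_ge0.
move=> k _; apply: size_spread => //; first exact: filter_uniq.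
move=> x y; rewrite !mem_filter => /andP[/eqP kx xs] /andP[/eqP ky ys].
rewrite intr_norm intrB -(ler_pM2l al0).
case: k kx ky => kx ky; first by apply: hp => //; rewrite -/(key _) (kx, ky).
by apply: hn => //; apply/ltW; rewrite ltNge -/(key _) (kx, ky).
Qed.

End Counting.

Section Window.
Variable R : realType.

Lemma norm_le_sqr (x y : R) : 0 <= y -> x ^+ 2 <= y ^+ 2 -> `|x| <= y.
Proof. by move=> y0 h; rewrite -ler_sqr ?nnegrE // real_normK ?num_real. Qed.

Lemma sqr_le_norm (x y : R) : 0 <= y -> y ^+ 2 <= x ^+ 2 -> y <= `|x|.
Proof. by move=> y0 h; rewrite -ler_sqr ?nnegrE // real_normK ?num_real. Qed.

(** Meant for x = d, the last coefficient, where a^2 x + be is the covariant G up to sign and the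
    hypothesis is the syzygy with |disc4| <= m^4. For small A, |G| is O(m^2 a). For large A, |G| is
    at least 3/2 q^3, and a variation of G^2 by 2 m^4 a^2 moves G by at most m^4 a^2 / q^3 on each
    side of 0. *)
Lemma size_syzygy_window (s : seq int) (a be A q m : R) : uniq s -> 0 < a -> 0 < m ->
  0 <= q -> q ^+ 2 = `|A| ->
  {in s, forall x, `|(a ^+ 2 * x%:~R + be) ^+ 2 - 4 * A ^+ 3| <= m ^+ 4 * a ^+ 2} ->
  (size s)%:R <= 6 * (m ^+ 2 / a) + 2 /\
    (0 < q -> (size s)%:R <= 6 * (m ^+ 4 / q ^+ 3) + 2).
Proof.
move=> us a0 m0 q0 qA hs.
have a20 : 0 < a ^+ 2 by exact: exprn_gt0.
have q30' : 0 <= q ^+ 3 by exact: exprn_ge0.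
have m20 : 0 < m ^+ 2 by exact: exprn_gt0.
have m4E : m ^+ 4 = (m ^+ 2) ^+ 2 by ring.
have m40 : 0 < m ^+ 4 by exact: exprn_gt0.
pose G (x : int) := a ^+ 2 * x%:~R + be.
have GB x y : a ^+ 2 * `|x%:~R - y%:~R| = `|G x - G y|.
  by rewrite -{1}(gtr0_norm a20) -normrM /G; congr `|_|; ring.
(* This comparison also decides which of m^2 / a and m^4 / q^3 is smaller, so the bound proved in
   each case implies the other one. *)
have [h1|h2] := leP (q ^+ 3) (m ^+ 2 * a).
  have hL : (size s)%:R <= 2 * (3 * (m ^+ 2 / a) + 1).
    have bG x : x \in s -> - (3 * (m ^+ 2 * a)) <= G x <= 3 * (m ^+ 2 * a).
      move=> /hs; rewrite -/(G x) => hx; rewrite -ler_norml; apply: norm_le_sqr.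
        by rewrite !mulr_ge0 // ltW.
      have hA3 : `|A ^+ 3| <= m ^+ 4 * a ^+ 2.
        rewrite normrX -qA.
        have -> : (q ^+ 2) ^+ 3 = (q ^+ 3) ^+ 2 by ring.
        have -> : m ^+ 4 * a ^+ 2 = (m ^+ 2 * a) ^+ 2 by ring.
        by rewrite lerXn2r ?nnegrE // mulr_ge0 // ltW.
      move: hx hA3; rewrite !ler_norml => /andP[_ hx] /andP[_ hA3].
      have : 0 <= m ^+ 4 * a ^+ 2 by rewrite mulr_ge0 // ltW.
      have -> : (3 * (m ^+ 2 * a)) ^+ 2 = 9 * (m ^+ 4 * a ^+ 2) by ring.
      move: hx hA3; move: (m ^+ 4 * a ^+ 2) (A ^+ 3) => E A3 *; lra.
    have aL : a ^+ 2 * (3 * (m ^+ 2 / a)) = 3 * (m ^+ 2 * a).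
      by field; rewrite gt_eqF.
    apply: (@size_square_window R s (a ^+ 2) be) => //.
    - by rewrite mulr_ge0 // divr_ge0 // ltW.
    - move=> x y xs ys; rewrite -/(G x) -/(G y) GB aL => gx gy.
      by have := bG x xs; have := bG y ys; rewrite ler_norml => /andP[? ?] /andP[? ?]; apply/andP; split; lra.
    - move=> x y xs ys; rewrite -/(G x) -/(G y) GB aL => gx gy.
      by have := bG x xs; have := bG y ys; rewrite ler_norml => /andP[? ?] /andP[? ?]; apply/andP; split; lra.
  split=> [|q0']; first by lra.
  have q30 : 0 < q ^+ 3 by exact: exprn_gt0.
  have : m ^+ 2 / a <= m ^+ 4 / q ^+ 3.
    rewrite ler_pdivrMr // mulrAC ler_pdivlMr // m4E [X in _ <= X * a]expr2 -mulrA ler_pM2l //.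
  lra.
have q30 : 0 < q ^+ 3 by apply: le_lt_trans h2; rewrite mulr_ge0 // ltW.
have {q0} q0 : 0 < q.
  by rewrite lt_neqAle q0 andbT; apply: contraTneq q30 => <-; rewrite expr0n ltxx.
have hL : (size s)%:R <= 2 * (m ^+ 4 / q ^+ 3 + 1).
  have q6 : (m ^+ 4 * a ^+ 2) < q ^+ 6.
    have -> : q ^+ 6 = (q ^+ 3) ^+ 2 by ring.
    have -> : m ^+ 4 * a ^+ 2 = (m ^+ 2 * a) ^+ 2 by ring.
    by rewrite ltrXn2r // mulr_ge0 // ltW.
  have q60 : 0 < q ^+ 6 by exact: exprn_gt0.
  have bG x : x \in s -> (3 / 2 * q ^+ 3) <= `|G x|.
    move=> /hs; rewrite -/(G x) => hx.
    apply: sqr_le_norm; first by have := ltW q30; lra.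
    have -> : (3 / 2 * q ^+ 3) ^+ 2 = 9 / 4 * q ^+ 6 by field.
    have A3 : A ^+ 3 = q ^+ 6 \/ A ^+ 3 = - q ^+ 6.
      have -> : q ^+ 6 = (q ^+ 2) ^+ 3 by ring.
      rewrite qA; case: (ger0P A) => _; [left|right] => //; ring.
    move: hx; rewrite ler_norml => /andP[hx hx'].
    case: A3 => A3; rewrite A3 in hx hx'; first by lra.
    have := sqr_ge0 (G x); lra.
  have aL : a ^+ 2 * (m ^+ 4 / q ^+ 3) = m ^+ 4 * a ^+ 2 / q ^+ 3 by field; rewrite gt_eqF.
  have key x y : x \in s -> y \in s -> 3 * q ^+ 3 <= `|G x + G y| ->
     `|G x - G y| <= m ^+ 4 * a ^+ 2 / q ^+ 3.
    move=> xs ys h; rewrite ler_pdivlMr //.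
    have : `|G x - G y| * `|G x + G y| <= 2 * (m ^+ 4 * a ^+ 2).
      rewrite -normrM; have := hs x xs; have := hs y ys; rewrite -/(G x) -/(G y).
      have -> : (G x - G y) * (G x + G y) = G x ^+ 2 - G y ^+ 2 by ring.
      rewrite !ler_norml => /andP[? ?] /andP[? ?]; apply/andP; split; lra.
    have : `|G x - G y| * (3 * q ^+ 3) <= `|G x - G y| * `|G x + G y|.
      by rewrite ler_wpM2l.
    have : 0 <= `|G x - G y| * q ^+ 3 by rewrite mulr_ge0 // ltW.
    move: (m ^+ 4 * a ^+ 2) => E; lra.
  apply: (@size_square_window R s (a ^+ 2) be) => //.
  - by rewrite divr_ge0 // ltW.
  - move=> x y xs ys; rewrite -/(G x) -/(G y) GB aL => gx gy; apply: key => //.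
    have := bG x xs; have := bG y ys.
    rewrite (ger0_norm gx) (ger0_norm gy) (ger0_norm (addr_ge0 gx gy)).
    by move: (G x) (G y) (q ^+ 3) => *; lra.
  - move=> x y xs ys; rewrite -/(G x) -/(G y) GB aL => gx gy; apply: key => //.
    have := bG x xs; have := bG y ys.
    have gxy : G x + G y <= 0 by rewrite -[0]addr0 lerD.
    rewrite (ler0_norm gx) (ler0_norm gy) (ler0_norm gxy).
    by move: (G x) (G y) (q ^+ 3) => *; lra.
have : 0 <= m ^+ 4 / q ^+ 3 by rewrite divr_ge0 // ltW.
split; last by lra.
have : m ^+ 4 / q ^+ 3 <= m ^+ 2 / a.
  by rewrite ler_pdivrMr // mulrAC ler_pdivlMr // m4E expr2 -mulrA ler_pM2l // ltW.
have : 0 <= m ^+ 2 / a by rewrite divr_ge0 // ltW.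
lra.
Qed.

Lemma inv_sqrt3_telescope (j : nat) : (0 < j)%N ->
  (j%:R * Num.sqrt j%:R)^-1 <= 6 * ((Num.sqrt j%:R)^-1 - (Num.sqrt j.+1%:R)^-1) :> R.
Proof.
move=> j0; set x := Num.sqrt j%:R; set y := Num.sqrt j.+1%:R.
have x0 : 0 < x by rewrite sqrtr_gt0 ltr0n.
have y0 : 0 < y by rewrite sqrtr_gt0 ltr0n.
have ex : x ^+ 2 = j%:R by rewrite sqr_sqrtr.
have ey : y ^+ 2 = x ^+ 2 + 1 by rewrite ex sqr_sqrtr // -natr1.
have x1 : 1 <= x ^+ 2 by rewrite ex ler1n.
have xy : x <= y by rewrite -ler_sqr ?nnegrE ?(ltW x0) ?(ltW y0) // ey; lra.
have y2x : y <= 3 / 2 * x.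
  rewrite -[leLHS]gtr0_norm //; apply: norm_le_sqr; first by have := ltW x0; lra.
  by rewrite exprMn ey; lra.
have -> : x^-1 - y^-1 = 1 / (x * y * (x + y)).
  have -> : 1 = (y - x) * (x + y) by have := ey; lra.
  by field; rewrite !gt_eqF // addr_gt0.
rewrite -ex -[leLHS]mul1r mulrA mulr1 ler_pdivlMr ?mulr_gt0 ?addr_gt0 //.
rewrite mulrAC ler_pdivrMr ?mulr_gt0 ?exprn_gt0 // mul1r.
have -> : 6 * (x ^+ 2 * x) = x * (6 * x ^+ 2) by ring.
rewrite -mulrA ler_pM2l //.
have : y * y <= (3 / 2 * x) * (3 / 2 * x) by apply: ler_pM => //; rewrite ltW.
have : y * x <= (3 / 2 * x) * x by rewrite ler_wpM2r // ltW.
have : 0 < x * x by rewrite mulr_gt0.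
lra.
Qed.

Lemma sum_inv_sqrt3 (k n : nat) : (0 < k)%N ->
  \sum_(k <= j < n) (j%:R * Num.sqrt j%:R)^-1 <= 6 * (Num.sqrt k%:R)^-1 :> R.
Proof.
move=> k0; have [nk|kn] := leqP n k.
  by rewrite big_geq // mulr_ge0 // invr_ge0 sqrtr_ge0.
apply: (@le_trans _ _ (6 * ((Num.sqrt k%:R)^-1 - (Num.sqrt n%:R)^-1))); last first.
  by rewrite ler_pM2l // gerBl invr_ge0 sqrtr_ge0.
elim: n kn => [//|n IH]; rewrite ltnS leq_eqVlt => /orP[/eqP <-|kn].
  by rewrite big_nat1; exact: inv_sqrt3_telescope.
rewrite big_nat_recr /=; last exact: ltnW.
have := IH kn; have := @inv_sqrt3_telescope n (leq_trans k0 (ltnW kn)); lra.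
Qed.

Lemma sum_inv_sqrt (n : nat) :
  \sum_(1 <= j < n.+1) (Num.sqrt j%:R)^-1 <= 2 * Num.sqrt n%:R :> R.
Proof.
elim: n => [|n IH]; first by rewrite big_geq // mulr_ge0 // sqrtr_ge0.
rewrite big_nat_recr //=; set x := Num.sqrt n%:R in IH *; set y := Num.sqrt n.+1%:R.
have x0 : 0 <= x by rewrite sqrtr_ge0.
have y0 : 0 < y by rewrite sqrtr_gt0 ltr0n.
have ey : y ^+ 2 = x ^+ 2 + 1 by rewrite !sqr_sqrtr // -natr1.
suff : y^-1 <= 2 * (y - x) by lra.
have xy : x <= y by rewrite ler_sqrt ?ler_nat.
rewrite -[leLHS]mul1r ler_pdivrMr //.
have : (y - x) * (x + y) <= (y - x) * (y + y) by rewrite ler_wpM2l; lra.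
have := ey; lra.
Qed.
End Window.

(** * Counting reduced forms *)

Definition coef2 (x : form int) : int := let: (a, b, c, d) := x in c.
Definition coef3 (x : form int) : int := let: (a, b, c, d) := x in d.

(** Normal form for a nonzero: a comes from reduction, b is reduced modulo a by a translation, while
    c and d are constrained only through A and the discriminant. *)
Definition nice (m : nat) (x : form int) : Prop :=
  [/\ coef0 x != 0, (`|coef0 x| <= 4 * m)%N, (2 * `|coef1 x| <= `|coef0 x|)%N,
      (`|hA x| <= m ^ 2)%N & `|disc4 x| <= (m ^ 4)%N%:Z].

Lemma absz_close (u v : int) (J k : nat) : (J <= `|u|)%N -> (`|u| < k + J)%N ->
  (J <= `|v|)%N -> (`|v| < k + J)%N -> (0 <= u) = (0 <= v) -> `|u - v| < k%:Z.
Proof. lia. Qed.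

Section NiceCount.
Variable R : realType.
Variable m : nat.
Hypothesis m0 : (0 < m)%N.
Let M : R := m%:R.

Let M0 : 0 < M. Proof. by rewrite ltr0n. Qed.

Lemma absz_natr (z : int) : (`|z|%N)%:R = `|z%:~R| :> R.
Proof. by rewrite natr_absz intr_norm. Qed.

(** The additive 2 of [size_syzygy_window] is absorbed: |a| <= 4 m gives 1 <= 4 m^2 / |a|, hence 14
    = 6 + 8, and |A| <= m^2 gives 1 <= m^4 / |A|^(3/2), hence 8 = 6 + 2. The second bound is
    summable in j. *)
Lemma size_same_abc (s : seq (form int)) (a b c : int) : uniq s ->
  {in s, forall x, [/\ coef0 x = a, coef1 x = b, coef2 x = c & nice m x]} ->
  (size s)%:R <= 14 * (M ^+ 2 / `|a%:~R|) /\
  forall j : nat, (0 < j)%N -> (j * `|a| <= `|(b ^+ 2 - a * c)%R|)%N ->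
  (size s)%:R <= 8 * (M ^+ 4 / (`|a%:~R| * Num.sqrt `|a%:~R|)) *
       (j%:R * Num.sqrt j%:R)^-1.
Proof.
move=> us hs; set al : R := `|a%:~R|.
have al_ge0 : 0 <= al by exact: normr_ge0.
case: s us hs => [|x0 s0 us hs].
  move=> _ _; split=> [|j j0 _].
    by apply: mulr_ge0 => //; apply: divr_ge0 => //; apply/exprn_ge0/ltW.
  apply: mulr_ge0; last by rewrite invr_ge0 mulr_ge0 ?sqrtr_ge0.
  apply: mulr_ge0 => //; apply: divr_ge0; last by rewrite mulr_ge0 ?sqrtr_ge0.
  exact/exprn_ge0/ltW.
set s := x0 :: s0 in us hs *.
have [ea eb ec [a0 aM _ AM _]] := hs x0 (mem_head _ _).
rewrite ea in a0 aM.
have hA0 : hA x0 = b ^+ 2 - a * c by rewrite -ea -eb -ec; case: (x0) => [[[? ?] ?] ?].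
rewrite hA0 in AM.
have al0 : 0 < al by rewrite normr_gt0 intr_eq0.
have al2 : al ^+ 2 = a%:~R ^+ 2 by rewrite real_normK ?num_real.
have al4 : al <= 4 * M by rewrite /al -absz_natr -natrM ler_nat.
set A := b ^+ 2 - a * c in AM *.
pose q : R := Num.sqrt `|A%:~R|.
have q2 : q ^+ 2 = `|A%:~R| by rewrite sqr_sqrtr.
have us3 : uniq (map coef3 s).
  rewrite map_inj_in_uniq // => x y /hs[ax bx cx _] /hs[ay by' cy _] dxy.
  case: x y ax bx cx ay by' cy dxy => [[[? ?] ?] ?] [[[? ?] ?] ?] /=.
  by move=> -> -> -> -> -> -> ->.
have [|d hd|h1 h2] := @size_syzygy_window R _ al (2 * b%:~R ^+ 3 - 3 * a%:~R * b%:~R * c%:~R)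
   A%:~R q M us3 al0 M0 _ q2.
- exact: sqrtr_ge0.
- case/mapP: hd => x /hs[ax bx cx [_ _ _ _ hD]] ->{d}.
  have := syzygy x; move: hD; case: x ax bx cx => [[[a' b'] c'] d] /= -> -> -> hD syz.
  rewrite al2.
  have -> : (a%:~R ^+ 2 * d%:~R + (2 * b%:~R ^+ 3 - 3 * a%:~R * b%:~R * c%:~R)) ^+ 2 - 4 * A%:~R ^+ 3
     = (disc4 (a, b, c, d) * a ^+ 2)%:~R :> R.
    by rewrite /disc4 /= /A !(intrM, intrB, rmorphXn) /=; ring.
  rewrite intrM normrM rmorphXn /= normrX -al2 ler_wpM2r ?exprn_ge0 //.
  by move: hD; rewrite -(ler_int R) intr_norm -pmulrn natrX.
rewrite size_map in h1 h2; split.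
  have : 1 <= 4 * (M ^+ 2 / al).
    rewrite mulrA ler_pdivlMr // mul1r; apply: (le_trans al4).
    by rewrite ler_pM2l // expr2 ler_peMr ?ler1n // ltW.
  lra.
move=> j j0 hj.
have hj' : j%:R * al <= `|A%:~R| by rewrite /al -!absz_natr -natrM ler_nat.
have A0 : 0 < `|A%:~R| :> R by apply: lt_le_trans hj'; rewrite mulr_gt0 ?ltr0n.
have q0 : 0 < q by rewrite sqrtr_gt0.
have q3 : q ^+ 3 = `|A%:~R| * q by rewrite -q2; ring.
have hq : (j%:R * al) * Num.sqrt (j%:R * al) <= q ^+ 3.
  by rewrite q3 ler_pM ?sqrtr_ge0 ?mulr_ge0 // ler_sqrt.
have jal : 0 < (j%:R * al) * Num.sqrt (j%:R * al).
  by apply: mulr_gt0; rewrite ?sqrtr_gt0 mulr_gt0 ?ltr0n.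
have hM : 1 <= M ^+ 4 / q ^+ 3.
  rewrite ler_pdivlMr ?exprn_gt0 // mul1r.
  have qM : q <= M.
    rewrite -ler_sqr ?nnegrE ?(ltW q0) ?(ltW M0) // q2 -absz_natr -natrX ler_nat.
    exact: AM.
  have -> : M ^+ 4 = M ^+ 3 * M by ring.
  apply: (@le_trans _ _ (M ^+ 3)); first by rewrite lerXn2r ?nnegrE ?(ltW q0) ?(ltW M0).
  by rewrite ler_peMr ?ler1n // exprn_ge0 // ltW.
have := h2 q0.
have -> : 8 * (M ^+ 4 / (al * Num.sqrt al)) * (j%:R * Num.sqrt j%:R)^-1 =
   8 * (M ^+ 4 / (j%:R * al * Num.sqrt (j%:R * al))).
  rewrite sqrtrM //; field; rewrite !gt_eqF ?sqrtr_gt0 ?ltr0n //.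
have : M ^+ 4 / q ^+ 3 <= M ^+ 4 / (j%:R * al * Num.sqrt (j%:R * al)).
  by rewrite ler_pM2l ?exprn_gt0 // lef_pV2 ?posrE ?exprn_gt0.
lra.
Qed.

(** The range |A| < m |a| contains at most 3 m values of c. Beyond it, since A = b^2 - a c moves in
    steps of a, the integer j = floor(|A| / |a|) and the sign of A determine c, and j^(-3/2) is
    summed from m on: 96 = 2 * 8 * 6. *)
Lemma size_same_ab (s : seq (form int)) (a b : int) : uniq s -> a != 0 ->
  {in s, forall x, [/\ coef0 x = a, coef1 x = b & nice m x]} ->
  (size s)%:R <= 42 * (M ^+ 3 / `|a%:~R|)
     + 96 * (M ^+ 4 / (`|a%:~R| * Num.sqrt `|a%:~R|)) / Num.sqrt M.
Proof.
move=> us a0 hs; set al : R := `|a%:~R|.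
have al0 : 0 < al by rewrite normr_gt0 intr_eq0.
have hAE x : x \in s -> hA x = b ^+ 2 - a * coef2 x.
  by move=> /hs[<- <- _]; case: x => [[[? ?] ?] ?].
pose small (x : form int) := (`|hA x| < m * `|a|)%N.
rewrite -(count_predC small) natrD -!size_filter; apply: lerD.
  have -> : 42 * (M ^+ 3 / al) = (3 * M) * (14 * (M ^+ 2 / al)) by ring.
  have us1 := filter_uniq small us.
  apply: (@size_le_mul _ _ _ coef2 _ (undup (map coef2 (filter small s)))).
  - by move=> x xs; rewrite mem_undup map_f.
  - by apply: mulr_ge0 => //; apply: divr_ge0 (ltW al0); apply/exprn_ge0/ltW.
  - apply: (@le_trans _ _ (2 * M + 1)); last by have : 1 <= M by [rewrite ler1n]; lra.
    apply: size_spread; rewrite ?undup_uniq // ?mulr_ge0 ?(ltW M0) //.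
    move=> c c'; rewrite !mem_undup => /mapP[x + ->{c}] /mapP[y + ->{c'}].
    rewrite !mem_filter => /andP[sx xs] /andP[sy ys].
    move: sx sy; rewrite /small !hAE // => sx sy.
    have : (`|a| * `|coef2 x - coef2 y| <= `|a| * (2 * m)%N%:Z).
      rewrite -normrM.
      have -> : a * (coef2 x - coef2 y) = (b ^+ 2 - a * coef2 y) - (b ^+ 2 - a * coef2 x) by ring.
      by move: (_ - _) (_ - _) sx sy => u v; lia.
    rewrite ler_pM2l ?normr_gt0 // -(ler_int R) => h.
    by apply: (le_trans h); rewrite -pmulrn natrM.
  - move=> c _; apply: (@size_same_abc _ a b c _ _).1; first exact: filter_uniq.
    by move=> x; rewrite !mem_filter => /and3P[/eqP <- _ /hs[? ? ?]].
pose f (x : form int) := (`|hA x| %/ `|a|)%N.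
have a0' : (0 < `|a|)%N by rewrite absz_gt0.
have fI : {in filter (predC small) s, forall x, f x \in index_iota m (m ^ 2).+1}.
  move=> x; rewrite mem_filter /= -leqNgt => /andP[sx /hs[_ _ [_ _ _ hA2 _]]].
  rewrite mem_index_iota leq_divRL // sx /= ltnS.
  by rewrite (leq_trans _ hA2) // leq_div.
apply: (le_trans (size_le_sum R fI)).
pose B := M ^+ 4 / (al * Num.sqrt al).
have B0 : 0 <= B by rewrite divr_ge0 ?exprn_ge0 ?mulr_ge0 ?sqrtr_ge0 ?(ltW M0) ?(ltW al0).
apply: (@le_trans _ _ (\sum_(m <= j < (m ^ 2).+1) 16 * B * (j%:R * Num.sqrt j%:R)^-1)); last first.
  rewrite -mulr_sumr.
  have -> : 96 * B / Num.sqrt M = 16 * B * (6 * (Num.sqrt M)^-1) by ring.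
  by apply: ler_wpM2l; [rewrite mulr_ge0|exact: sum_inv_sqrt3].
rewrite !big_seq; apply: ler_sum => j; rewrite mem_index_iota => /andP[mj _].
have j0 : (0 < j)%N by exact: leq_trans mj.
set sj := filter _ (filter _ s).
have usj : uniq sj by rewrite !filter_uniq.
have hj x : x \in sj -> [/\ x \in s, (j * `|a| <= `|hA x|)%N & (`|hA x| < j.+1 * `|a|)%N].
  rewrite !mem_filter => /and3P[/eqP <- _ xs]; split => //.
    exact: leq_divM.
  by rewrite -ltn_divLR.
have -> : 16 * B * (j%:R * Num.sqrt j%:R)^-1 = 2 * (8 * B * (j%:R * Num.sqrt j%:R)^-1) by ring.
have C0 : 0 <= 8 * B * (j%:R * Num.sqrt j%:R)^-1.
  by apply: mulr_ge0; [exact: mulr_ge0|rewrite invr_ge0 mulr_ge0 ?sqrtr_ge0].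
apply: (@size_le_mul _ _ _ (fun x => 0 <= hA x) _ [:: true; false]) => //.
  by move=> x _; case: (0 <= hA x); rewrite !inE.
move=> e _; set t := filter _ sj.
have ht x : x \in t -> [/\ x \in s, (j * `|a| <= `|hA x|)%N, (`|hA x| < j.+1 * `|a|)%N & (0 <= hA x) = e].
  by rewrite mem_filter => /andP[/eqP <- /hj[]].
have [t0|[x0 x0t]] : t = [::] \/ exists x, x \in t.
  by case: (t) => [|y ?]; [left|right; exists y; rewrite mem_head].
  by rewrite t0.
have [x0s hx0 hx0' ex0] := ht _ x0t.
have ut : uniq t by exact: filter_uniq.
apply: (@size_same_abc t a b (coef2 x0) ut _).2 => //; last by rewrite -hAE.
move=> x xt; have [xs hx hx' ex] := ht _ xt.
have [ax bx nx] := hs _ xs; split => //.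
have e1 := hAE _ xs; have e0 := hAE _ x0s.
have h : a * (coef2 x - coef2 x0) = hA x0 - hA x by rewrite e0 e1; ring.
have h' : `|hA x0 - hA x| < `|a|%N.
  by apply: (@absz_close _ _ (j * `|a|)); rewrite -?mulSn // ex0 ex.
apply/eqP; rewrite -subr_eq0; apply: contraTT h' => c0.
rewrite -h normrM -leNgt abszE ler_peMr //.
by rewrite -gtz0_ge1 normr_gt0.
Qed.

Lemma size_same_a (s : seq (form int)) (a : int) : uniq s -> a != 0 ->
  {in s, forall x, coef0 x = a /\ nice m x} ->
  (size s)%:R <= 84 * M ^+ 3 + 192 * M ^+ 4 / Num.sqrt M * (Num.sqrt `|a%:~R|)^-1.
Proof.
move=> us a0 hs; set al : R := `|a%:~R|.
have al1 : 1 <= al by rewrite /al -absz_natr ler1n absz_gt0.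
have al0 : 0 < al by lra.
have -> : 84 * M ^+ 3 + 192 * M ^+ 4 / Num.sqrt M * (Num.sqrt al)^-1 =
  (2 * al) * (42 * (M ^+ 3 / al) + 96 * (M ^+ 4 / (al * Num.sqrt al)) / Num.sqrt M).
  by field; rewrite !gt_eqF ?sqrtr_gt0.
apply: (@size_le_mul _ _ _ coef1 _ (undup (map coef1 s))).
- by move=> x xs; rewrite mem_undup map_f.
- rewrite addr_ge0 //.
    by apply: mulr_ge0 => //; apply: divr_ge0 (ltW al0); apply/exprn_ge0/ltW.
  apply: divr_ge0; last exact: sqrtr_ge0.
  apply: mulr_ge0 => //; apply: divr_ge0; first by apply/exprn_ge0/ltW.
  by rewrite mulr_ge0 ?sqrtr_ge0 // ltW.
- apply: (@le_trans _ _ (al + 1)); last by lra.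
  apply: size_spread; rewrite ?undup_uniq ?(ltW al0) //.
  move=> c c'; rewrite !mem_undup => /mapP[x xs ->{c}] /mapP[y ys ->{c'}].
  have [ax [_ _ bx _ _]] := hs x xs; have [ay [_ _ by' _ _]] := hs y ys.
  rewrite ax in bx; rewrite ay in by'.
  have : `|coef1 x - coef1 y| <= `|a|%N by lia.
  by rewrite -(ler_int R) /al -absz_natr.
- move=> b _; apply: (@size_same_ab _ a b) => //; first exact: filter_uniq.
  by move=> x; rewrite mem_filter => /andP[/eqP bx /hs[? ?]]; split.
Qed.

(** Both signs of a are counted and |a|^(-1/2) is summed over |a| <= 4 m: 2208 = 168 * 4 + 384 *
    4. *)
Lemma size_nice (s : seq (form int)) : uniq s -> {in s, forall x, nice m x} ->
  (size s)%:R <= 2208 * M ^+ 4.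
Proof.
move=> us hs; pose f (x : form int) := `|coef0 x|%N.
have fI : {in s, forall x, f x \in index_iota 1 (4 * m).+1}.
  move=> x /hs[a0 aM _ _ _]; rewrite mem_index_iota ltnS aM andbT absz_gt0 //.
apply: (le_trans (size_le_sum R fI)).
apply: (@le_trans _ _ (\sum_(1 <= j < (4 * m).+1) (168 * M ^+ 3 +
     384 * M ^+ 4 / Num.sqrt M * (Num.sqrt j%:R)^-1))); last first.
  rewrite big_split /= sumr_const_nat subn1 /= -mulr_sumr.
  have h1 : 168 * M ^+ 3 *+ (4 * m) = 672 * M ^+ 4 by rewrite -mulr_natr natrM; ring.
  have sM : Num.sqrt M ^+ 2 = M by rewrite sqr_sqrtr // ltW.
  have h2 : \sum_(1 <= i < (4 * m).+1) (Num.sqrt i%:R)^-1 <= 4 * Num.sqrt M.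
    apply: (le_trans (sum_inv_sqrt _ _)); rewrite natrM sqrtrM //.
    have -> : Num.sqrt 4 = 2 :> R by rewrite (_ : 4 = 2 ^+ 2) ?sqrtr_sqr ?ger0_norm //; ring.
    by rewrite mulrA (_ : 2 * 2 = 4 :> R) //; ring.
  have s0 : 0 < Num.sqrt M by rewrite sqrtr_gt0.
  have h3 : 384 * M ^+ 4 / Num.sqrt M * (4 * Num.sqrt M) = 1536 * M ^+ 4.
    by field; rewrite gt_eqF.
  rewrite h1 (_ : 2208 * M ^+ 4 = 672 * M ^+ 4 + 1536 * M ^+ 4); last ring.
  rewrite lerD2l -h3; apply: ler_wpM2l h2; apply: divr_ge0; last exact: ltW.
  by apply: mulr_ge0 => //; apply/exprn_ge0/ltW.
rewrite !big_seq; apply: ler_sum => j; rewrite mem_index_iota => /andP[j0 _].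
set t := filter _ s; have ut : uniq t by exact: filter_uniq.
have -> : 168 * M ^+ 3 + 384 * M ^+ 4 / Num.sqrt M * (Num.sqrt j%:R)^-1 =
  2 * (84 * M ^+ 3 + 192 * M ^+ 4 / Num.sqrt M * (Num.sqrt j%:R)^-1) by ring.
apply: (@size_le_mul _ _ _ coef0 _ [:: j%:Z; - j%:Z]) => //.
- move=> x; rewrite mem_filter !inE /f => /andP[/eqP <- _]; lia.
- rewrite addr_ge0 //; first by apply: mulr_ge0 => //; apply/exprn_ge0/ltW.
  apply: mulr_ge0; last by rewrite invr_ge0 sqrtr_ge0.
  apply: divr_ge0; last exact: sqrtr_ge0.
  by apply: mulr_ge0 => //; apply/exprn_ge0/ltW.
move=> a; rewrite !inE => ha.
have -> : j%:R = `|a%:~R| :> R by rewrite -absz_natr; congr (_%:R); lia.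
apply: size_same_a; [exact: filter_uniq|lia|].
by move=> x; rewrite !mem_filter => /and3P[/eqP <- _ /hs].
Qed.

End NiceCount.

Lemma centered_rem (b a : int) : a != 0 -> exists t : int, (2 * `|(b + a * t)%R| <= `|a|)%N.
Proof.
move=> a0; pose r := (b %% a)%Z; pose k := (b %/ a)%Z.
have e : b = k * a + r by exact: divz_eq.
have r0 : 0 <= r by exact: modz_ge0.
have ra : r < `|a| by exact: ltz_mod.
have [h|h] := leP (2 * r) `|a|.
  exists (- k); rewrite e (_ : _ + _ = r); last ring.
  by clear -h r0; lia.
exists (- k - Num.sg a); rewrite e (_ : _ + _ = r - Num.sg a * a); last ring.
rewrite -normrEsg.
by clear -h r0 ra; lia.
Qed.

(** Normal form for a = 0, where disc4 = b^2 (4 b d - 3 c^2): translations change c by multiples of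
    2 b, and b^2 divides the discriminant, so |b| <= m^2. *)
Definition nice0 (m : nat) (x : form int) : Prop :=
  [/\ coef0 x = 0, (`|coef2 x| <= `|coef1 x|)%N, disc4 x != 0 &
      `|disc4 x| <= (m ^ 4)%N%:Z].

Lemma normal_rep (R : realType) (m : nat) x : disc4 x != 0 -> `|disc4 x| <= (m ^ 4)%N%:Z ->
  exists2 y, eqv x y & nice m y \/ nice0 m y.
Proof.
move=> D0 Dm; have [y xy /andP[ya yA]] := small_rep R D0.
rewrite -(disc4_eqv xy) in D0 Dm ya yA.
have trans t : eqv y (sub4 1 0 t 1 y) by exists 1, 0, t, 1; split => //; ring.
have eD t : disc4 (sub4 1 0 t 1 y) = disc4 y by rewrite disc4_sub4 //; ring.
have [a0|a0] := eqVneq (coef0 y) 0.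
  have b0 : 2 * coef1 y != 0.
    rewrite mulf_neq0 //; apply: contraNneq D0; move: a0; case: (y) => [[[a b] c] d] /= -> ->.
    by rewrite /disc4 /=; apply/eqP; ring.
  have [t ht] := centered_rem (coef2 y) b0.
  exists (sub4 1 0 t 1 y); first exact: eqv_trans xy (trans t).
  right; rewrite /nice0 eD; split => //; move: a0 ht; case: (y) => [[[a b] c] d] /= ->.
    by move=> _; ring.
  have -> : 0 * 1 * t ^+ 2 + b * (2 * 1 * t * 1 + 0 * t ^+ 2) + c * (1 * 1 ^+ 2 + 2 * 0 * t * 1) + d * 0 * 1 ^+ 2
    = c + 2 * b * t by ring.
  have -> : 0 * 1 ^+ 2 * t + b * (1 ^+ 2 * 1 + 2 * 1 * 0 * t) + c * (2 * 1 * 0 * 1 + 0 ^+ 2 * t) + d * 0 ^+ 2 * 1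
    = b by ring.
  by rewrite abszM /= leq_pmul2l.
have [t ht] := centered_rem (coef1 y) a0.
exists (sub4 1 0 t 1 y); first exact: eqv_trans xy (trans t).
have e0 : coef0 (sub4 1 0 t 1 y) = coef0 y.
  by case: (y) => [[[a b] c] d] /=; ring.
have e1 : coef1 (sub4 1 0 t 1 y) = coef1 y + coef0 y * t.
  by case: (y) => [[[a b] c] d] /=; ring.
have eA : hA (sub4 1 0 t 1 y) = hA y by rewrite hA_sub4; ring.
left; split; rewrite ?e0 ?e1 ?eA ?eD //.
  rewrite -(@leq_exp2r _ _ 4) // -lez_nat -abszX abszE normrX.
  have -> : `|coef0 y| ^+ 4 = coef0 y ^+ 4 by rewrite -normrX ger0_norm // exprn_even_ge0.
  apply: (le_trans ya).
  by rewrite expnMn PoszM ler_pM2l.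
rewrite -(@leq_exp2r _ _ 2) // -expnM -lez_nat -abszX abszE.
rewrite ger0_norm ?sqr_ge0 //; exact: le_trans yA Dm.
Qed.

Section Davenport.
Variable R : realType.

(** For |b| = j there are O(j) values of c, and d lies in a window of length m^4 / (2 j^3); the sum
    of m^4 / j^2 + j over j <= m^2 is O(m^4). *)
Lemma size_nice0 (m : nat) (s : seq (form int)) : (0 < m)%N -> uniq s ->
  {in s, forall x, nice0 m x} -> (size s)%:R <= 24 * m%:R ^+ 4 :> R.
Proof.
move=> m0 us hs; pose M : R := m%:R; have M0 : 0 < M by rewrite ltr0n.
have M40 : 0 < M ^+ 4 by exact: exprn_gt0.
pose f (x : form int) := `|coef1 x|%N.
have fI : {in s, forall x, f x \in index_iota 1 (m ^ 2).+1}.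
  move=> x /hs[a0 _ D0 DM]; move: a0 D0 DM; rewrite mem_index_iota ltnS /f.
  case: x => [[[a b] c] d] /= ->; rewrite /disc4 /=.
  have -> : (b * c - 0 * d) ^+ 2 - 4 * (b ^+ 2 - 0 * c) * (c ^+ 2 - b * d) =
     b ^+ 2 * (4 * b * d - 3 * c ^+ 2) by ring.
  rewrite mulf_eq0 negb_or expf_eq0 /= => /andP[b0 e0] h.
  rewrite absz_gt0 b0 /= -(@leq_exp2r _ _ 2) // -expnM -lez_nat -abszX abszE.
  apply: le_trans h; rewrite [leRHS]normrM ler_peMr // -gtz0_ge1 normr_gt0.
  exact: e0.
apply: (le_trans (size_le_sum R fI)).
apply: (@le_trans _ _ (\sum_(1 <= j < (m ^ 2).+1) (3 * M ^+ 4 * (j%:R * Num.sqrt j%:R)^-1 +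
     6 * (m ^ 2)%:R))); last first.
  rewrite big_split /= sumr_const_nat subn1 /= -mulr_sumr.
  have := @sum_inv_sqrt3 R 1 (m ^ 2).+1 isT; rewrite sqrtr1 invr1 mulr1 => h.
  have : 3 * M ^+ 4 * \sum_(1 <= j < (m ^ 2).+1) (j%:R * Num.sqrt j%:R)^-1 <= 3 * M ^+ 4 * 6.
    by apply: ler_wpM2l h; apply: mulr_ge0 => //; exact: ltW.
  rewrite -[_ *+ (m ^ 2)]mulr_natr natrX -/M.
  rewrite (_ : 24 * M ^+ 4 = 3 * M ^+ 4 * 6 + 6 * M ^+ 2 * M ^+ 2); last ring.
  by move=> h'; apply: lerD.
rewrite !big_seq; apply: ler_sum => j; rewrite mem_index_iota => /andP[j0 jm].
set t := filter _ s; have ut : uniq t by exact: filter_uniq.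
have J0 : 0 < j%:R :> R by rewrite ltr0n.
have J1 : 1 <= j%:R :> R by rewrite ler1n.
apply: (@le_trans _ _ (2 * ((3 * j%:R) * (M ^+ 4 / (2 * j%:R ^+ 3) + 1)))); last first.
  have -> : 2 * ((3 * j%:R) * (M ^+ 4 / (2 * j%:R ^+ 3) + 1)) = 3 * (M ^+ 4 / j%:R ^+ 2) + 6 * j%:R :> R.
    by field; rewrite gt_eqF.
  apply: lerD; last by rewrite ler_pM2l // ler_nat -ltnS.
  rewrite -mulrA !ler_pM2l // lef_pV2 ?posrE ?mulr_gt0 ?sqrtr_gt0 // expr2 ler_pM2l //.
  rewrite -[leRHS](sqr_sqrtr (ltW J0)) expr2 ler_peMr ?sqrtr_ge0 //.
  by rewrite -[leLHS]sqrtr1 ler_sqrt.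
have B0 : 0 <= M ^+ 4 / (2 * j%:R ^+ 3).
  by apply: divr_ge0; [exact: ltW|apply: mulr_ge0 => //; apply: exprn_ge0].
apply: (@size_le_mul _ _ _ coef1 _ [:: j%:Z; - j%:Z]) => //.
- by move=> x; rewrite mem_filter !inE /f => /andP[/eqP <- _]; clear; lia.
- by apply: mulr_ge0; [rewrite mulr_ge0|rewrite addr_ge0].
move=> b; rewrite !inE => hb.
have bj : `|b%:~R| = j%:R :> R by rewrite -absz_natr; congr (_%:R); clear -hb; lia.
apply: (@size_le_mul _ _ _ coef2 _ (undup (map coef2 (filter (fun x => coef1 x == b) t)))).
- by move=> x xs; rewrite mem_undup map_f.
- by rewrite addr_ge0.
- apply: (@le_trans _ _ (2 * j%:R + 1)); last by lra.
  apply: size_spread; rewrite ?undup_uniq ?mulr_ge0 //.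
  move=> c c'; rewrite !mem_undup => /mapP[x xs ->{c}] /mapP[y ys ->{c'}].
  have h z : z \in [seq x <- t | coef1 x == b] -> (`|coef2 z| <= j)%N.
    rewrite !mem_filter => /and3P[_ /eqP <- zs]; exact: (let: And4 _ h _ _ := hs z zs in h).
  rewrite intr_norm intrB; apply: (le_trans (ler_normB _ _)).
  by rewrite -!absz_natr mulrDl mul1r lerD // ler_nat h.
move=> c _; set u := filter _ _; have uu : uniq u by rewrite !filter_uniq.
have hu x : x \in u -> [/\ coef1 x = b, coef2 x = c & nice0 m x].
  by rewrite !mem_filter => /and4P[/eqP ? /eqP ? _ /hs].
have uu3 : uniq (map coef3 u).
  rewrite map_inj_in_uniq // => x y /hu[bx cx [ax _ _ _]] /hu[by' cy [ay _ _ _]] dxy.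
  case: x y ax bx cx ay by' cy dxy => [[[? ?] ?] ?] [[[? ?] ?] ?] /=.
  by move=> -> -> -> -> -> -> ->.
rewrite -(size_map coef3); apply: size_spread => // d d' /mapP[x /hu[bx cx [ax _ _ Dx]] ->{d}].
move=> /mapP[y /hu[by' cy [ay _ _ Dy]] ->{d'}].
have DE z : coef0 z = 0 -> coef1 z = b -> coef2 z = c ->
    disc4 z = b ^+ 2 * (4 * b * coef3 z - 3 * c ^+ 2).
  by case: z => [[[? ?] ?] ?] /= -> -> ->; rewrite /disc4 /=; ring.
rewrite (DE x) // in Dx; rewrite (DE y) // in Dy.
have : `|4 * b ^+ 3 * (coef3 x - coef3 y)| <= 2 * (m ^ 4)%N%:Z.
  have -> : 4 * b ^+ 3 * (coef3 x - coef3 y) = b ^+ 2 * (4 * b * coef3 x - 3 * c ^+ 2)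
     - b ^+ 2 * (4 * b * coef3 y - 3 * c ^+ 2) by ring.
  by apply: (le_trans (ler_normB _ _)); rewrite [2 * _]mulrDl mul1r lerD.
rewrite normrM (normrM 4) normrX (_ : `|b| = j%:Z) => [h|]; last by clear -hb; lia.
have {h} : (4 * j%:Z ^+ 3 * `|coef3 x - coef3 y|)%:~R <= (2 * (m ^ 4)%N%:Z)%:~R :> R.
  by rewrite ler_int.
have -> : (4 * j%:Z ^+ 3 * `|coef3 x - coef3 y|)%:~R =
    4 * j%:R ^+ 3 * `|coef3 x - coef3 y|%:~R :> R.
  by rewrite rmorphM rmorphM rmorphXn.
have -> : (2 * (m ^ 4)%N%:Z)%:~R = 2 * M ^+ 4 :> R by rewrite rmorphM /= -pmulrn natrX.
move=> h; rewrite ler_pdivlMr ?mulr_gt0 ?exprn_gt0 // mulrC.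
by move: h; move: (`|_|%:~R) (j%:R ^+ 3) => u1 u2; lra.
Qed.

Lemma davenport : exists2 C : R, 0 < C & forall (s : seq (form int)) (Y : R),
  ineqs s -> 0 <= Y -> {in s, forall x, disc4 x != 0 /\ `|disc4 x|%:~R <= Y} ->
  (size s)%:R <= C * Y.
Proof.
exists (16 * 2232) => [|s Y si Y0 hs]; first by rewrite mulr_gt0.
have [s0|[x xs]] : s = [::] \/ exists x, x \in s.
  by case: (s) => [|y ?]; [left|right; exists y; rewrite mem_head].
  by rewrite s0 mulr_ge0 ?mulr_ge0.
have Y1 : 1 <= Y.
  have [D0 DY] := hs x xs; apply: le_trans DY.
  by rewrite -[1]/(1%:~R) ler_int -gtz0_ge1 normr_gt0.
pose z := Num.sqrt (Num.sqrt Y).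
have sqrt_ge1 (u : R) : 1 <= u -> 1 <= Num.sqrt u.
  by move=> u1; rewrite -[leLHS]sqrtr1 ler_sqrt // (le_trans _ u1).
have z1 : 1 <= z by apply/sqrt_ge1/sqrt_ge1.
have z4 : z ^+ 4 = Y.
  by transitivity ((z ^+ 2) ^+ 2); [ring|rewrite !sqr_sqrtr ?sqrtr_ge0].
(* The first integer above Y^(1/4): Y <= m^4 <= 16 Y because Y >= 1, as the list is nonempty. The
   constant is 16 (2208 + 24). *)
pose m := (Num.trunc z).+1.
have zm : z <= m%:R by apply/ltW/truncnS_gt.
have mz : m%:R <= 2 * z.
  have h : (Num.trunc z)%:R <= z by rewrite truncn_le (le_trans _ z1).
  have : m%:R = (Num.trunc z)%:R + 1 :> R by rewrite natr1.
  lra.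
have m4 : m%:R ^+ 4 <= 16 * Y.
  have -> : 16 * Y = (2 * z) ^+ 4 by rewrite exprMn z4; congr (_ * _); ring.
  by rewrite lerXn2r ?nnegrE // (le_trans _ mz).
have Ym : Y <= m%:R ^+ 4 by rewrite -z4 lerXn2r ?nnegrE // (le_trans _ z1).
have [|s' [si' <- hs']] := @ineqs_rep (fun y => nice m y \/ nice0 m y) s _ si.
  move=> y /hs[D0 DY]; apply: (normal_rep R) => //.
  by rewrite -(ler_int R) -pmulrn natrX (le_trans DY).
have us' := ineqs_uniq si'.
pose p (y : form int) := coef0 y == 0.
rewrite -(count_predC p) natrD -!size_filter.
have h1 : (size (filter p s'))%:R <= 24 * m%:R ^+ 4 :> R.
  apply: size_nice0 => //; first exact: filter_uniq.
  move=> y; rewrite mem_filter => /andP[py /hs'[[[]|] //]].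
  by rewrite -/(p y) py.
have h2 : (size (filter (predC p) s'))%:R <= 2208 * m%:R ^+ 4 :> R.
  apply: size_nice => //; first exact: filter_uniq.
  by move=> y; rewrite mem_filter => /andP[/negP py /hs'[[|[a0]] //]]; case: py; apply/eqP.
lra.
Qed.
End Davenport.

(** * Composition of classes with the same Hessian content *)

Definition hess (n A B C : int) (x : form int) : Prop :=
  [/\ hA x = n * A, hB x = n * B & hC x = n * C].

(** With sigma a root of X^2 - B X + A C, the norm of a sigma - b A is n A^3; this is that equation
    divided by A. *)
Lemma hess_norm n A B C x : n != 0 -> hess n A B C x ->
  coef0 x ^+ 2 * C - coef0 x * coef1 x * B + coef1 x ^+ 2 * A = n * A ^+ 2.
Proof.
move=> n0; case: x => [[[a b] c] d] [eA eB eC].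
have := coef2_hess a b c d; rewrite eA eB eC /= => h.
apply: (mulfI n0); move: eA; rewrite /= => eA.
have -> : n * (n * A ^+ 2) = (n * A) * (n * A) by ring.
rewrite -{1}eA.
have -> : (b ^+ 2 - a * c) * (n * A) = b ^+ 2 * n * A - a * (c * (n * A)) by ring.
by rewrite h; ring.
Qed.

Lemma hess_coef2 n A B C a b c d : n != 0 -> hess n A B C (a, b, c, d) ->
  c * A = b * B - a * C.
Proof.
move=> n0 [eA eB eC]; have := coef2_hess a b c d; rewrite eA eB eC => h.
by apply: (mulfI n0); transitivity (c * (n * A)); [ring|rewrite h; ring].
Qed.

Lemma hess_coef3 n A B C a b c d : n != 0 -> hess n A B C (a, b, c, d) ->
  d * A = c * B - b * C.
Proof.
move=> n0 [eA eB eC]; have := coef3_hess a b c d; rewrite eA eB eC => h.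
by apply: (mulfI n0); transitivity (d * (n * A)); [ring|rewrite h; ring].
Qed.

(* Dirichlet composition of two forms with concordant Hessians. *)
Lemma composition (n A A' B C : int) (x z : form int) :
  n != 0 -> A != 0 -> A' != 0 -> coprimez A A' -> coprimez A n -> coprimez A' n ->
  hess n A B (A' * C) x -> hess n A' B (A * C) z ->
  (n %| coef0 x * coef0 z * B - coef0 x * coef1 z * A' - coef1 x * coef0 z * A)%Z ->
  (n %| coef0 x * coef0 z * C - coef1 x * coef1 z)%Z ->
  exists y, [/\ hess 1 (A * A') B C y,
    n * coef0 y = coef0 x * coef0 z * B - coef0 x * coef1 z * A' - coef1 x * coef0 z * A &
    n * coef1 y = coef0 x * coef0 z * C - coef1 x * coef1 z].
Proof.
move=> n0 A0 A'0 cAA' cAn cA'n hx hz.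
have nx := hess_norm n0 hx; have nz := hess_norm n0 hz.
case: x hx nx => [[[a b] c] d] hx nx; case: z hz nz => [[[a' b'] c'] d'] hz nz.
have ex2 := hess_coef2 n0 hx; have ex3 := hess_coef3 n0 hx.
have ez2 := hess_coef2 n0 hz; have ez3 := hess_coef3 n0 hz.
rewrite /= in nx nz *.
move=> /dvdzP[y0 e0] /dvdzP[y1 e1].
have AA'0 : A * A' != 0 by rewrite mulf_neq0.
have cA'A : coprimez A' A by rewrite coprimez_sym.
have step (A1 A2 v w : int) : coprimez A1 A2 -> coprimez A1 n ->
    n * (A2 * v) = A1 * w -> (A1 %| v)%Z.
  move=> c1 c2 e; have : (A1 %| n * (A2 * v))%Z by rewrite e dvdz_mulr.
  by rewrite !Gauss_dvdzr.
(* The leading coefficients come from (a sigma - b A) (a' sigma - b' A') = n (y0 sigma - y1 A A'),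
   where sigma^2 = B sigma - A A' C. The recurrence of [hess_coef2] and [hess_coef3] then dictates
   y2 and y3, and coprimality allows the divisions by A A'. *)
have [y2 e2] : exists y2, y1 * B - y0 * C = y2 * (A * A').
  apply/dvdzP; rewrite Gauss_dvdz //; apply/andP; split.
    apply: (step A 1 _ (b * a' * C - b' * c)) => //; first by rewrite /coprimez gcdz1.
    transitivity ((y1 * n) * B - (y0 * n) * C); first ring.
    rewrite -e0 -e1.
    transitivity (b * a' * A * C - b' * (b * B - a * (A' * C))); first ring.
    by rewrite -ex2; ring.
  apply: (step A' 1 _ (b' * a * C - b * c')) => //; first by rewrite /coprimez gcdz1.
  transitivity ((y1 * n) * B - (y0 * n) * C); first ring.
  rewrite -e0 -e1.
  transitivity (b' * a * A' * C - b * (b' * B - a' * (A * C))); first ring.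
  by rewrite -ez2; ring.
have f2 : n * (A' * y2) = b * a' * C - b' * c.
  apply: (mulfI A0).
  transitivity ((y1 * n) * B - (y0 * n) * C).
    by transitivity (n * (y2 * (A * A'))); [ring|rewrite -e2; ring].
  rewrite -e0 -e1.
  transitivity (b * a' * A * C - b' * (b * B - a * (A' * C))); first ring.
  by rewrite -ex2; ring.
have f2' : n * (A * y2) = b' * a * C - b * c'.
  apply: (mulfI A'0).
  transitivity ((y1 * n) * B - (y0 * n) * C).
    by transitivity (n * (y2 * (A * A'))); [ring|rewrite -e2; ring].
  rewrite -e0 -e1.
  transitivity (b' * a * A' * C - b * (b' * B - a' * (A * C))); first ring.
  by rewrite -ez2; ring.
have [y3 e3] : exists y3, y2 * B - y1 * C = y3 * (A * A').
  apply/dvdzP; rewrite Gauss_dvdz //; apply/andP; split.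
    apply: (step A A' _ (a' * c * C - b' * d)) => //.
    transitivity ((n * (A' * y2)) * B - (y1 * n) * (A' * C)); first ring.
    rewrite f2 -e1.
    transitivity (a' * C * (b * B - a * (A' * C)) - b' * (c * B - b * (A' * C))); first ring.
    by rewrite -ex2 -ex3; ring.
  apply: (step A' A _ (a * c' * C - b * d')) => //.
  transitivity ((n * (A * y2)) * B - (y1 * n) * (A * C)); first ring.
  rewrite f2' -e1.
  transitivity (a * C * (b' * B - a' * (A * C)) - b * (c' * B - b' * (A * C))); first ring.
  by rewrite -ez2 -ez3; ring.
(* Multiplicativity of the norm; it yields the first Hessian coefficient of the composed form. *)
have nrm : y0 ^+ 2 * C - y0 * y1 * B + y1 ^+ 2 * (A * A') = (A * A') ^+ 2.
  have n20 : n ^+ 2 != 0 by rewrite expf_neq0.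
  apply: (mulfI n20).
  transitivity ((y0 * n) ^+ 2 * C - (y0 * n) * (y1 * n) * B + (y1 * n) ^+ 2 * (A * A')); first ring.
  rewrite -e0 -e1.
  transitivity ((a ^+ 2 * (A' * C) - a * b * B + b ^+ 2 * A) *
    (a' ^+ 2 * (A * C) - a' * b' * B + b' ^+ 2 * A')); first ring.
  by rewrite nx nz; ring.
have hAy : y1 ^+ 2 - y0 * y2 = A * A'.
  apply: (mulfI AA'0).
  transitivity (y1 ^+ 2 * (A * A') - y0 * (y2 * (A * A'))); first ring.
  by rewrite -e2 -[RHS]expr2 -nrm; ring.
exists (y0, y1, y2, y3); split; rewrite /= ?e0 ?e1; try ring.
split; rewrite /= ?mul1r //; apply: (mulfI AA'0).
- transitivity (y1 * (y2 * (A * A')) - y0 * (y3 * (A * A'))); first ring.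
  rewrite -e3 -e2 -{1}hAy.
  transitivity (B * y1 ^+ 2 - y0 * y2 * B); first ring.
  ring.
- transitivity (y2 * (y2 * (A * A')) - y1 * (y3 * (A * A'))); first ring.
  rewrite -e3 -e2 -{1}hAy; ring.
Qed.

(** * Lattices spanned by frames *)

Section FrameProducts.
Variable F : numFieldType.

Lemma frame_prod (S x1 x2 e1 e2 : F) x : S != 0 -> frame S x1 x2 e1 e2 x ->
  x1 * e2 = ((hB x)%:~R + S) / 2 /\ x2 * e1 = ((hB x)%:~R - S) / 2.
Proof.
move=> S0 fr; have [_ -> _] := frame_hess S0 fr; rewrite -(frame_det fr).
by split; field.
Qed.

Lemma frame_cube (S x1 x2 e1 e2 : F) x : S != 0 -> frame S x1 x2 e1 e2 x ->
  x1 ^+ 3 = (coef0 x)%:~R * (((hB x)%:~R + S) / 2) - (coef1 x)%:~R * (hA x)%:~R /\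
  e1 ^+ 3 = (coef0 x)%:~R * (((hB x)%:~R - S) / 2) - (coef1 x)%:~R * (hA x)%:~R.
Proof.
move=> S0 fr; have [p1 p2] := frame_prod S0 fr; have [-> _ _] := frame_hess S0 fr.
rewrite -p1 -p2; case: x fr {p1 p2} => [[[a b] c] d] [eS ea eb _ _] /=.
split; apply: (mulfI S0).
- transitivity ((S * a%:~R) * (x1 * e2) - (S * b%:~R) * (x1 * e1)); last ring.
  rewrite ea eb -eS; ring.
- transitivity ((S * a%:~R) * (x2 * e1) - (S * b%:~R) * (x1 * e1)); last ring.
  rewrite ea eb -eS; ring.
Qed.

(** The cube of x1 depends only on x and S, so x1 is known up to a cube root of unity; the products
    x1 e1, x1 e2 and x2 e1 then determine the other coordinates. *)
Lemma frame_uniq (S x1 x2 e1 e2 x1' x2' e1' e2' : F) x : S != 0 -> hA x != 0 ->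
  frame S x1 x2 e1 e2 x -> frame S x1' x2' e1' e2' x ->
  exists z : F, [/\ z ^+ 3 = 1, x1' = z * x1, x2' = z * x2, e1' = z ^+ 2 * e1 &
    e2' = z ^+ 2 * e2].
Proof.
move=> S0 A0 fr fr'.
have {A0} A0 : (hA x)%:~R != 0 :> F by rewrite intr_eq0.
have [hA1 _ _] := frame_hess S0 fr; have [hA2 _ _] := frame_hess S0 fr'.
have [p1 p2] := frame_prod S0 fr; have [p1' p2'] := frame_prod S0 fr'.
have [c1 _] := frame_cube S0 fr; have [c1' _] := frame_cube S0 fr'.
move: A0 (A0); rewrite {1}hA1 hA2 !mulf_eq0 !negb_or => /andP[x0 e0] /andP[x0' e0'].
exists (x1' / x1).
have z3 : (x1' / x1) ^+ 3 = 1 by rewrite expr_div_n c1 c1' divff // -c1 expf_neq0.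
have ez : e1' = (x1' / x1) ^+ 2 * e1.
  apply: (mulfI x0'); rewrite -hA2 hA1.
  transitivity ((x1' / x1) ^+ 3 * (x1 * e1)); first by rewrite z3 mul1r.
  by field.
split=> //.
- by rewrite divfK.
- apply: (mulIf e0'); rewrite p2' -p2 ez.
  transitivity ((x1' / x1) ^+ 3 * (x2 * e1)); first by rewrite z3 mul1r.
  by ring.
- apply: (mulfI x0'); rewrite p1' -p1.
  transitivity ((x1' / x1) ^+ 3 * (x1 * e2)); first by rewrite z3 mul1r.
  by field.
Qed.

Lemma frame_twist (S x1 x2 e1 e2 z : F) x : z ^+ 3 = 1 -> frame S x1 x2 e1 e2 x ->
  frame S (z * x1) (z * x2) (z ^+ 2 * e1) (z ^+ 2 * e2) x.
Proof.
move=> z3; case: x => [[[a b] c] d] [eS ea eb ec ed]; split.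
- by transitivity (z ^+ 3 * (x1 * e2 - x2 * e1)); [ring|rewrite z3 mul1r].
- by transitivity (z ^+ 3 * x1 ^+ 3 - z ^+ 3 * z ^+ 3 * e1 ^+ 3); [rewrite z3 ea; ring|ring].
- by transitivity (z ^+ 3 * (x1 ^+ 2 * x2) - z ^+ 3 * z ^+ 3 * (e1 ^+ 2 * e2));
    [rewrite z3 eb; ring|ring].
- by transitivity (z ^+ 3 * (x1 * x2 ^+ 2) - z ^+ 3 * z ^+ 3 * (e1 * e2 ^+ 2));
    [rewrite z3 ec; ring|ring].
- by transitivity (z ^+ 3 * x2 ^+ 3 - z ^+ 3 * z ^+ 3 * e2 ^+ 3); [rewrite z3 ed; ring|ring].
Qed.

(** The ideal attached to a frame, each element p being carried along with its conjugate q. *)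
Definition lat (x1 x2 e1 e2 p q : F) : Prop :=
  exists u v : int, p = u%:~R * x1 + v%:~R * x2 /\ q = u%:~R * e1 + v%:~R * e2.

Lemma latD x1 x2 e1 e2 p q p' q' : lat x1 x2 e1 e2 p q -> lat x1 x2 e1 e2 p' q' ->
  lat x1 x2 e1 e2 (p + p') (q + q').
Proof.
move=> [u [v [-> ->]]] [u' [v' [-> ->]]]; exists (u + u'), (v + v').
by rewrite !intrD; split; ring.
Qed.

Lemma latZ (n : int) x1 x2 e1 e2 p q : lat x1 x2 e1 e2 p q ->
  lat x1 x2 e1 e2 (n%:~R * p) (n%:~R * q).
Proof.
move=> [u [v [-> ->]]]; exists (n * u), (n * v).
by rewrite !intrM; split; ring.
Qed.

Lemma lat_mul x1 x2 e1 e2 y1 y2 g1 g2 w1 w2 z1 z2 p q p' q' :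
  lat x1 x2 e1 e2 (y1 * w1) (g1 * z1) -> lat x1 x2 e1 e2 (y1 * w2) (g1 * z2) ->
  lat x1 x2 e1 e2 (y2 * w1) (g2 * z1) -> lat x1 x2 e1 e2 (y2 * w2) (g2 * z2) ->
  lat y1 y2 g1 g2 p q -> lat w1 w2 z1 z2 p' q' ->
  lat x1 x2 e1 e2 (p * p') (q * q').
Proof.
move=> h11 h12 h21 h22 [u [v [-> ->]]] [u' [v' [-> ->]]].
have := latD (latD (latZ (u * u') h11) (latZ (u * v') h12))
             (latD (latZ (v * u') h21) (latZ (v * v') h22)).
rewrite !intrM; set P := (X in lat _ _ _ _ X _); set Q := (X in lat _ _ _ _ _ X).
rewrite (_ : P = (u%:~R * y1 + v%:~R * y2) * (u'%:~R * w1 + v'%:~R * w2)); last by rewrite /P; ring.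
by rewrite (_ : Q = (u%:~R * g1 + v%:~R * g2) * (u'%:~R * z1 + v'%:~R * z2)); last by rewrite /Q; ring.
Qed.

(** Both frames have determinant S, so an inclusion of one lattice in the other is given by an
    integral matrix of determinant 1, which is the required substitution. The cube root of unity
    absorbs the ambiguity of frames. *)
Lemma lat_eqv (S x1 x2 e1 e2 x1' x2' e1' e2' z : F) x x' : S != 0 -> z ^+ 3 = 1 ->
  frame S x1 x2 e1 e2 x -> frame S x1' x2' e1' e2' x' ->
  lat x1 x2 e1 e2 (z ^+ 2 * x1') (z * e1') -> lat x1 x2 e1 e2 (z ^+ 2 * x2') (z * e2') ->
  eqv x x'.
Proof.
move=> S0 z3 fr fr' [r [s [h1 h2]]] [t [w [h3 h4]]].
have fr2 := frame_twist (z := z ^+ 2) _ fr'.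
have {fr2} fr2 : frame S (z ^+ 2 * x1') (z ^+ 2 * x2') (z * e1') (z * e2') x'.
  have -> : z = (z ^+ 2) ^+ 2 by transitivity (z ^+ 3 * z); [rewrite z3 mul1r|ring].
  have -> : ((z ^+ 2) ^+ 2) ^+ 2 = z ^+ 2.
    by transitivity ((z ^+ 3) ^+ 2 * z ^+ 2); [ring|rewrite z3 expr1n mul1r].
  by apply: fr2; transitivity ((z ^+ 3) ^+ 2); [ring|rewrite z3 expr1n].
rewrite h1 h2 h3 h4 in fr2.
have det1 : r * w - s * t = 1.
  apply/eqP; rewrite -(eqr_int F); apply/eqP/(mulfI S0).
  rewrite intrB !intrM mulr1.
  by rewrite -[in RHS](frame_det fr2) -[in LHS](frame_det fr); ring.
exists r, s, t, w; split=> //.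
exact: frame_inj S0 fr2 (frame_sub4 det1 fr).
Qed.

End FrameProducts.

Definition composed (n A A' B C : int) (x z y : form int) : Prop :=
  [/\ hess n A B (A' * C) x, hess n A' B (A * C) z, hess 1 (A * A') B C y,
    n * coef0 y = coef0 x * coef0 z * B - coef0 x * coef1 z * A' - coef1 x * coef0 z * A &
    n * coef1 y = coef0 x * coef0 z * C - coef1 x * coef1 z].

Section ComposedFrames.
Variable F : numFieldType.

Lemma frame_disc (S x1 x2 e1 e2 : F) x : S != 0 -> frame S x1 x2 e1 e2 x ->
  (disc4 x)%:~R = S ^+ 2.
Proof.
move=> S0 fr; have [hA' hB' hC'] := frame_hess S0 fr.
rewrite /disc4 intrB rmorphXn /= !intrM hA' hB' hC' -(frame_det fr); ring.
Qed.

(** The composed form has y1 = x1 z1 / n. Since z1 w1 = n A', multiplication by the conjugate frame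
    (w1, w2) of z brings the frame of y back into the lattice of x. The determinants n s and s
    differ because the content n of x and z is gone from y. *)
Lemma composed_frame (n A A' B C : int) x z y (s x1 x2 e1 e2 z1 z2 w1 w2 : F) :
  n != 0 -> A != 0 -> A' != 0 -> s != 0 -> composed n A A' B C x z y ->
  frame (n%:~R * s) x1 x2 e1 e2 x -> frame (n%:~R * s) z1 z2 w1 w2 z ->
  exists y1 y2 g1 g2 : F, [/\ frame s y1 y2 g1 g2 y,
    y1 * w1 = A'%:~R * x1 /\ g1 * z1 = A'%:~R * e1,
    y1 * w2 = B%:~R * x1 - A%:~R * x2 /\ g1 * z2 = B%:~R * e1 - A%:~R * e2,
    y2 * w1 = x2 /\ g2 * z1 = e2 &
    y2 * w2 = C%:~R * x1 /\ g2 * z2 = C%:~R * e1].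
Proof.
move=> n0 A0 A'0 s0 [hx hz hy e0 e1'] frx frz.
have nF : n%:~R != 0 :> F by rewrite intr_eq0.
have S0 : n%:~R * s != 0 by rewrite mulf_neq0.
have [px1 px2] := frame_prod S0 frx; have [pz1 pz2] := frame_prod S0 frz.
have [pxA _ _] := frame_hess S0 frx; have [pzA _ _] := frame_hess S0 frz.
have [cx _] := frame_cube S0 frx; have [cz _] := frame_cube S0 frz.
have dx := frame_disc S0 frx.
case: hx hz hy => [hxA hxB hxC] [hzA hzB hzC] [hyA hyB hyC].
rewrite hxA intrM in pxA cx; rewrite hzA intrM in pzA cz.
rewrite hxB intrM in px1 px2 cx; rewrite hzB intrM in pz1 pz2 cz.
rewrite !mul1r in hyA hyB hyC.
have hsD : s ^+ 2 = (B ^+ 2 - 4 * (A * A') * C)%:~R.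
  apply: (mulfI (expf_neq0 2 nF)); rewrite -exprMn -dx /disc4 hxA hxB hxC.
  rewrite -rmorphXn /= -intrM; congr (_%:~R); ring.
set sg := (B%:~R + s) / 2; set sb := (B%:~R - s) / 2.
have {px1}px1 : x1 * e2 = n%:~R * sg by rewrite px1 /sg; field.
have {px2}px2 : x2 * e1 = n%:~R * sb by rewrite px2 /sb; field.
have {pz1}pz1 : z1 * w2 = n%:~R * sg by rewrite pz1 /sg; field.
have {pz2}pz2 : z2 * w1 = n%:~R * sb by rewrite pz2 /sb; field.
have sgb : sg + sb = B%:~R by rewrite /sg /sb; field.
have sgN : sg * sb = A%:~R * A'%:~R * C%:~R.
  transitivity ((B%:~R ^+ 2 - s ^+ 2) / 4); first by rewrite /sg /sb; field.
  by rewrite hsD !(intrB, intrM, rmorphXn) /=; field.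
have AF : A%:~R != 0 :> F by rewrite intr_eq0.
have A'F : A'%:~R != 0 :> F by rewrite intr_eq0.
have : x1 * e1 != 0 by rewrite -pxA mulf_neq0.
rewrite mulf_eq0 negb_or => /andP[x10 e10].
have : z1 * w1 != 0 by rewrite -pzA mulf_neq0.
rewrite mulf_eq0 negb_or => /andP[z10 w10].
have hyA0 : hA y != 0 by rewrite hyA mulf_neq0.
have hsy : s ^+ 2 = (disc4 y)%:~R by rewrite hsD /disc4 hyA hyB hyC.
have cy : (x1 * z1 / n%:~R) ^+ 3 =
   (coef0 y)%:~R * (((hB y)%:~R + s) / 2) - (coef1 y)%:~R * (hA y)%:~R.
  rewrite hyA hyB -/sg.
  have E0 := congr1 (fun u : int => u%:~R : F) e0; rewrite !(intrB, intrM) /= in E0.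
  have E1 := congr1 (fun u : int => u%:~R : F) e1'; rewrite !(intrB, intrM) /= in E1.
  apply: (mulfI (expf_neq0 3 nF)).
  transitivity (x1 ^+ 3 * z1 ^+ 3); first by field.
  transitivity (n%:~R ^+ 2 * ((n%:~R * (coef0 y)%:~R) * sg - (n%:~R * (coef1 y)%:~R) * (A%:~R * A'%:~R)));
    last by rewrite intrM; ring.
  rewrite E0 E1 cx cz.
  transitivity (n%:~R ^+ 2 * (((coef0 x)%:~R * sg - (coef1 x)%:~R * A%:~R) *
    ((coef0 z)%:~R * sg - (coef1 z)%:~R * A'%:~R))); first by rewrite /sg; field.
  have sg2 : sg ^+ 2 = B%:~R * sg - A%:~R * A'%:~R * C%:~R by rewrite -sgb -sgN; ring.
  transitivity (n%:~R ^+ 2 * ((coef0 x)%:~R * (coef0 z)%:~R * sg ^+ 2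
     - ((coef0 x)%:~R * (coef1 z)%:~R * A'%:~R + (coef1 x)%:~R * (coef0 z)%:~R * A%:~R) * sg
     + (coef1 x)%:~R * (coef1 z)%:~R * (A%:~R * A'%:~R))); first ring.
  rewrite sg2; ring.
have [y2 [g1 [g2 fry]]] := frame_exists hyA0 hsy cy.
have [py1 py2] := frame_prod s0 fry; have [pyA _ _] := frame_hess s0 fry.
rewrite hyB -/sg in py1; rewrite hyB -/sb in py2; rewrite hyA intrM in pyA.
have g1E : g1 = e1 * w1 / n%:~R.
  have y10 : x1 * z1 / n%:~R != 0.
    have h1 : x1 * z1 != 0 by rewrite mulf_neq0.
    have h2 : n%:~R^-1 != 0 :> F by rewrite invr_eq0.
    exact: mulf_neq0 h1 h2.
  apply: (mulfI y10); rewrite -pyA.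
  transitivity ((n%:~R * A%:~R) * (n%:~R * A'%:~R) / n%:~R ^+ 2 : F); first by field.
  by rewrite pxA pzA; field.
have Ax2 : A%:~R * x2 = sb * x1.
  apply: (mulIf e10); transitivity (A%:~R * (x2 * e1)); first ring.
  rewrite px2; transitivity (sb * (n%:~R * A%:~R)); first ring.
  by rewrite pxA; ring.
have Ae2 : A%:~R * e2 = sg * e1.
  apply: (mulfI x10); transitivity (A%:~R * (x1 * e2)); first ring.
  rewrite px1; transitivity (sg * (n%:~R * A%:~R)); first ring.
  by rewrite pxA; ring.
have AA' : A%:~R * A'%:~R != 0 :> F by rewrite mulf_neq0.
set y1 := x1 * z1 / n%:~R in fry pyA py1 *.
have Y11 : y1 * w1 = A'%:~R * x1.
  transitivity (x1 * (z1 * w1) / n%:~R); first by rewrite /y1; field.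
  by rewrite -pzA; field.
have Y12 : y1 * w2 = sg * x1.
  transitivity (x1 * (z1 * w2) / n%:~R); first by rewrite /y1; field.
  by rewrite pz1; field.
have G11 : g1 * z1 = A'%:~R * e1.
  transitivity (e1 * (z1 * w1) / n%:~R); first by rewrite g1E; field.
  by rewrite -pzA; field.
have G12 : g1 * z2 = sb * e1.
  transitivity (e1 * (z2 * w1) / n%:~R); first by rewrite g1E; field.
  by rewrite pz2; field.
have Y2 : (A%:~R * A'%:~R) * y2 = sb * y1 by rewrite pyA -py2; ring.
have G2 : (A%:~R * A'%:~R) * g2 = sg * g1 by rewrite pyA -py1; ring.
exists y1, y2, g1, g2; split => //; split=> //.
- by rewrite Y12 Ax2 -sgb; ring.
- by rewrite G12 Ae2 -sgb; ring.
- apply: (mulfI AA'); rewrite mulrA Y2 -mulrA Y11.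
  by transitivity (A'%:~R * (sb * x1)); [ring|rewrite -Ax2; ring].
- apply: (mulfI AA'); rewrite mulrA G2 -mulrA G11.
  by transitivity (A'%:~R * (sg * e1)); [ring|rewrite -Ae2; ring].
- apply: (mulfI AA'); rewrite mulrA Y2 -mulrA Y12.
  by transitivity (sg * sb * x1); [ring|rewrite sgN; ring].
- apply: (mulfI AA'); rewrite mulrA G2 -mulrA G12.
  by transitivity (sg * sb * e1); [ring|rewrite sgN; ring].
Qed.

End ComposedFrames.

Lemma algC_frame_exists (S : algC) x : hA x != 0 -> S ^+ 2 = (disc4 x)%:~R ->
  exists x1 x2 e1 e2, frame S x1 x2 e1 e2 x.
Proof.
move=> A0 hS; have h3 := @rootCK algC 3 isT ((coef0 x)%:~R * (((hB x)%:~R + S) / 2) -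
  (coef1 x)%:~R * (hA x)%:~R).
have [x2 [e1 [e2 fr]]] := frame_exists A0 hS h3.
by do 4!eexists; exact: fr.
Qed.

(* Multiplying the product lattice by the conjugate of the lattice of [z] gives back, up to the scalar n, the lattice of [x]. *)
Lemma composed_inj (n A A' B C At Bt Ct j : int) x z y xt yt (u v w : int) :
  n != 0 -> A != 0 -> A' != 0 -> At != 0 -> disc4 x != 0 ->
  composed n A A' B C x z y -> composed n At A' Bt Ct xt (sub4 1 0 j 1 z) yt ->
  u * A' + v * Bt + w * Ct = 1 -> disc4 xt = disc4 x ->
  eqv y yt -> eqv x xt.
Proof.
move=> n0 A0 A'0 At0 D0 cx cxt huvw eD [r [t [r' [t' [det1 eyt]]]]].
have dn : disc4 x = n ^+ 2 * (B ^+ 2 - 4 * A * A' * C).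
  by case: cx => [[h1 h2 h3] _ _ _ _]; rewrite /disc4 h1 h2 h3; ring.
pose s : algC := sqrtC (B ^+ 2 - 4 * A * A' * C)%:~R.
have s2 : s ^+ 2 = (B ^+ 2 - 4 * A * A' * C)%:~R by rewrite sqrtCK.
have s0 : s != 0.
  apply: contra_neq D0 => s00; move: s2; rewrite s00 expr0n /= => /esym/eqP.
  by rewrite intr_eq0 => /eqP h; rewrite dn h mulr0.
have S2 : (n%:~R * s) ^+ 2 = (disc4 x)%:~R by rewrite exprMn s2 dn intrM rmorphXn.
have S0 : n%:~R * s != 0 by rewrite mulf_neq0 // intr_eq0.
have [hx hz hy _ _] := cx; have [hxt _ hyt _ _] := cxt.
have Ax0 : hA x != 0 by case: hx => -> _ _; rewrite mulf_neq0.
have Az0 : hA z != 0 by case: hz => -> _ _; rewrite mulf_neq0.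
have Axt0 : hA xt != 0 by case: hxt => -> _ _; rewrite mulf_neq0.
have Ayt0 : hA yt != 0 by case: hyt => -> _ _; rewrite !mulf_neq0.
have Dz : disc4 z = disc4 x.
  by rewrite dn; case: hz => h1 h2 h3; rewrite /disc4 h1 h2 h3; ring.
have [x1 [x2 [e1 [e2 frx]]]] := algC_frame_exists Ax0 S2.
have [xt1 [xt2 [et1 [et2 frxt]]]] := algC_frame_exists Axt0 (etrans S2 (congr1 _ (esym eD))).
have [z1 [z2 [w1 [w2 frz]]]] := algC_frame_exists Az0 (etrans S2 (congr1 _ (esym Dz))).
have det01 : 1 * 1 - 0 * j = 1 by ring.
have frzt := frame_sub4 det01 frz.
rewrite mulr1z mulr0z !mul0r !addr0 !mul1r in frzt.
have [y1 [y2 [g1 [g2 [fry [a1 a2] [b1 b2] [c1 c2] [d1 d2]]]]]] :=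
  composed_frame n0 A0 A'0 s0 cx frx frz.
have [yt1 [yt2 [gt1 [gt2 [fryt [at1 at2] [bt1 bt2] [ct1 ct2] [dt1 dt2]]]]]] :=
  composed_frame n0 At0 A'0 s0 cxt frxt frzt.
have fryt' := frame_sub4 det1 fry; rewrite -eyt in fryt'.
have [k [k3 ky1 ky2 kg1 kg2]] := frame_uniq s0 Ayt0 fryt' fryt.
have L11 : lat x1 x2 e1 e2 (y1 * w1) (g1 * z1).
  by exists A', 0; rewrite a1 a2 !mul0r !addr0.
have L12 : lat x1 x2 e1 e2 (y1 * w2) (g1 * z2).
  by exists B, (- A); rewrite b1 b2 !intrN; split; ring.
have L21 : lat x1 x2 e1 e2 (y2 * w1) (g2 * z1).
  by exists 0, 1; rewrite c1 c2 !mul0r !add0r !mul1r.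
have L22 : lat x1 x2 e1 e2 (y2 * w2) (g2 * z2).
  by exists C, 0; rewrite d1 d2 !mul0r !addr0.
pose inL p q := lat x1 x2 e1 e2 (k ^+ 2 * p) (k * q).
have W1 : lat w1 w2 z1 z2 w1 z1 by exists 1, 0; rewrite !mul0r !addr0 !mul1r.
have W2 : lat w1 w2 z1 z2 (j%:~R * w1 + w2) (j%:~R * z1 + z2).
  by exists j, 1; rewrite !mul1r.
have K p : k ^+ 2 * (k * p) = p.
  by transitivity (k ^+ 3 * p); [ring|rewrite k3 mul1r].
have K' p : k * (k ^+ 2 * p) = p.
  by transitivity (k ^+ 3 * p); [ring|rewrite k3 mul1r].
have Y1 : lat y1 y2 g1 g2 (k ^+ 2 * yt1) (k * gt1).
  by exists r, t; rewrite ky1 kg1 K K'.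
have Y2 : lat y1 y2 g1 g2 (k ^+ 2 * yt2) (k * gt2).
  by exists r', t'; rewrite ky2 kg2 K K'.
have mulL p q p' q' : lat y1 y2 g1 g2 (k ^+ 2 * p) (k * q) -> lat w1 w2 z1 z2 p' q' ->
    inL (p * p') (q * q').
  by move=> h1 h2; rewrite /inL !mulrA; exact: lat_mul L11 L12 L21 L22 h1 h2.
have addL p q p' q' : inL p q -> inL p' q' -> inL (p + p') (q + q').
  by move=> h1 h2; rewrite /inL !mulrDr; exact: latD.
have scaleL (m : int) p q : inL p q -> inL (m%:~R * p) (m%:~R * q).
  by move=> h; rewrite /inL !(mulrCA _ m%:~R); exact: latZ.
have M11 := mulL _ _ _ _ Y1 W1; have M12 := mulL _ _ _ _ Y1 W2.
have M21 := mulL _ _ _ _ Y2 W1; have M22 := mulL _ _ _ _ Y2 W2.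
apply: (lat_eqv S0 k3 frx frxt); rewrite -/(inL _ _); last by rewrite -ct1 -ct2.
(* As A', Bt and Ct generate the unit ideal, xt1 is an integral combination of the four products;
   xt2 is itself one of them, yt2 w1. *)
have := addL _ _ _ _ (scaleL u _ _ M11)
   (addL _ _ _ _ (scaleL v _ _ (addL _ _ _ _ M12 (scaleL At _ _ M21))) (scaleL w _ _ M22)).
rewrite at1 at2 bt1 bt2 ct1 ct2 dt1 dt2.
have huvw' : u%:~R * A'%:~R + v%:~R * Bt%:~R + w%:~R * Ct%:~R = 1 :> algC.
  by rewrite -!intrM -!intrD huvw.
set P := (X in inL X _); set Q := (X in inL _ X).
have -> : P = xt1 by rewrite -[RHS]mul1r -huvw' /P; ring.
by have -> : Q = et1 by rewrite -[RHS]mul1r -huvw' /Q; ring.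
Qed.

(** * Counting classes with prescribed content *)

Definition hcont (x : form int) : nat := gcdn (gcdn `|hA x| `|hB x|) `|hC x|.

Lemma dvdn_hcont d x : (d %| hcont x)%N = [&& (d %| hA x)%Z, (d %| hB x)%Z & (d %| hC x)%Z].
Proof. by rewrite /hcont !dvdn_gcd -andbA !dvdzE. Qed.

Lemma dvdn_hcont_sub4 d r s t w x : r * w - s * t = 1 ->
  (d %| hcont x)%N -> (d %| hcont (sub4 r s t w x))%N.
Proof.
move=> det1; rewrite !dvdn_hcont hA_sub4 // hB_sub4 // hC_sub4 //.
case/and3P => /dvdzP[A ->] /dvdzP[B ->] /dvdzP[C ->]; apply/and3P; split; apply/dvdzP.
- by exists (A * r ^+ 2 + B * r * s + C * s ^+ 2); ring.
- by exists (2 * A * r * t + B * (r * w + s * t) + 2 * C * s * w); ring.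
- by exists (A * t ^+ 2 + B * t * w + C * w ^+ 2); ring.
Qed.

Lemma hcont_eqv x y : eqv x y -> hcont y = hcont x.
Proof.
move=> xy; apply/eqP; rewrite eqn_dvd.
have h u v : eqv u v -> (hcont u %| hcont v)%N.
  by move=> [r [s [t [w [det1 ->]]]]]; apply: dvdn_hcont_sub4.
by rewrite !h //; exact: eqv_sym.
Qed.

Lemma hcont_gt0 x : disc4 x != 0 -> (0 < hcont x)%N.
Proof.
rewrite lt0n; apply: contraNneq => h0.
have : (0 %| hcont x)%N by rewrite h0.
rewrite dvdn_hcont !dvd0z => /and3P[/eqP hA0 /eqP hB0 /eqP hC0].
by rewrite /disc4 hA0 hB0 hC0.
Qed.

Lemma sqr_hcont_dvd x : ((hcont x ^ 2)%N %| disc4 x)%Z.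
Proof.
have := dvdnn (hcont x); rewrite dvdn_hcont => /and3P[/dvdzP[A hA'] /dvdzP[B hB'] /dvdzP[C hC']].
rewrite /disc4 hA' hB' hC'; apply/dvdzP; exists (B ^+ 2 - 4 * A * C).
rewrite expnS expn1 PoszM; ring.
Qed.

Lemma prime_dvdz_mul (p : nat) (a b : int) : prime p ->
  (p %| a * b)%Z = (p %| a)%Z || (p %| b)%Z.
Proof. by move=> pp; rewrite !dvdzE abszM Euclid_dvdM. Qed.

Lemma prime_dvdz_exp (p : nat) (a : int) n : prime p -> (0 < n)%N -> (p %| a ^+ n)%Z = (p %| a)%Z.
Proof. by move=> pp n0; rewrite !dvdzE abszX Euclid_dvdX // n0 andbT. Qed.

Lemma coprimez_primes (a : int) (N : nat) : (0 < N)%N ->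
  (forall p, prime p -> (p %| N)%N -> ~~ (p %| a)%Z) -> coprimez a N.
Proof.
move=> N0 h; rewrite coprimezE /= coprime_sym; apply/eqP.
apply/eqP; apply: contraT => g1.
have g0 : (0 < gcdn N `|a|)%N by rewrite gcdn_gt0 N0.
have pp : prime (pdiv (gcdn N `|a|)) by rewrite pdiv_prime // ltn_neqAle eq_sym g1.
have pd := pdiv_dvd (gcdn N `|a|).
have := h _ pp (dvdn_trans pd (dvdn_gcdl _ _)).
by rewrite dvdzE /= (dvdn_trans pd (dvdn_gcdr _ _)).
Qed.

Lemma prime_dvd_prod (p : nat) (s : seq nat) (P : pred nat) : prime p -> all prime s ->
  (p %| \prod_(l <- s | P l) l)%N = (p \in s) && P p.
Proof.
move=> pp; elim: s => [|l s IH] /=; first by rewrite big_nil dvdn1; case: (p) pp => [|[]].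
move=> /andP[pl /IH {}IH]; rewrite big_cons in_cons.
case: ifP => Pl; rewrite ?Euclid_dvdM // IH.
  by rewrite dvdn_prime2 //; case: eqP => [->|//]; rewrite Pl.
by case: eqP => [->|//]; rewrite Pl andbF.
Qed.

Lemma primitive_value_coprime (A B C : int) (N : nat) : (0 < N)%N ->
  (forall p, prime p -> ~~ [&& (p %| A)%Z, (p %| B)%Z & (p %| C)%Z]) ->
  exists r s t w : int, r * w - s * t = 1 /\ coprimez (A * r ^+ 2 + B * r * s + C * s ^+ 2) N.
Proof.
move=> N0 prim.
(* At a prime p of N the value at (r, s) is congruent to A r^2 if p does not divide A, to C s^2 if p
   divides A but not C, and to B r s if p divides both; r and s are built to make this term a
   unit. *)
pose r := (\prod_(p <- primes N | (p %| A)%Z && ~~ (p %| C)%Z) p)%N.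
pose s := (\prod_(p <- primes N | ~~ (p %| A)%Z) p)%N.
have allp : all prime (primes N) by exact: all_prime_primes.
have rP p : prime p -> (p %| r)%N = (p \in primes N) && ((p %| A)%Z && ~~ (p %| C)%Z).
  by move=> pp; rewrite prime_dvd_prod.
have sP p : prime p -> (p %| s)%N = (p \in primes N) && ~~ (p %| A)%Z.
  by move=> pp; rewrite prime_dvd_prod.
have s0 : (0 < s)%N.
  rewrite /s big_seq_cond; apply: prodn_cond_gt0 => p /andP[+ _].
  by rewrite mem_primes => /and3P[/prime_gt0].
have crs : coprimez r s.
  apply: coprimez_primes => // p pp; rewrite sP // => /andP[_ pA].
  by rewrite dvdzE /= rP // (negbTE pA) andbF.
have /coprimezP[[u v] /= huv] := crs.
exists r%:Z, s%:Z, (- v), u; split; first by rewrite -huv; ring.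
apply: coprimez_primes => // p pp pN.
have pm : p \in primes N by rewrite mem_primes pp N0.
have dr : (p %| r%:Z)%Z = (p %| A)%Z && ~~ (p %| C)%Z by rewrite dvdzE /= rP // pm.
have ds : (p %| s%:Z)%Z = ~~ (p %| A)%Z by rewrite dvdzE /= sP // pm.
have := prim p pp; apply: contra => dV.
have dX (u' v' w' : int) : u' + v' + w' = A * r%:Z ^+ 2 + B * r%:Z * s%:Z + C * s%:Z ^+ 2 ->
    (p %| u')%Z -> (p %| v')%Z -> (p %| w')%Z.
  move=> e du dv; have -> : w' = (A * r%:Z ^+ 2 + B * r%:Z * s%:Z + C * s%:Z ^+ 2) - u' - v'.
    by rewrite -e; ring.
  by rewrite !rpredB.
case pA : (p %| A)%Z dr ds; case pC : (p %| C)%Z => //= dr ds.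
- have : (p %| B * r%:Z * s%:Z)%Z.
    apply: (dX (A * r%:Z ^+ 2) (C * s%:Z ^+ 2)); [ring|exact: dvdz_mulr|exact: dvdz_mulr].
  by rewrite !prime_dvdz_mul // dr ds !orbF => ->.
- have : (p %| C * s%:Z ^+ 2)%Z.
    apply: (dX (A * r%:Z ^+ 2) (B * r%:Z * s%:Z)); [ring|exact: dvdz_mulr|].
    by rewrite mulrAC dvdz_mull // dr.
  by rewrite prime_dvdz_mul // prime_dvdz_exp // pC ds.
- have : (p %| A * r%:Z ^+ 2)%Z.
    apply: (dX (C * s%:Z ^+ 2) (B * r%:Z * s%:Z)); [ring|exact: dvdz_mulr|].
    by rewrite dvdz_mull // ds.
  by rewrite prime_dvdz_mul // prime_dvdz_exp // pA dr.
- have : (p %| A * r%:Z ^+ 2)%Z.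
    apply: (dX (C * s%:Z ^+ 2) (B * r%:Z * s%:Z)); [ring| |by rewrite dvdz_mull // ds].
    by rewrite expr2 mulrA dvdz_mull // ds.
  by rewrite prime_dvdz_mul // prime_dvdz_exp // pA dr.
Qed.

Definition primitive3 (A B C : int) : Prop :=
  forall p : nat, prime p -> ~~ [&& (p %| A)%Z, (p %| B)%Z & (p %| C)%Z].

Lemma hess_hcont x : disc4 x != 0 ->
  exists A B C, hess (hcont x) A B C x /\ primitive3 A B C.
Proof.
move=> D0; have n0 := hcont_gt0 D0.
have := dvdnn (hcont x); rewrite dvdn_hcont => /and3P[/dvdzP[A hA'] /dvdzP[B hB'] /dvdzP[C hC']].
exists A, B, C; split; first by split; rewrite ?hA' ?hB' ?hC' mulrC.
move=> p pp; apply/negP => /and3P[dA dB dC].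
have : (p * hcont x %| hcont x)%N.
  by rewrite dvdn_hcont hA' hB' hC' PoszM !dvdz_mul.
by move=> /(dvdn_leq n0); rewrite -{2}[hcont x]mul1n leq_pmul2r // leqNgt prime_gt1.
Qed.

Lemma hess_primitive (n : nat) A B C x : (0 < n)%N -> hess n A B C x -> hcont x = n -> primitive3 A B C.
Proof.
move=> n0 [hA' hB' hC'] hn p pp; apply/negP => /and3P[dA dB dC].
have : (p * n %| n)%N.
  by rewrite -{2}hn dvdn_hcont hA' hB' hC' PoszM ![n%:Z * _]mulrC !dvdz_mul.
by move=> /(dvdn_leq n0); rewrite -{2}[n]mul1n leq_pmul2r // leqNgt prime_gt1.
Qed.

Definition redA (x : form int) : int := (hA x %/ hcont x)%Z.

Lemma hess_redA (n : nat) A B C x : (0 < n)%N -> hess n A B C x -> hcont x = n -> redA x = A.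
Proof.
by move=> n0 [hA' _ _] hn; rewrite /redA hA' hn mulKz // -lt0n.
Qed.

Lemma coprime_rep (N : nat) x : disc4 x != 0 -> (0 < N)%N ->
  exists2 y, eqv x y & coprimez (redA y) N.
Proof.
move=> D0 N0; have [A [B [C [[hA' hB' hC'] prim]]]] := hess_hcont D0.
have [r [s [t [w [det1 cop]]]]] := primitive_value_coprime N0 prim.
have xy : eqv x (sub4 r s t w x) by exists r, s, t, w.
exists (sub4 r s t w x) => //.
rewrite /redA (hcont_eqv xy) hA_sub4 // hA' hB' hC'.
rewrite (_ : _ + _ = (hcont x)%:Z * (A * r ^+ 2 + B * r * s + C * s ^+ 2)); last ring.
by rewrite mulKz // -lt0n hcont_gt0.
Qed.

(** Composition asks for coprime leading Hessian coefficients. Representatives are chosen one after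
    another, each coprime to N and to its predecessors; 1 < N keeps these coefficients nonzero. *)
Lemma coprime_reps (N : nat) (s : seq (form int)) : (1 < N)%N -> ineqs s ->
  {in s, forall x, disc4 x != 0} ->
  exists s', [/\ ineqs s', size s' = size s, {in s', forall y, exists2 x, x \in s & eqv x y},
    {in s', forall y, coprimez (redA y) N} & pairwise (fun x y => coprimez (redA x) (redA y)) s'].
Proof.
move=> N1; elim: s => [|x s IH]; first by exists [::].
rewrite /ineqs /= -/(ineqs s) => /andP[/allP hx si] hD.
have [|s' [si' sz hs' hN hc]] := IH si; first by move=> y ys; apply: hD; rewrite in_cons ys orbT.
pose M := (\prod_(y <- s') `|redA y|)%N.
have nz y : y \in s' -> (0 < `|redA y|)%N.
  move=> /hN; rewrite absz_gt0; apply: contraTneq => ->.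
  by rewrite /coprimez gcd0z /=; case: (N) N1 => [|[|]].
have M0 : (0 < N * M)%N.
  by rewrite muln_gt0 (ltnW N1) /M big_seq prodn_cond_gt0.
have [y xy cy] := coprime_rep (hD x (mem_head _ _)) M0.
have [cyN cyM] : coprimez (redA y) N /\ coprimez (redA y) M.
  by move: cy; rewrite !coprimezE /= coprimeMr => /andP.
exists (y :: s'); split => /=.
- rewrite /ineqs /= -/(ineqs s') si' andbT; apply/allP => z /hs'[x' x's x'z].
  apply/asboolPn => yz; have /asboolPn := hx x' x's; apply.
  exact: eqv_trans xy (eqv_trans yz (eqv_sym x'z)).
- by rewrite sz.
- move=> z; rewrite in_cons => /orP[/eqP ->|/hs'[x' x's e]].
    by exists x => //; rewrite mem_head.
  by exists x' => //; rewrite in_cons x's orbT.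
- by move=> z; rewrite in_cons => /orP[/eqP -> //|/hN].
- rewrite hc andbT; apply/allP => z zs; move: cyM; rewrite !coprimezE /=.
  by apply: coprime_dvdr; rewrite /M (big_rem z) //= dvdn_mulr.
Qed.

(* Here k = gcd(a, b, n), n0 = n / k^2, and s = b0 A / a0 modulo n0; subtracting B / 2 makes t invariant under the
   translations of x. *)
Definition has_key (n k n0 t : nat) (x : form int) : Prop :=
  exists A B C a0 b0 s : int,
    [/\ hess n A B C x, coef0 x = k%:Z * a0 /\ coef1 x = k%:Z * b0, coprimez a0 n0,
      (n0 %| a0 * s - b0 * A)%Z & (n0 %| s - (B %/ 2)%Z - t%:Z)%Z].

(** Says that s = t + floor(B / 2) is a root of X^2 - B X + A C modulo n0, expressed through the
    discriminant D = B^2 - 4 A C alone. *)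
Definition key_root (D : int) (n0 t : nat) : bool :=
  (4 * n0%:Z %| (2 * t%:Z - (D %% 2)%Z) ^+ 2 - D)%Z.

Lemma modz2_sqr (B : int) : (B ^+ 2 %% 2)%Z = (B %% 2)%Z.
Proof.
have : B = 2 * (B %/ 2)%Z + (B %% 2)%Z by rewrite {1}(divz_eq B 2) mulrC.
have := ltz_pmod B (isT : 0 < 2 :> int); have := modz_ge0 B (isT : 2 != 0 :> int).
move: (B %/ 2)%Z (B %% 2)%Z => h e e0 e2 ->.
have [->|->] : e = 0 \/ e = 1 by lia.
  by rewrite (_ : _ ^+ 2 = (2 * h ^+ 2) * 2) ?modzMl //; ring.
by rewrite (_ : _ ^+ 2 = (2 * h ^+ 2 + 2 * h) * 2 + 1) ?modzMDl //; ring.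
Qed.

Lemma disc_parity A B C : ((B ^+ 2 - 4 * A * C) %% 2)%Z = (B %% 2)%Z.
Proof.
rewrite -[RHS]modz2_sqr (_ : B ^+ 2 - 4 * A * C = (- (2 * A * C)) * 2 + B ^+ 2); last ring.
by rewrite modzMDl.
Qed.

(** The norm equation and the coprimality of A and n give k^2 | n and make a0 a unit modulo m = n /
    k^2. There a0 sigma - b0 A becomes a0 (sigma - s), and the norm equation says that s is a root
    of X^2 - B X + A C. *)
Lemma key_exists (n : nat) A B C x : (0 < n)%N -> hess n A B C x -> coprimez A n ->
  exists k t : nat, [/\ (0 < k)%N, (k ^ 2 %| n)%N, (t < n %/ k ^ 2)%N,
    has_key n k (n %/ k ^ 2) t x & key_root (B ^+ 2 - 4 * A * C) (n %/ k ^ 2) t].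
Proof.
move=> n0 hx cA; have nz : n%:Z != 0 by rewrite -lt0n.
have nrm := hess_norm nz hx.
pose k := gcdn (gcdn `|coef0 x| `|coef1 x|) n.
have k0 : (0 < k)%N by rewrite gcdn_gt0 n0 orbT.
have /dvdzP[a0 ea] : (k %| coef0 x)%Z.
  by rewrite dvdzE /= (dvdn_trans (dvdn_gcdl _ _)) ?dvdn_gcdl.
have /dvdzP[b0 eb] : (k %| coef1 x)%Z.
  by rewrite dvdzE /= (dvdn_trans (dvdn_gcdl _ _)) ?dvdn_gcdr.
have kn : (k %| n)%N by exact: dvdn_gcdr.
have k2n : (k ^ 2 %| n)%N.
  have : (k%:Z ^+ 2 %| n%:Z * A ^+ 2)%Z.
    rewrite -nrm ea eb; apply/dvdzP; exists (a0 ^+ 2 * C - a0 * b0 * B + b0 ^+ 2 * A); ring.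
  rewrite Gauss_dvdzl; first by rewrite dvdzE abszX.
  rewrite coprimezE !abszX coprimeXl // coprimeXr //.
  by move: cA; rewrite coprimezE coprime_sym; apply: coprime_dvdl.
pose m := (n %/ k ^ 2)%N.
have nE : n = (k ^ 2 * m)%N by rewrite mulnC divnK.
have m0 : (0 < m)%N by move: n0; rewrite nE muln_gt0 => /andP[].
have nrm0 : a0 ^+ 2 * C - a0 * b0 * B + b0 ^+ 2 * A = m%:Z * A ^+ 2.
  have k20 : k%:Z ^+ 2 != 0 by rewrite expf_neq0 // -lt0n.
  apply: (mulfI k20); transitivity (n%:Z * A ^+ 2).
    by rewrite -nrm ea eb; ring.
  by rewrite nE PoszM -mulnn PoszM; ring.
have cAm p : prime p -> (p %| m)%N -> ~~ (p %| A)%Z.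
  move=> pp pm; apply/negP => pA; have pn : (p %| n)%N by rewrite nE dvdn_mull.
  have : (p %| gcdn `|A| n)%N by move: pA; rewrite dvdn_gcd pn andbT dvdzE.
  move: cA; rewrite coprimezE /coprime /= => /eqP ->; rewrite dvdn1 => /eqP p1.
  by rewrite p1 in pp.
have ca0 : coprimez a0 m.
  apply: coprimez_primes => // p pp pm; apply/negP => pa.
  have : (p %| b0 ^+ 2 * A)%Z.
    have -> : b0 ^+ 2 * A = m%:Z * A ^+ 2 - a0 * (a0 * C - b0 * B) by rewrite -nrm0; ring.
    by rewrite rpredB // dvdz_mulr // dvdzE.
  rewrite prime_dvdz_mul // prime_dvdz_exp // (negbTE (cAm _ pp pm)) orbF => pb.
  have : (p * k %| k)%N.
    move: pa pb; rewrite !dvdzE /= => pa pb.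
    rewrite {2}/k !dvdn_gcd ea eb !abszM /= !dvdn_mul //=.
    by rewrite nE -mulnn mulnAC dvdn_mul // dvdn_mull.
  by move=> /(dvdn_leq k0); rewrite -{2}[k]mul1n leq_pmul2r // leqNgt prime_gt1.
have /coprimezP[[u v] /= huv] := ca0.
pose s := u * b0 * A.
have hs : a0 * s - b0 * A = - (b0 * A * v) * m%:Z.
  transitivity (b0 * A * (u * a0 + v * m%:Z) - b0 * A - b0 * A * v * m%:Z).
    by rewrite /s; ring.
  by rewrite huv; ring.
pose t := `|((s - (B %/ 2)%Z) %% m)%Z|%N.
have tE : (t : int) = ((s - (B %/ 2)%Z) %% m)%Z by rewrite gez0_abs // modz_ge0 // -lt0n.
exists k, t; rewrite -/m; split => //.
- by rewrite -ltz_nat tE ltz_pmod.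
- exists A, B, C, a0, b0, s; split=> //.
  + by rewrite ea eb; split; rewrite mulrC.
  + by rewrite hs dvdz_mull.
  + by rewrite tE -eqz_mod_dvd modz_mod.
have root_s : (m %| s ^+ 2 - B * s + A * C)%Z.
  have : (m %| a0 ^+ 2 * (s ^+ 2 - B * s + A * C))%Z.
    have -> : a0 ^+ 2 * (s ^+ 2 - B * s + A * C) =
      (a0 * s - b0 * A) * (a0 * s + b0 * A - a0 * B) + A * (a0 ^+ 2 * C - a0 * b0 * B + b0 ^+ 2 * A).
      by ring.
    rewrite hs nrm0; apply/dvdzP.
    by exists (A ^+ 3 - b0 * A * v * (a0 * s + b0 * A - a0 * B)); ring.
  by rewrite Gauss_dvdzr // coprimezE abszX coprimeXr // coprime_sym -coprimezE.
rewrite /key_root disc_parity.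
have eB : B = 2 * (B %/ 2)%Z + (B %% 2)%Z by rewrite {1}(divz_eq B 2) mulrC.
have /dvdzP[q hq] : (m %| t%:Z - (s - (B %/ 2)%Z))%Z by rewrite tE -eqz_mod_dvd modz_mod.
case/dvdzP: root_s => q' hq'.
apply/dvdzP; exists (q' + q * (2 * s - B) + q ^+ 2 * m%:Z).
have -> : 2 * t%:Z - (B %% 2)%Z = 2 * s - B + 2 * (q * m%:Z).
  by move: eB; rewrite -hq; move: (B %/ 2)%Z (B %% 2)%Z => h e ->; ring.
transitivity (4 * (s ^+ 2 - B * s + A * C) + 4 * m%:Z * (q * (2 * s - B) + q ^+ 2 * m%:Z)).
  by ring.
by rewrite hq'; ring.
Qed.

(** The substitution u -> - u, of determinant -1, which represents the inverse class. *)
Definition inv3 (x : form int) : form int := let: (a, b, c, d) := x in (- a, b, - c, d).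

Lemma hess_inv3 n A B C x : hess n A B C x -> hess n A (- B) C (inv3 x).
Proof.
case: x => [[[a b] c] d] [/= h1 h2 h3]; split; rewrite /= ?mulrN -?h1 -?h2 -?h3; ring.
Qed.

Lemma hess_transl n A B C x i : hess n A B C x ->
  hess n A (B + 2 * A * i) (A * i ^+ 2 + B * i + C) (sub4 1 0 i 1 x).
Proof.
move=> [h1 h2 h3]; have e : 1 * 1 - 0 * i = 1 :> int by ring.
by split; rewrite ?hA_sub4 ?hB_sub4 ?hC_sub4 // h1 h2 h3; ring.
Qed.

Lemma coef0_transl x i : coef0 (sub4 1 0 i 1 x) = coef0 x.
Proof. case: x => [[[a b] c] d] /=; ring. Qed.

Lemma coef1_transl x i : coef1 (sub4 1 0 i 1 x) = coef1 x + coef0 x * i.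
Proof. case: x => [[[a b] c] d] /=; ring. Qed.

Lemma hess_inj n A B C A' B' C' x : n != 0 -> hess n A B C x -> hess n A' B' C' x ->
  [/\ A' = A, B' = B & C' = C].
Proof. move=> n0 [h1 h2 h3] [h1' h2' h3']; split; apply: (mulfI n0).
- by rewrite -h1 -h1'.
- by rewrite -h2 -h2'.
- by rewrite -h3 -h3'.
Qed.

(** Modulo n0 the two factors are a (sigma - s) and a1 (sigma - s1). With s1 = B - s the conjugate
    root, (sigma - s) (sigma - s1) = 0. *)
Lemma composition_dvd (n0 A A1 B C a b a1 b1 s s1 : int) :
  coprimez A n0 -> coprimez A1 n0 -> coprimez a n0 ->
  (n0 %| a * s - b * A)%Z -> (n0 %| a1 * s1 - b1 * A1)%Z -> (n0 %| s + s1 - B)%Z ->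
  (n0 %| a ^+ 2 * (A1 * C) - a * b * B + b ^+ 2 * A)%Z ->
  (n0 %| a * a1 * B - a * b1 * A1 - b * a1 * A)%Z /\ (n0 %| a * a1 * C - b * b1)%Z.
Proof.
move=> cA cA1 ca /dvdzP[p1 e1] /dvdzP[p2 e2] /dvdzP[p3 e3] /dvdzP[q hq].
have cX (u : int) : coprimez u n0 -> coprimez n0 u by rewrite coprimez_sym.
split.
  apply/dvdzP; exists (- a * a1 * p3 + a * p2 + a1 * p1).
  transitivity (- a * a1 * (s + s1 - B) + a * (a1 * s1 - b1 * A1) + a1 * (a * s - b * A)).
    by ring.
  by rewrite e1 e2 e3; ring.
have [p4 e4] : exists p4, s ^+ 2 - B * s + A * (A1 * C) = p4 * n0.
  apply/dvdzP.
  have : (n0 %| a * (a * (s ^+ 2 - B * s + A * (A1 * C))))%Z.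
    apply/dvdzP; exists (p1 * (a * s + b * A - a * B) + A * q).
    transitivity ((a * s - b * A) * (a * s + b * A - a * B)
       + A * (a ^+ 2 * (A1 * C) - a * b * B + b ^+ 2 * A)); first ring.
    by rewrite e1 hq; ring.
  by rewrite !Gauss_dvdzr ?cX.
have : (n0 %| A * (A1 * (a * a1 * C - b * b1)))%Z.
  apply/dvdzP; exists (a * a1 * (p4 - p3 * s) + a * s * p2 + a1 * s1 * p1 - p1 * p2 * n0).
  have f1 : b * A = a * s - p1 * n0 by rewrite -e1; ring.
  have f2 : b1 * A1 = a1 * s1 - p2 * n0 by rewrite -e2; ring.
  have f3 : A * (A1 * C) = p4 * n0 - s ^+ 2 + B * s by rewrite -e4; ring.
  have f4 : B = s + s1 - p3 * n0 by rewrite -e3; ring.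
  transitivity (a * a1 * (A * (A1 * C)) - (b * A) * (b1 * A1)); first ring.
  by rewrite f1 f2 f3 {1}f4; ring.
by rewrite !Gauss_dvdzr ?cX.
Qed.

(** Composing with the inverse of x1 turns equal keys into conjugate roots, as [composition_dvd]
    requires. The translations i and j give both Hessians the middle coefficient Bc; equality of
    discriminants then produces the common Cc. *)
Lemma key_compose (n k n0 t : nat) A B C A1 B1 C1 x x1 : (0 < n)%N -> n = (k ^ 2 * n0)%N ->
  hess n A B C x -> hess n A1 B1 C1 x1 -> has_key n k n0 t x -> has_key n k n0 t x1 ->
  A != 0 -> A1 != 0 -> coprimez A A1 -> coprimez A n -> coprimez A1 n ->
  B ^+ 2 - 4 * A * C = B1 ^+ 2 - 4 * A1 * C1 ->
  exists i j Bc Cc y, composed n A A1 Bc Cc (sub4 1 0 i 1 x) (sub4 1 0 j 1 (inv3 x1)) y.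
Proof.
move=> ngt0 nE hx hx1.
have nz : n%:Z != 0 by rewrite -lt0n.
move=> [A_ [B_ [C_ [a0 [b0 [s [hx_ [ea eb] ca hs ht]]]]]]].
have [eA eB eC] := hess_inj nz hx hx_; subst A_ B_ C_ => {hx_}.
move=> [A_ [B_ [C_ [al [be [s1 [hx1_ [ea1 eb1] ca1 hs1 ht1]]]]]]].
have [eA eB eC] := hess_inj nz hx1 hx1_; subst A_ B_ C_ => {hx1_}.
move=> A0 A10 cAA1 cAn cA1n eD.
have k0 : k%:Z ^+ 2 != 0.
  by rewrite expf_neq0 //; apply: contraTneq ngt0 => -[k0]; rewrite nE k0 mul0n.
have nZ : n%:Z = k%:Z ^+ 2 * n0%:Z by rewrite nE PoszM -mulnn PoszM; ring.
have par : (B1 %% 2)%Z = (B %% 2)%Z by rewrite -(disc_parity A B C) eD disc_parity.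
have eB : B = 2 * (B %/ 2)%Z + (B %% 2)%Z by rewrite {1}(divz_eq B 2) mulrC.
have eB1 : B1 = 2 * (B1 %/ 2)%Z + (B %% 2)%Z by rewrite -par {1}(divz_eq B1 2) mulrC.
move: eB eB1 ht ht1; move: (B %/ 2)%Z (B1 %/ 2)%Z (B %% 2)%Z => h h1 ep eB eB1 ht ht1.
have /coprimezP[[u v] /= huv] := cAA1.
(* B + 2 A i = - B1 + 2 A1 j amounts to A i - A1 j = - (B + B1) / 2, an integer since B and B1 have
   the parity of the common discriminant. *)
pose w := - (h + h1 + ep); pose i := u * w; pose j := - v * w.
have ij : A * i - A1 * j = w.
  transitivity ((u * A + v * A1) * w); first by rewrite /i /j; ring.
  by rewrite huv mul1r.
pose Bc := B + 2 * A * i.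
have Bc' : Bc = - B1 + 2 * A1 * j.
  have : A * i = w + A1 * j by rewrite -ij; ring.
  rewrite /Bc eB eB1 -mulrA => ->; rewrite /w; ring.
have hX := hess_transl i hx; have hZ := hess_transl j (hess_inv3 hx1).
rewrite -/Bc in hX; rewrite -Bc' in hZ.
set CX := A * i ^+ 2 + _ + _ in hX; set CZ := A1 * j ^+ 2 + _ + _ in hZ.
have eACX : A * CX = A1 * CZ.
  have four0 : 4 != 0 :> int by [].
  apply: (mulfI four0).
  transitivity (Bc ^+ 2 - (B ^+ 2 - 4 * A * C)); first by rewrite /Bc /CX; ring.
  by rewrite eD Bc' /CZ; ring.
have [Cc eCX] : exists Cc, CX = A1 * Cc.
  have : (A1 %| A * CX)%Z by rewrite eACX dvdz_mulr.
  rewrite Gauss_dvdzr; last by rewrite coprimez_sym.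
  by case/dvdzP => Cc ->; exists Cc; rewrite mulrC.
have eCZ : CZ = A * Cc.
  by apply: (mulfI A10); rewrite -eACX eCX; ring.
rewrite eCX in hX; rewrite eCZ in hZ.
have cn0 (z : int) : coprimez z n -> coprimez z n0.
  rewrite !coprimezE nE /=; exact: coprime_dvdr (dvdn_mull _ (dvdnn _)).
have nrmX := hess_norm nz hX.
rewrite !coef0_transl coef1_transl ea eb nZ in nrmX.
have nrm0 : (n0 %| a0 ^+ 2 * (A1 * Cc) - a0 * (b0 + a0 * i) * Bc + (b0 + a0 * i) ^+ 2 * A)%Z.
  apply/dvdzP; exists (A ^+ 2); apply: (mulfI k0).
  transitivity (k%:Z ^+ 2 * n0%:Z * A ^+ 2); last ring.
  by rewrite -nrmX; ring.
have c0z : coef0 (inv3 x1) = - coef0 x1 by case: (x1) => [[[? ?] ?] ?].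
have c1z : coef1 (inv3 x1) = coef1 x1 by case: (x1) => [[[? ?] ?] ?].
have [||||d1 d2] := @composition_dvd n0 A A1 Bc Cc a0 (b0 + a0 * i) (- al) (be - al * j)
   (s + A * i) (- s1 + A1 * j) (cn0 _ cAn) (cn0 _ cA1n) ca _ _ _ _ => //.
- by rewrite (_ : _ - _ = a0 * s - b0 * A) //; ring.
- by rewrite (_ : _ - _ = al * s1 - be * A1) //; ring.
- have -> : s + A * i + (- s1 + A1 * j) - Bc = (s - h - t%:Z) - (s1 - h1 - t%:Z).
    have : A * i = w + A1 * j by rewrite -ij; ring.
    by rewrite /Bc eB -[2 * A * i]mulrA => ->; rewrite /w; ring.
  by rewrite rpredB.
have [||y [hy e0 e1]] := @composition n A A1 Bc Cc (sub4 1 0 i 1 x) (sub4 1 0 j 1 (inv3 x1))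
  nz A0 A10 cAA1 cAn cA1n hX hZ.
- rewrite !coef0_transl !coef1_transl c0z c1z ea eb ea1 eb1 nZ.
  rewrite (_ : _ - _ = k%:Z ^+ 2 * (a0 * - al * Bc - a0 * (be - al * j) * A1 - (b0 + a0 * i) * - al * A)); last ring.
  by rewrite dvdz_mul.
- rewrite !coef0_transl !coef1_transl c0z c1z ea eb ea1 eb1 nZ.
  rewrite (_ : _ - _ = k%:Z ^+ 2 * (a0 * - al * Cc - (b0 + a0 * i) * (be - al * j))); last ring.
  by rewrite dvdz_mul.
by exists i, j, Bc, Cc, y; split.
Qed.

Lemma hcont_inv3 x : hcont (inv3 x) = hcont x.
Proof.
case: x => [[[a b] c] d]; rewrite /hcont /=.
rewrite (_ : b ^+ 2 - - a * - c = b ^+ 2 - a * c); last ring.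
rewrite (_ : b * - c - - a * d = - (b * c - a * d)); last ring.
by rewrite (_ : (- c) ^+ 2 - b * d = c ^+ 2 - b * d) ?abszN //; ring.
Qed.

Lemma bezout3 A B C : primitive3 A B C -> exists u v w : int, u * A + v * B + w * C = 1.
Proof.
move=> prim; have [u [v huv]] := Bezoutz A B.
have cg : coprimez C (gcdz A B).
  have [g0|g0] := posnP `|gcdz A B|%N.
    have A0 : A = 0 /\ B = 0.
      move/eqP: g0; rewrite absz_eq0 => /eqP g0.
      by have := dvdz_gcdl A B; have := dvdz_gcdr A B; rewrite g0 !dvd0z => /eqP -> /eqP ->.
    case: A0 prim => -> -> prim; rewrite coprimezE /= /coprime !gcdn0.
    have [//|c1] := eqVneq `|C|%N 1%N.
    have [C0|C0] := posnP `|C|%N.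
      by have /negP := prim 2 isT; rewrite !dvdzE C0.
    have pp : prime (pdiv `|C|) by rewrite pdiv_prime // ltn_neqAle eq_sym c1.
    by have /negP := prim _ pp; rewrite !dvdz0 dvdzE /= pdiv_dvd.
  have -> : gcdz A B = `|gcdz A B|%N by rewrite abszE ger0_norm.
  apply: coprimez_primes => // p pp pg; apply: contra (prim p pp) => pC.
  have pg' : (p %| gcdz A B)%Z by rewrite dvdzE.
  by rewrite pC andbT; apply/andP; split; apply: dvdz_trans pg' _; rewrite ?dvdz_gcdl ?dvdz_gcdr.
have /coprimezP[[w q] /= hwq] := cg.
exists (q * u), (q * v), w.
transitivity (w * C + q * (u * A + v * B)); first ring.
by rewrite huv hwq.
Qed.

Lemma transl_comp i j x : sub4 1 0 j 1 (sub4 1 0 i 1 x) = sub4 1 0 (i + j) 1 x.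
Proof. by rewrite sub4_comp; congr (sub4 _ _ _ _ _); ring. Qed.

Lemma eqv_transl i x : eqv x (sub4 1 0 i 1 x).
Proof. by exists 1, 0, i, 1; split => //; ring. Qed.

(** All members but the first are composed with the inverse of the first; the first is lost, since
    leading coefficients are coprime for distinct members only. Hence the successor in the bound. *)
Lemma key_list (n k n0 t : nat) (D : int) (s : seq (form int)) :
  (0 < n)%N -> n = (k ^ 2 * n0)%N -> D != 0 -> ineqs s ->
  {in s, forall x, [/\ disc4 x = D, hcont x = n, coprimez (redA x) (2 * n)%N & has_key n k n0 t x]} ->
  pairwise (fun x y => coprimez (redA x) (redA y)) s ->
  exists ys, [/\ ineqs ys, (size s <= (size ys).+1)%N &
    {in ys, forall y, n%:Z ^+ 2 * disc4 y = D}].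
Proof.
move=> ngt0 nE D0; case: s => [|x1 s]; first by exists [::].
rewrite /ineqs /= => /andP[_ si] hs /andP[/allP hc _].
have nz : n%:Z != 0 by rewrite -lt0n.
have facts x : x \in x1 :: s -> exists A B C, [/\ hess n A B C x, A != 0, coprimez A n,
    redA x = A & D = n%:Z ^+ 2 * (B ^+ 2 - 4 * A * C)].
  move=> /hs[Dx hn cA _].
  have [|A [B [C [hx _]]]] := @hess_hcont x; first by rewrite Dx.
  rewrite hn in hx; exists A, B, C.
  have rA := hess_redA ngt0 hx hn; rewrite rA in cA.
  have cAn : coprimez A n.
    by move: cA; rewrite !coprimezE /=; apply: coprime_dvdr; rewrite dvdn_mull.
  (* Coprimality with 2 n rather than n excludes A = 0 also when n = 1. *)
  have A0 : A != 0.
    apply: contraTneq cA => ->; rewrite coprimezE /coprime gcd0n.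
    by case: (n) ngt0 => [|[|]].
  split=> //; case: hx => h1 h2 h3; rewrite -Dx /disc4 h1 h2 h3; ring.
have [A1 [B1 [C1 [hx1 A10 cA1n rA1 eD1]]]] := facts _ (mem_head _ _).
have [Dx1 hn1 _ key1] := hs _ (mem_head _ _).
have n2 : n%:Z ^+ 2 != 0 by rewrite expf_neq0.
pose P x y := exists A Bc Cc i j, A != 0 /\
  composed n A A1 Bc Cc (sub4 1 0 i 1 x) (sub4 1 0 j 1 (inv3 x1)) y.
have /choice[f hf] x : exists y, x \in s -> P x y.
  have [xs|xs] := boolP (x \in s); last by exists x.
  have xs' : x \in x1 :: s by rewrite in_cons xs orbT.
  have [A [B [C [hx A0 cAn rA eD]]]] := facts _ xs'.
  have [Dx hn _ key] := hs _ xs'.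
  have cAA1 : coprimez A A1 by rewrite coprimez_sym -rA -rA1; exact: hc.
  have eDD : B ^+ 2 - 4 * A * C = B1 ^+ 2 - 4 * A1 * C1.
    by apply: (mulfI n2); rewrite -eD -eD1.
  have [i [j [Bc [Cc [y hy]]]]] :=
    key_compose ngt0 nE hx hx1 key key1 A0 A10 cAA1 cAn cA1n eDD.
  by exists y => _; exists A, Bc, Cc, i, j.
have Dxs x : x \in s -> disc4 x = D.
  by move=> xs; have [] := hs x; rewrite ?in_cons ?xs ?orbT.
exists (map f s); split; rewrite ?size_map //.
  apply: ineqs_map si => x xt xs xts e.
  have [A [Bc [Cc [i [j [A0 cx]]]]]] := hf x xs.
  have [At [Bt [Ct [it [jt [At0 cxt]]]]]] := hf xt xts.
  have ejt : sub4 1 0 jt 1 (inv3 x1) = sub4 1 0 (jt - j) 1 (sub4 1 0 j 1 (inv3 x1)).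
    by rewrite transl_comp; congr (sub4 _ _ _ _ _); ring.
  have hnz : hcont (sub4 1 0 jt 1 (inv3 x1)) = n.
    by rewrite (hcont_eqv (eqv_transl _ _)) hcont_inv3.
  have [u [v [w huvw]]] : exists u v w : int, u * A1 + v * Bt + w * Ct = 1.
    apply: bezout3 => p pp; have [_ hz _ _ _] := cxt.
    have := hess_primitive ngt0 hz hnz pp; apply: contra => /and3P[-> -> h] /=.
    by rewrite dvdz_mull.
  rewrite ejt in cxt.
  have tx : disc4 (sub4 1 0 i 1 x) = D by rewrite (disc4_eqv (eqv_transl _ _)) Dxs.
  have txt : disc4 (sub4 1 0 it 1 xt) = D by rewrite (disc4_eqv (eqv_transl _ _)) Dxs.
  have h : eqv (sub4 1 0 i 1 x) (sub4 1 0 it 1 xt).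
    by apply: (composed_inj nz A0 A10 At0 _ cx cxt huvw _ e); rewrite ?tx ?txt.
  exact: eqv_trans (eqv_transl i x) (eqv_trans h (eqv_sym (eqv_transl it xt))).
move=> _ /mapP[x xs ->]; have [A [Bc [Cc [i [j [A0 [hx _ hy _ _]]]]]]] := hf x xs.
rewrite -(Dxs x xs) -(disc4_eqv (eqv_transl i x)) /disc4.
by case: hx => -> -> ->; case: hy => -> -> ->; ring.
Qed.

(** * Number of keys and classes of fixed content *)

Section RootCount.
Variable R : realType.

Definition gcd_sum (n : nat) : R := \sum_(d <- divisors n) (gcdn d (n %/ d))%:R.

(** Fix a root t0 and put d = gcd(t - t0, n). With eps the parity of D, d divides t - t0 and n / d
    divides t + t0 - eps, so t is determined modulo lcm(d, n / d); this leaves at most gcd(d, n / d)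
    values below n. *)
Lemma key_root_count (D : int) (n : nat) : (0 < n)%N ->
  (size [seq t <- iota 0 n | key_root D n t])%:R <= gcd_sum n.
Proof.
move=> n0; set s := filter _ _.
have us : uniq s by rewrite filter_uniq // iota_uniq.
have [->|[t0 t0s]] : s = [::] \/ exists t0, t0 \in s.
  by case: (s) => [|y ?]; [left|right; exists y; rewrite mem_head].
  by rewrite sumr_ge0.
pose f (t : nat) := gcdn `|t%:Z - t0%:Z| n.
have fI : {in s, forall t, f t \in divisors n}.
  by move=> t _; rewrite -dvdn_divisors // dvdn_gcdr.
apply: (le_trans (size_le_sum R fI)); rewrite /gcd_sum !big_seq.
apply: ler_sum => d; rewrite -dvdn_divisors // => dn.
rewrite ler_nat; set e := (n %/ d)%N.
have nE : n = (d * e)%N by rewrite mulnC divnK.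
have e0 : (0 < e)%N by move: n0; rewrite nE muln_gt0 => /andP[].
have d0 : (0 < d)%N by move: n0; rewrite nE muln_gt0 => /andP[].
set u := filter _ s.
have cong t t' : t \in u -> t' \in u -> (lcmn d e %| t%:Z - t'%:Z)%Z.
  have root t1 : t1 \in u -> (d %| t1%:Z - t0%:Z)%Z /\ (e %| t1%:Z + t0%:Z - (D %% 2)%Z)%Z.
    rewrite mem_filter /f => /andP[/eqP ft t1s]; split.
      by rewrite -ft dvdzE /= dvdn_gcdl.
    move: t1s t0s; rewrite !mem_filter /key_root => /andP[r1 _] /andP[r0 _].
    have : (4 * n%:Z %| 4 * ((t1%:Z - t0%:Z) * (t1%:Z + t0%:Z - (D %% 2)%Z)))%Z.
      have -> : 4 * ((t1%:Z - t0%:Z) * (t1%:Z + t0%:Z - (D %% 2)%Z)) =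
       ((2 * t1%:Z - (D %% 2)%Z) ^+ 2 - D) - ((2 * t0%:Z - (D %% 2)%Z) ^+ 2 - D) by ring.
      by rewrite rpredB.
    rewrite dvdz_mul2l //; move: (t1%:Z + _ - _) => w.
    rewrite !dvdzE abszM /= => h.
    have hd : (d %| `|t1%:Z - t0%:Z|)%N by rewrite -ft dvdn_gcdl.
    case/dvdnP: (hd) => q hq.
    have cq : coprime q e.
      have : gcdn (q * d) (e * d) = d by rewrite -hq [(e * d)%N]mulnC -nE.
      rewrite -muln_gcdl => /eqP; rewrite -[X in _ == X]mul1n eqn_pmul2r //.
    have : (d * e %| d * (q * `|w|))%N by rewrite -nE mulnA [(d * q)%N]mulnC -hq.
    by rewrite dvdn_pmul2l // Gauss_dvdr // coprime_sym.
  move=> /root[h1 h2] /root[h1' h2'].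
  rewrite dvdzE /= dvdn_lcm -[X in X && _]/(d %| t%:Z - t'%:Z)%Z -[X in _ && X]/(e %| t%:Z - t'%:Z)%Z.
  apply/andP; split.
    have -> : t%:Z - t'%:Z = (t%:Z - t0%:Z) - (t'%:Z - t0%:Z) by ring.
    by rewrite rpredB.
  have -> : t%:Z - t'%:Z = (t%:Z + t0%:Z - (D %% 2)%Z) - (t'%:Z + t0%:Z - (D %% 2)%Z) by ring.
  by rewrite rpredB.
set L := lcmn d e in cong.
have L0 : (0 < L)%N by rewrite lcmn_gt0 d0.
have gE : n = (gcdn d e * L)%N by rewrite mulnC muln_lcm_gcd.
have : (size (map (divn^~ L) u) <= size (iota 0 (gcdn d e)))%N.
  apply: uniq_leq_size.
    rewrite map_inj_in_uniq; first by rewrite filter_uniq.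
    move=> t t' tu t'u e'; have := cong _ _ tu t'u.
    rewrite -eqz_mod_dvd => /eqP h; have {}h : (t %% L = t' %% L)%N by case: h; rewrite !modz_nat => -[].
    by rewrite (divn_eq t L) (divn_eq t' L) e' h.
  move=> _ /mapP[t + ->]; rewrite !mem_filter !mem_iota /= !add0n => /and3P[_ _ tn].
  by rewrite ltn_divLR // -gE.
by rewrite size_map size_iota.
Qed.
End RootCount.

Lemma ineqs_flatten (ds : seq int) (f : int -> seq (form int)) (h : form int -> int) :
  (forall x y, eqv x y -> h x = h y) ->
  uniq ds -> {in ds, forall D, ineqs (f D) /\ {in f D, forall y, h y = D}} ->
  ineqs (flatten (map f ds)).
Proof.
move=> hinv; elim: ds => [//|D ds IH] /= /andP[Dds us] hf.
rewrite /ineqs pairwise_cat -/(ineqs (f D)) -/(ineqs (flatten _)).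
have [iD hD] := hf D (mem_head _ _).
have hf' : {in ds, forall D, ineqs (f D) /\ {in f D, forall y, h y = D}}.
  by move=> D' D's; apply: hf; rewrite in_cons D's orbT.
rewrite iD IH // !andbT; apply/allrelP => x y xD /flatten_mapP[D' D's yD'].
apply/asboolPn => /hinv; rewrite (hD _ xD).
have [_ h2] := hf' _ D's; rewrite (h2 _ yD') => e.
by rewrite e D's in Dds.
Qed.

Section FixedContent.
Variable R : realType.

(** Bounds the number of keys (k, t) that occur for content n and one discriminant. *)
Definition key_sum (n : nat) : R :=
  \sum_(k <- iota 1 n | (k ^ 2 %| n)%N) gcd_sum R (n %/ k ^ 2).

Lemma gcd_sum_ge0 n : 0 <= gcd_sum R n.
Proof. exact: sumr_ge0. Qed.

Lemma key_sum_ge0 n : 0 <= key_sum n.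
Proof. by apply: sumr_ge0 => k _; exact: gcd_sum_ge0. Qed.

(** The longest of the lists obtained for the separate keys serves all of them, so the classes of
    discriminant D / n^2 are charged once for each key. *)
Lemma key_list_max (n : nat) (D : int) (s : seq (form int)) (key : form int -> nat * nat)
    (l : seq (nat * nat)) :
  (0 < n)%N -> D != 0 -> ineqs s ->
  {in s, forall x, [/\ disc4 x = D, hcont x = n, coprimez (redA x) (2 * n)%N,
     ((key x).1 ^ 2 %| n)%N & has_key n (key x).1 (n %/ (key x).1 ^ 2) (key x).2 x]} ->
  pairwise (fun x y => coprimez (redA x) (redA y)) s ->
  exists ys, [/\ ineqs ys, {in ys, forall y, n%:Z ^+ 2 * disc4 y = D} &
    {in l, forall kt, size [seq x <- s | key x == kt] <= (size ys).+1}%N].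
Proof.
move=> n0 D0 si hs cs; elim: l => [|kt l [ys [iys hys lys]]]; first by exists [::].
have [[x0 x0s]|none] : (exists x, x \in [seq x <- s | key x == kt]) \/ [seq x <- s | key x == kt] = [::].
  by case: [seq x <- s | key x == kt] => [|y ?]; [right|left; exists y; rewrite mem_head].
  have [zs [izs lzs hzs]] : exists zs, [/\ ineqs zs, (size [seq x <- s | key x == kt] <= (size zs).+1)%N &
    {in zs, forall y, n%:Z ^+ 2 * disc4 y = D}].
    apply: (@key_list n kt.1 (n %/ kt.1 ^ 2) kt.2) => //.
    - move: x0s; rewrite mem_filter => /andP[/eqP <- /hs[_ _ _ d _]].
      by rewrite mulnC divnK.
    - exact: ineqs_filter.
    - by move=> x; rewrite mem_filter => /andP[/eqP <- /hs[]].
    - exact: pairwise_filter.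
  have [h|h] := leqP (size ys) (size zs).
    exists zs; split=> // kt'; rewrite in_cons => /orP[/eqP -> //|/lys h'].
    exact: leq_trans h' _.
  exists ys; split=> // kt'; rewrite in_cons => /orP[/eqP ->|/lys //].
  by apply: leq_trans lzs _; rewrite ltnS ltnW.
exists ys; split=> // kt'; rewrite in_cons => /orP[/eqP ->|/lys //].
by rewrite none.
Qed.

(** For each discriminant D the count is at most [key_sum n] times 1 plus a number of classes of
    discriminant D / n^2. All D are nonzero multiples of n^2, so there are at most 3 Y / n^2 of
    them; Davenport's bound at level Y / n^2 handles the classes. Hence C + 3. *)
Lemma fixed_content_count : exists2 C : R, 0 < C &
  forall (n : nat) (s : seq (form int)) (Y : R), (0 < n)%N -> 0 <= Y -> ineqs s ->
  {in s, forall x, [/\ disc4 x != 0, hcont x = n & `|disc4 x|%:~R <= Y]} ->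
  (size s)%:R <= C * key_sum n * (Y / n%:R ^+ 2).
Proof.
have [C C0 dav] := davenport R; exists (C + 3) => [|n s Y n0 Y0 si hs]; first by rewrite addr_gt0.
have N1 : (1 < 2 * n)%N by rewrite mul2n -addnn; case: (n) n0 => // m _; rewrite addnS.
have [|s' [si' <- hs' hcop hpair]] := coprime_reps N1 si; first by move=> x /hs[].
have {hs hs'} hs x : x \in s' -> [/\ disc4 x != 0, hcont x = n & `|disc4 x|%:~R <= Y].
  by move=> /hs'[x0 /hs[? ? ?] e]; rewrite (disc4_eqv e) (hcont_eqv e).
have nR : 0 < n%:R ^+ 2 :> R by rewrite exprn_gt0 // ltr0n.
set Z := Y / n%:R ^+ 2.
have Z0 : 0 <= Z by rewrite divr_ge0 // ltW.
have /choice[key hkey] x : exists kt : nat * nat, x \in s' -> [/\ kt.1 \in [seq k <- iota 1 n | (k ^ 2 %| n)%N],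
   kt.2 \in [seq t <- iota 0 (n %/ kt.1 ^ 2) | key_root (disc4 x %/ n%:Z ^+ 2)%Z (n %/ kt.1 ^ 2) t] &
   has_key n kt.1 (n %/ kt.1 ^ 2) kt.2 x].
  have [xs|xs] := boolP (x \in s'); last by exists (0, 0)%N.
  have [Dx hn _] := hs x xs; have [A [B [C' [hx _]]]] := hess_hcont Dx.
  rewrite hn in hx; have rA := hess_redA n0 hx hn.
  have cA : coprimez A n.
    by have := hcop x xs; rewrite rA !coprimezE; apply: coprime_dvdr; rewrite dvdn_mull.
  have [k [t [k0 kn tn hk rt]]] := key_exists n0 hx cA.
  exists (k, t) => _ /=; split=> //.
    rewrite mem_filter kn mem_iota k0 /= add1n ltnS.
    by apply: leq_trans (dvdn_leq n0 kn); rewrite -{1}[k]expn1 leq_pexp2l.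
  rewrite mem_filter mem_iota /= add0n tn andbT.
  have -> : disc4 x = (B ^+ 2 - 4 * A * C') * n%:Z ^+ 2.
    by case: hx => h1 h2 h3; rewrite /disc4 h1 h2 h3; ring.
  by rewrite mulzK // expf_neq0 // -lt0n.
pose ds := undup (map disc4 s').
have dsI x : x \in s' -> disc4 x \in ds by move=> xs; rewrite mem_undup map_f.
have dsE D : D \in ds -> exists2 x, x \in s' & disc4 x = D.
  by rewrite mem_undup => /mapP[x xs ->]; exists x.
have /choice[ysf hysf] D : exists ys, D \in ds -> [/\ ineqs ys,
    {in ys, forall y, n%:Z ^+ 2 * disc4 y = D} &
    (size [seq x <- s' | disc4 x == D])%:R <= key_sum n * (1 + (size ys)%:R)].
  have [Dds|] := boolP (D \in ds); last by exists [::].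
  have [x0 x0s Dx0] := dsE _ Dds; have [D0 _ _] := hs _ x0s; rewrite Dx0 in D0.
  set u := filter _ s'; pose D1 := (D %/ n%:Z ^+ 2)%Z.
  pose kl := flatten [seq [seq (k, t) | t <- [seq t <- iota 0 (n %/ k ^ 2) | key_root D1 (n %/ k ^ 2) t]]
     | k <- [seq k <- iota 1 n | (k ^ 2 %| n)%N]].
  have hu x : x \in u -> x \in s' /\ disc4 x = D by rewrite mem_filter => /andP[/eqP].
  have [|||||ys [iys hys lys]] := @key_list_max n D u key kl.
  - by [].
  - by [].
  - exact: ineqs_filter.
  - move=> x /hu[xs Dx]; have [_ hn _] := hs _ xs; have [k1 _ hk] := hkey _ xs.
    by split => //; [exact: hcop|move: k1; rewrite mem_filter => /andP[]].
  - exact: pairwise_filter.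
  exists ys => _; split=> //.
  have kI : {in u, forall x, key x \in kl}.
    move=> x /hu[xs Dx]; have [k1 k2 _] := hkey _ xs; rewrite Dx in k2.
    by apply/flatten_mapP; exists (key x).1 => //; apply/mapP; exists (key x).2 => //; case: (key x).
  have ysn : 0 <= 1 + (size ys)%:R :> R by rewrite addr_ge0.
  apply: (size_le_mul kI ysn) => [|kt /lys]; last by rewrite -(ler_nat R) -addn1 natrD addrC.
  rewrite /kl size_flatten /shape -map_comp sumnE big_map natr_sum big_filter /key_sum.
  rewrite big_seq_cond [X in _ <= X]big_seq_cond.
  apply: ler_sum => k /andP[_ kn] /=; rewrite size_map; apply: key_root_count.
  by rewrite divn_gt0; [exact: dvdn_leq|case: (k) kn => [|//]; rewrite /= dvd0n => /eqP n00; rewrite n00 in n0].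
have ds_count : (size ds)%:R <= 3 * Z.
  have [->|[D1 D1s]] : ds = [::] \/ exists D1, D1 \in ds.
    by case: (ds) => [|y ?]; [left|right; exists y; rewrite mem_head].
    by rewrite mulr_ge0.
  have dn D : D \in ds -> exists2 q : int, q != 0 & D = q * (n ^ 2)%N%:Z.
    move=> /dsE[x /hs[Dx <- _] <-]; have /dvdzP[q hq] := sqr_hcont_dvd x.
    by exists q => //; apply: contraNneq Dx => q0; rewrite hq q0 mul0r.
  have qZ D q : D \in ds -> D = q * (n ^ 2)%N%:Z -> `|q|%:~R <= Z.
    move=> /dsE[x /hs[_ _ hY] <-] hq; rewrite ler_pdivlMr //.
    move: hY; rewrite hq normrM intrM; apply: le_trans.
    by rewrite (ger0_norm (_ : 0 <= (n ^ 2)%N%:Z)) // -pmulrn natrX.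
  have Z1 : 1 <= Z.
    have [q q0 hq] := dn _ D1s; apply: le_trans (qZ _ _ D1s hq).
    by rewrite -[1]/(1%:~R) ler_int -gtz0_ge1 normr_gt0.
  apply: (@le_trans _ _ (2 * Z + 1)); last by lra.
  have n2Z : (n ^ 2)%N%:Z != 0 by rewrite -lt0n expn_gt0 n0.
  rewrite -(size_map (fun D => (D %/ (n ^ 2)%N)%Z)); apply: size_spread.
  - rewrite map_inj_in_uniq ?undup_uniq // => D D' /dn[q _ ->] /dn[q' _ ->].
    by rewrite !mulzK // => ->.
  - by rewrite mulr_ge0.
  - move=> _ _ /mapP[D Ds ->] /mapP[D' D's ->].
    have [q _ hq] := dn _ Ds; have [q' _ hq'] := dn _ D's.
    rewrite hq hq' !mulzK // intr_norm intrB; apply: (le_trans (ler_normB _ _)).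
    by rewrite -!intr_norm mulrDl mul1r lerD // (qZ _ _ _ hq, qZ _ _ _ hq').
have n2Z : n%:Z ^+ 2 != 0 by rewrite expf_neq0 // -lt0n.
have fl : (size (flatten (map ysf ds)))%:R <= C * Z.
  apply: dav => //.
    apply: (@ineqs_flatten _ _ (fun y => n%:Z ^+ 2 * disc4 y)).
    - by move=> x y /disc4_eqv ->.
    - exact: undup_uniq.
    - by move=> D /hysf[].
  move=> y /flatten_mapP[D Ds yD]; have [_ hy _] := hysf _ Ds.
  have e := hy _ yD; have [x /hs[Dx _ hY] ex] := dsE _ Ds; rewrite ex -e in Dx hY.
  split; first by apply: contraNneq Dx => ->; rewrite mulr0.
  rewrite ler_pdivlMr // mulrC; apply: le_trans hY.
  by rewrite normrM intrM ger0_norm ?exprn_ge0 // rmorphXn.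
apply: (le_trans (size_le_sum R dsI)).
apply: (@le_trans _ _ (\sum_(D <- ds) key_sum n * (1 + (size (ysf D))%:R))).
  by rewrite big_seq [X in _ <= X]big_seq; apply: ler_sum => D /hysf[].
rewrite -mulr_sumr big_split /= -natr_sum.
have -> : \sum_(D <- ds) 1 = (size ds)%:R :> R by rewrite big_const_seq count_predT iter_addr_0.
have -> : (\sum_(i <- ds) size (ysf i))%N = size (flatten (map ysf ds)).
  by rewrite size_flatten /shape -map_comp sumnE big_map.
rewrite [_ * key_sum n]mulrC -mulrA; apply: ler_wpM2l; first exact: key_sum_ge0.
rewrite mulrDl; lra.
Qed.
End FixedContent.

(** * Divisor sums over contents divisible by Q *)

Section ContentSum.
Variable R : realType.

Lemma ler_sum_subset (T : eqType) (s1 s2 : seq T) (F : T -> R) :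
  uniq s1 -> {subset s1 <= s2} -> (forall x, 0 <= F x) ->
  \sum_(x <- s1) F x <= \sum_(x <- s2) F x.
Proof.
move=> us sub F0; elim: s1 s2 us sub => [|x s1 IH] s2 /=; first by move=> _ _; rewrite big_nil sumr_ge0.
move=> /andP[xs us] sub; rewrite big_cons [leRHS](big_rem x) ?sub ?mem_head //=.
rewrite lerD2l; apply: IH => // y ys; apply: rem_mem.
  by apply: contraNneq xs => <-.
by apply: sub; rewrite in_cons ys orbT.
Qed.

Lemma sum_multiples (p N : nat) (F : nat -> R) : (0 < p)%N -> (forall k, 0 <= F k) ->
  \sum_(k <- iota 1 N | (p %| k)%N) F k <= \sum_(k <- iota 1 N) F (p * k)%N.
Proof.
move=> p0 F0; rewrite -big_filter -(big_map (fun k => p * k)%N xpredT F).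
apply: ler_sum_subset => //; first by rewrite filter_uniq // iota_uniq.
move=> k; rewrite mem_filter mem_iota => /andP[/dvdnP[q ->] /andP[k0 kN]].
have q0 : (0 < q)%N by move: k0; rewrite muln_gt0 => /andP[].
apply/mapP; exists q; last by rewrite mulnC.
by rewrite mem_iota q0 /=; apply: leq_ltn_trans kN; rewrite leq_pmulr.
Qed.

Variable N : nat.

Definition sum3 (F : nat -> nat -> nat -> R) : R :=
  \sum_(k <- iota 1 N) \sum_(d <- iota 1 N) \sum_(e <- iota 1 N) F k d e.

Lemma ler_sum3 F G : (forall k d e, (0 < k)%N -> (0 < d)%N -> (0 < e)%N -> F k d e <= G k d e) ->
  sum3 F <= sum3 G.
Proof.
move=> h; rewrite /sum3; rewrite !big_seq; apply: ler_sum => k; rewrite mem_iota => /andP[k0 _].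
rewrite !big_seq; apply: ler_sum => d; rewrite mem_iota => /andP[d0 _].
by rewrite !big_seq; apply: ler_sum => e; rewrite mem_iota => /andP[e0 _]; exact: h.
Qed.

Lemma sum3D F G : sum3 (fun k d e => F k d e + G k d e) = sum3 F + sum3 G.
Proof.
rewrite /sum3 -big_split; apply: eq_bigr => k _ /=.
by rewrite -big_split; apply: eq_bigr => d _ /=; rewrite -big_split.
Qed.

Lemma sum3Z c F : sum3 (fun k d e => c * F k d e) = c * sum3 F.
Proof.
rewrite /sum3 mulr_sumr; apply: eq_bigr => k _ /=.
by rewrite mulr_sumr; apply: eq_bigr => d _ /=; rewrite mulr_sumr.
Qed.

Lemma sum3_swap1 F : sum3 F = sum3 (fun d k e => F k d e).
Proof. by rewrite /sum3 exchange_big. Qed.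

Lemma sum3_swap2 F : sum3 F = sum3 (fun k e d => F k d e).
Proof. by rewrite /sum3; apply: eq_bigr => k _; rewrite exchange_big. Qed.

Lemma sum3_mult1 p F : (0 < p)%N -> (forall k d e, 0 <= F k d e) ->
  sum3 (fun k d e => (p %| k)%N%:R * F k d e) <= sum3 (fun k d e => F (p * k)%N d e).
Proof.
move=> p0 F0; rewrite /sum3.
have -> : \sum_(k <- iota 1 N) \sum_(d <- iota 1 N) \sum_(e <- iota 1 N) (p %| k)%N%:R * F k d e =
    \sum_(k <- iota 1 N | (p %| k)%N) \sum_(d <- iota 1 N) \sum_(e <- iota 1 N) F k d e.
  rewrite [RHS]big_mkcond; apply: eq_bigr => k _; case: ifP => _.
    by apply: eq_bigr => d _; apply: eq_bigr => e _; rewrite mul1r.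
  by apply: big1 => d _; apply: big1 => e _; rewrite mul0r.
apply: (@sum_multiples p N (fun k => \sum_(d <- iota 1 N) \sum_(e <- iota 1 N) F k d e)) => // k.
by apply: sumr_ge0 => d _; apply: sumr_ge0.
Qed.

Lemma sum3_mult2 p F : (0 < p)%N -> (forall k d e, 0 <= F k d e) ->
  sum3 (fun k d e => (p %| d)%N%:R * F k d e) <= sum3 (fun k d e => F k (p * d)%N e).
Proof.
move=> p0 F0; rewrite sum3_swap1 [leRHS]sum3_swap1.
exact: (@sum3_mult1 p (fun d k e => F k d e)).
Qed.

Lemma sum3_mult3 p F : (0 < p)%N -> (forall k d e, 0 <= F k d e) ->
  sum3 (fun k d e => (p %| e)%N%:R * F k d e) <= sum3 (fun k d e => F k d (p * e)%N).
Proof.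
move=> p0 F0; rewrite sum3_swap2 [leRHS]sum3_swap2.
exact: (@sum3_mult2 p (fun k e d => F k d e)).
Qed.

(** The term of [key_sum n] / n^2 for the factorization n = k^2 d e. *)
Definition weight3 (k d e : nat) : R := (gcdn d e)%:R / (k%:R ^+ 4 * (d%:R ^+ 2 * e%:R ^+ 2)).
Definition term3 (Q k d e : nat) : R := (Q %| k ^ 2 * (d * e))%N%:R * weight3 k d e.

Lemma weight3_ge0 k d e : 0 <= weight3 k d e.
Proof. by rewrite divr_ge0 // mulr_ge0 ?exprn_ge0 // mulr_ge0 ?exprn_ge0. Qed.

Lemma term3_ge0 Q k d e : 0 <= term3 Q k d e.
Proof. by rewrite mulr_ge0 ?weight3_ge0. Qed.

(** If p divides k^2 d e, it divides k, or exactly one of d and e, or both. Removing it saves p^-4,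
    p^-2, p^-2 or p^-3, the last because the gcd also loses a factor p; four terms give 4 / p^2. *)
Lemma sum3_term_prime (p Q : nat) : prime p -> coprime p Q ->
  sum3 (term3 (p * Q)) <= 4 / p%:R ^+ 2 * sum3 (term3 Q).
Proof.
move=> pp cpQ; have p0 := prime_gt0 pp; have p1 := prime_gt1 pp.
have pR : 0 < p%:R :> R by rewrite ltr0n.
have pR1 : 1 <= p%:R :> R by rewrite ler1n.
have pR0 : p%:R != 0 :> R by rewrite gt_eqF.
have cQp : coprime Q p by rewrite coprime_sym.
have cQp2 : coprime Q (p ^ 2) by rewrite coprimeXr.
pose F1 k d e := (Q %| k ^ 2 * (d * e))%N%:R * weight3 k d e.
(* The complementary conditions in [F2] and [F3] keep gcd(d, e) unchanged when p is removed from the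
   other variable. *)
pose F2 k d e := (~~ (p %| e)%N)%:R * F1 k d e.
pose F3 k d e := (~~ (p %| d)%N)%:R * F1 k d e.
have F10 k d e : 0 <= F1 k d e by exact: term3_ge0.
have F20 k d e : 0 <= F2 k d e by rewrite mulr_ge0.
have F30 k d e : 0 <= F3 k d e by rewrite mulr_ge0.
have h4 k d e : 0 <= (p %| e)%N%:R * F1 k d e by rewrite mulr_ge0.
have b0 (b : bool) : 0 <= b%:R :> R by [].
apply: (@le_trans _ _ (sum3 (fun k d e => (p %| k)%N%:R * F1 k d e) +
   sum3 (fun k d e => (p %| d)%N%:R * F2 k d e) + sum3 (fun k d e => (p %| e)%N%:R * F3 k d e) +
   sum3 (fun k d e => (p %| d)%N%:R * ((p %| e)%N%:R * F1 k d e)))).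
  rewrite -!sum3D; apply: ler_sum3 => k d e k0 d0 e0.
  rewrite /term3 /F2 /F3 /F1.
  move: (weight3 k d e) (weight3_ge0 k d e) => W W0.
  case h : (p * Q %| k ^ 2 * (d * e))%N; last first.
    by rewrite /= mul0r; repeat apply: addr_ge0; repeat apply: mulr_ge0.
  rewrite Gauss_dvd // in h; case/andP: h => hp hQ; rewrite hQ.
  rewrite Euclid_dvdM // Euclid_dvdX // andbT Euclid_dvdM // in hp.
  by case: (p %| k)%N (p %| d)%N (p %| e)%N hp => [] [] [] //= _; lra.
have e1 : sum3 (fun k d e => F1 (p * k)%N d e) <= p%:R ^- 4 * sum3 (term3 Q).
  rewrite -sum3Z; apply: ler_sum3 => k d e k0 d0 e0; rewrite /F1 /term3.
  rewrite expnMn -mulnA Gauss_dvdr // [leRHS]mulrCA; apply: ler_wpM2l => //.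
  rewrite le_eqVlt; apply/orP; left; apply/eqP; rewrite /weight3 natrM.
  by field; rewrite pR0 !pnatr_eq0 -!lt0n k0 d0 e0.
have e2 : sum3 (fun k d e => F2 k (p * d)%N e) <= p%:R ^- 2 * sum3 (term3 Q).
  rewrite -sum3Z; apply: ler_sum3 => k d e k0 d0 e0; rewrite /F2 /F1 /term3.
  have -> : (k ^ 2 * (p * d * e) = p * (k ^ 2 * (d * e)))%N by rewrite -(mulnA p) mulnCA.
  rewrite Gauss_dvdr //; case pe : (p %| e)%N => /=.
    by rewrite mul0r mulr_ge0 ?invr_ge0 ?exprn_ge0 ?term3_ge0.
  rewrite mul1r [leRHS]mulrCA; apply: ler_wpM2l => //.
  have -> : weight3 k (p * d) e = p%:R ^- 2 * weight3 k d e.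
    rewrite /weight3 natrM gcdnC Gauss_gcdr ?[gcdn e d]gcdnC;
      last by rewrite coprime_sym prime_coprime // pe.
    by field; rewrite pR0 !pnatr_eq0 -!lt0n k0 d0 e0.
  by [].
have e3 : sum3 (fun k d e => F3 k d (p * e)%N) <= p%:R ^- 2 * sum3 (term3 Q).
  rewrite -sum3Z; apply: ler_sum3 => k d e k0 d0 e0; rewrite /F3 /F1 /term3.
  have -> : (k ^ 2 * (d * (p * e)) = p * (k ^ 2 * (d * e)))%N by rewrite (mulnCA d) mulnCA.
  rewrite Gauss_dvdr //; case pd : (p %| d)%N => /=.
    by rewrite mul0r mulr_ge0 ?invr_ge0 ?exprn_ge0 ?term3_ge0.
  rewrite mul1r [leRHS]mulrCA; apply: ler_wpM2l => //.
  have -> : weight3 k d (p * e) = p%:R ^- 2 * weight3 k d e.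
    rewrite /weight3 natrM Gauss_gcdr; last by rewrite coprime_sym prime_coprime // pd.
    by field; rewrite pR0 !pnatr_eq0 -!lt0n k0 d0 e0.
  by [].
have e4 : sum3 (fun k d e => (p %| e)%N%:R * F1 k (p * d)%N e) <= p%:R ^- 3 * sum3 (term3 Q).
  apply: (le_trans (@sum3_mult3 p (fun k d e => F1 k (p * d)%N e) p0 _)) => //.
  rewrite -sum3Z; apply: ler_sum3 => k d e k0 d0 e0; rewrite /F1 /term3.
  have -> : (k ^ 2 * (p * d * (p * e)) = p ^ 2 * (k ^ 2 * (d * e)))%N by rewrite (mulnACA p) mulnn mulnCA.
  rewrite Gauss_dvdr // [leRHS]mulrCA; apply: ler_wpM2l => //.
  have -> : weight3 k (p * d) (p * e) = p%:R ^- 3 * weight3 k d e.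
    rewrite /weight3 -muln_gcdr !natrM.
    by field; rewrite pR0 !pnatr_eq0 -!lt0n k0 d0 e0.
  by [].
have T0 : 0 <= sum3 (term3 Q).
  by apply: sumr_ge0 => k _; apply: sumr_ge0 => d _; apply: sumr_ge0 => e _; exact: term3_ge0.
have g3 : p%:R ^- 3 <= p%:R ^- 2 :> R.
  by rewrite lef_pV2 ?posrE ?exprn_gt0 // ler_weXn2l.
have g4 : p%:R ^- 4 <= p%:R ^- 2 :> R.
  by rewrite lef_pV2 ?posrE ?exprn_gt0 // ler_weXn2l.
have {e4}e4 : sum3 (fun k d e => (p %| d)%N%:R * ((p %| e)%N%:R * F1 k d e)) <= p%:R ^- 2 * sum3 (term3 Q).
  apply: (le_trans (@sum3_mult2 p (fun k d e => (p %| e)%N%:R * F1 k d e) p0 _)) => //.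
  by apply: (le_trans e4); exact: ler_wpM2r.
have {e1}e1 : sum3 (fun k d e => (p %| k)%N%:R * F1 k d e) <= p%:R ^- 2 * sum3 (term3 Q).
  apply: (le_trans (@sum3_mult1 p F1 p0 _)) => //.
  by apply: (le_trans e1); exact: ler_wpM2r.
have {}e2 := le_trans (@sum3_mult2 p F2 p0 F20) e2.
have {}e3 := le_trans (@sum3_mult3 p F3 p0 F30) e3.
rewrite -[4 / _ * _]mulrA; move: e1 e2 e3 e4; move: (p%:R ^- 2 * _) => E; lra.
Qed.

(** The inequality gcd(d, e) <= sqrt(d e) separates the variables into three sums of j^(-3/2), each
    at most 6. *)
Lemma sum3_term1 : sum3 (term3 1) <= 216.
Proof.
pose f (j : nat) : R := (j%:R * Num.sqrt j%:R)^-1.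
have f0 j : 0 <= f j by rewrite invr_ge0 mulr_ge0 ?sqrtr_ge0.
have fs : \sum_(j <- iota 1 N) f j <= 6.
  have := @sum_inv_sqrt3 R 1 N.+1 isT; rewrite sqrtr1 invr1 mulr1.
  by rewrite /index_iota subn1.
have fs0 : 0 <= \sum_(j <- iota 1 N) f j by exact: sumr_ge0.
apply: (@le_trans _ _ (sum3 (fun k d e => f k * (f d * f e)))).
  apply: ler_sum3 => k d e k0 d0 e0; rewrite /term3 dvd1n mul1r /weight3.
  have k1 : 1 <= k%:R :> R by rewrite ler1n.
  have kR : 0 < k%:R :> R by rewrite ltr0n.
  have dR : 0 < d%:R :> R by rewrite ltr0n.
  have eR : 0 < e%:R :> R by rewrite ltr0n.
  have sd : 0 < Num.sqrt d%:R :> R by rewrite sqrtr_gt0.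
  have se : 0 < Num.sqrt e%:R :> R by rewrite sqrtr_gt0.
  have sd2 : Num.sqrt d%:R ^+ 2 = d%:R :> R by rewrite sqr_sqrtr.
  have se2 : Num.sqrt e%:R ^+ 2 = e%:R :> R by rewrite sqr_sqrtr.
  have hg : (gcdn d e)%:R <= Num.sqrt d%:R * Num.sqrt e%:R :> R.
    rewrite -ler_sqr ?nnegrE ?mulr_ge0 ?(ltW sd) ?(ltW se) // exprMn sd2 se2 -natrX -natrM ler_nat.
    by rewrite -mulnn leq_mul // dvdn_leq // ?dvdn_gcdl ?dvdn_gcdr.
  have hk : (k%:R ^+ 4)^-1 <= f k.
    rewrite lef_pV2 ?posrE ?exprn_gt0 ?mulr_gt0 ?sqrtr_gt0 //.
    have -> : k%:R ^+ 4 = k%:R * k%:R ^+ 3 :> R by ring.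
    rewrite ler_pM2l //.
    have sk : Num.sqrt k%:R <= k%:R :> R.
      have sk1 : 1 <= Num.sqrt k%:R :> R by rewrite -[leLHS]sqrtr1 ler_sqrt // (le_trans _ k1).
      by rewrite -{2}[k%:R](sqr_sqrtr (ltW kR)) expr2 ler_peMr // sqrtr_ge0.
    by apply: (le_trans sk); rewrite -{1}[k%:R]expr1 ler_weXn2l.
  rewrite invfM mulrCA; apply: ler_pM => //.
  - by rewrite invr_ge0 exprn_ge0.
  - by rewrite divr_ge0 // mulr_ge0 ?exprn_ge0.
  rewrite ler_pdivrMr ?mulr_gt0 ?exprn_gt0 //; apply: (le_trans hg).
  have gen (y x : R) : 0 < x -> x ^+ 2 = y -> (y * x)^-1 * y ^+ 2 = x.
    by move=> x0 <-; field; rewrite gt_eqF.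
  rewrite [leRHS](_ : _ = (f d * d%:R ^+ 2) * (f e * e%:R ^+ 2)); last by ring.
  by rewrite /f !gen.
rewrite /sum3.
have -> : \sum_(k <- iota 1 N) \sum_(d <- iota 1 N) \sum_(e <- iota 1 N) f k * (f d * f e)
   = (\sum_(j <- iota 1 N) f j) * ((\sum_(j <- iota 1 N) f j) * (\sum_(j <- iota 1 N) f j)).
  rewrite mulr_suml; apply: eq_bigr => k _.
  rewrite mulr_suml mulr_sumr; apply: eq_bigr => d _.
  by rewrite !mulr_sumr.
rewrite (_ : 216 = 6 * (6 * 6)); last by ring.
by apply: ler_pM => //; [exact: mulr_ge0|apply: ler_pM].
Qed.

End ContentSum.

Section ContentCount.
Variable R : realType.

Lemma ler_sum_single (T : eqType) (s : seq T) (F : T -> R) x :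
  (forall y, 0 <= F y) -> x \in s -> F x <= \sum_(y <- s) F y.
Proof. by move=> F0 xs; rewrite (big_rem x) //= lerDl sumr_ge0. Qed.

Lemma sum3_sum N (T : Type) (l : seq T) (F : T -> nat -> nat -> nat -> R) :
  \sum_(n <- l) sum3 N (F n) = sum3 N (fun k d e => \sum_(n <- l) F n k d e).
Proof.
rewrite /sum3 exchange_big; apply: eq_bigr => k _ /=.
by rewrite exchange_big; apply: eq_bigr => d _ /=; rewrite exchange_big.
Qed.

Lemma key_sum_le_sum3 (N n : nat) : (0 < n <= N)%N ->
  key_sum R n / n%:R ^+ 2 <=
  sum3 N (fun k d e => (k ^ 2 * (d * e) == n)%N%:R * weight3 R k d e).
Proof.
move=> /andP[n0 nN]; have nR : 0 < n%:R ^+ 2 :> R by rewrite exprn_gt0 ?ltr0n.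
have W0 k d e : 0 <= (k ^ 2 * (d * e) == n)%N%:R * weight3 R k d e.
  by rewrite mulr_ge0 ?weight3_ge0.
have nI m : (m %| n)%N -> m \in iota 1 N.
  move=> mn; rewrite mem_iota add1n ltnS (leq_trans (dvdn_leq n0 mn)) // andbT.
  by rewrite (dvdn_gt0 n0 mn).
rewrite /key_sum mulr_suml -big_filter.
pose H k d := \sum_(e <- iota 1 N) (k ^ 2 * (d * e) == n)%N%:R * weight3 R k d e.
pose G k := \sum_(d <- iota 1 N) H k d.
apply: (@le_trans _ _ (\sum_(k <- [seq k <- iota 1 n | (k ^ 2 %| n)%N]) G k)); last first.
  apply: (@ler_sum_subset _ _ _ _ G); first by rewrite filter_uniq // iota_uniq.
    move=> k; rewrite mem_filter !mem_iota => /andP[_ /andP[-> h]].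
    by rewrite (leq_trans h) // leq_add2l.
  by move=> k; apply: sumr_ge0 => d _; apply: sumr_ge0 => e _; exact: W0.
rewrite !big_seq; apply: ler_sum => k; rewrite mem_filter => /andP[kn _].
set m := (n %/ k ^ 2)%N; have nE : n = (k ^ 2 * m)%N by rewrite mulnC divnK.
have m0 : (0 < m)%N by move: n0; rewrite nE muln_gt0 => /andP[].
have mn : (m %| n)%N by rewrite nE dvdn_mull.
have k0 : (0 < k)%N by move: n0; rewrite nE muln_gt0 expn_gt0 orbF => /andP[].
rewrite /gcd_sum mulr_suml.
apply: (@le_trans _ _ (\sum_(d <- divisors m) H k d)); last first.
  apply: (@ler_sum_subset _ _ _ _ (H k)); first exact: divisors_uniq.
    by move=> d; rewrite -dvdn_divisors // => dm; apply: nI (dvdn_trans dm mn).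
  by move=> d; apply: sumr_ge0 => e _; exact: W0.
rewrite !big_seq; apply: ler_sum => d; rewrite -dvdn_divisors // => dm.
have mE : m = (d * (m %/ d))%N by rewrite mulnC divnK.
have em : (m %/ d)%N \in iota 1 N.
  by apply: nI; apply: dvdn_trans mn; rewrite {2}mE dvdn_mull.
apply: le_trans (ler_sum_single (W0 k d) em).
rewrite -mE -nE eqxx mul1r /weight3.
have -> : k%:R ^+ 4 * (d%:R ^+ 2 * (m %/ d)%:R ^+ 2) = n%:R ^+ 2 :> R; last by [].
transitivity ((k ^ 2 * (d * (m %/ d)))%N%:R ^+ 2 : R); last by rewrite -mE -nE.
by rewrite !natrM; ring.
Qed.

Lemma sum_key_sum (N Q : nat) :
  \sum_(n <- [seq n <- iota 1 N | (Q %| n)%N]) key_sum R n / n%:R ^+ 2 <= sum3 N (term3 R Q).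
Proof.
apply: (@le_trans _ _ (\sum_(n <- [seq n <- iota 1 N | (Q %| n)%N])
    sum3 N (fun k d e => (k ^ 2 * (d * e) == n)%N%:R * weight3 R k d e))).
  rewrite !big_seq; apply: ler_sum => n; rewrite mem_filter mem_iota add1n ltnS => /andP[_ h].
  exact: key_sum_le_sum3 h.
rewrite sum3_sum; apply: ler_sum3 => k d e _ _ _; rewrite /term3 -mulr_suml.
apply: ler_wpM2r; first exact: weight3_ge0.
set X := (k ^ 2 * (d * e))%N; rewrite -natr_sum ler_nat.
elim: (iota 1 N) (iota_uniq 1 N) => [|n l IH] /=; first by rewrite big_nil.
move=> /andP[nl ul]; case: ifP => Qn; rewrite ?IH // big_cons.
have [e'|e'] := eqVneq X n; last by rewrite add0n IH.
rewrite e' Qn big_seq big1 // => i; rewrite mem_filter => /andP[_ il].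
by case: eqP => // e2; rewrite e2 il in nl.
Qed.

Lemma prod_prime_coprime (p : nat) (ps : seq nat) : prime p -> all prime ps -> p \notin ps ->
  coprime p (\prod_(l <- ps) l).
Proof.
move=> pp aps pn; rewrite prime_coprime //; apply: contra pn => h.
have := @prime_dvd_prod p ps xpredT pp aps; rewrite andbT => <-.
exact: h.
Qed.

Lemma sum3_term_primes (N : nat) (ps : seq nat) : all prime ps -> uniq ps ->
  sum3 N (term3 R (\prod_(p <- ps) p)) <= 216 * 4 ^+ size ps / (\prod_(p <- ps) p)%:R ^+ 2.
Proof.
elim: ps => [_ _|p ps IH /= /andP[pp aps] /andP[pn ups]].
  by rewrite big_nil expr0 expr1n mulr1 divr1; exact: sum3_term1.
rewrite big_cons; apply: (le_trans (@sum3_term_prime R N _ _ pp (prod_prime_coprime pp aps pn))).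
have pR : 0 < p%:R :> R by rewrite ltr0n prime_gt0.
have p2 : 0 <= 4 / p%:R ^+ 2 :> R by rewrite divr_ge0 // exprn_ge0.
apply: (le_trans (ler_wpM2l p2 (IH aps ups))).
by rewrite natrM exprMn (exprS 4 (size ps)) (invfM (p%:R ^+ 2)); rewrite le_eqVlt; apply/orP; left; apply/eqP; ring.
Qed.

Lemma content_count : exists2 C : R, 0 < C &
  forall (ps : seq nat) (s : seq (form int)) (Y : R), all prime ps -> uniq ps -> 0 <= Y -> ineqs s ->
  {in s, forall x, [/\ disc4 x != 0, (\prod_(p <- ps) p %| hcont x)%N & `|disc4 x|%:~R <= Y]} ->
  (size s)%:R <= C * 4 ^+ size ps * Y / (\prod_(p <- ps) p)%:R ^+ 2.
Proof.
have [C C0 fcc] := fixed_content_count R.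
exists (C * 216) => [|ps s Y aps ups Y0 si hs]; first by rewrite mulr_gt0.
set Q := (\prod_(p <- ps) p)%N in hs *.
(* A crude bound for the contents that occur; the final estimate is independent of it. *)
pose N := (\sum_(x <- s) hcont x)%N.
have hN x : x \in s -> hcont x \in [seq n <- iota 1 N | (Q %| n)%N].
  move=> xs; have [Dx Qx _] := hs x xs.
  rewrite mem_filter Qx mem_iota hcont_gt0 //= add1n ltnS /N (big_rem x) //=.
  exact: leq_addr.
apply: (le_trans (size_le_sum R hN)).
apply: (@le_trans _ _ (\sum_(n <- [seq n <- iota 1 N | (Q %| n)%N]) C * Y * (key_sum R n / n%:R ^+ 2))).
  rewrite !big_seq; apply: ler_sum => n; rewrite mem_filter mem_iota => /and3P[_ n0 _].
  rewrite (_ : C * Y * _ = C * key_sum R n * (Y / n%:R ^+ 2)); last by ring.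
  apply: fcc => //; first exact: ineqs_filter.
  by move=> x; rewrite mem_filter => /andP[/eqP hn /hs[]].
rewrite -mulr_sumr.
have CY : 0 <= C * Y by rewrite mulr_ge0 // ltW.
apply: (le_trans (ler_wpM2l CY (le_trans (sum_key_sum N Q) (sum3_term_primes N aps ups)))).
by rewrite le_eqVlt; apply/orP; left; apply/eqP; rewrite -/Q; ring.
Qed.

End ContentCount.

(** * Weighted counts *)

Definition scale4 (p : int) (x : form int) : form int :=
  let: (a, b, c, d) := x in (p * a, p * b, p * c, p * d).

Definition dvdf (m : nat) (x : form int) : bool :=
  let: (a, b, c, d) := x in [&& (m %| a)%Z, (m %| b)%Z, (m %| c)%Z & (m %| d)%Z].

Lemma dvdfP (m : nat) x : reflect (exists y, x = scale4 m y) (dvdf m x).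
Proof.
apply: (iffP idP) => [|[[[[a b] c] d] ->]]; last by rewrite /= !dvdz_mulr.
case: x => [[[a b] c] d] /and4P[/dvdzP[a' ->] /dvdzP[b' ->] /dvdzP[c' ->] /dvdzP[d' ->]].
by exists (a', b', c', d'); rewrite /= ![_ * m%:Z]mulrC.
Qed.

Lemma sub4_scale4 p r s t w x : sub4 r s t w (scale4 p x) = scale4 p (sub4 r s t w x).
Proof. by case: x => [[[a b] c] d]; congr (_, _, _, _); ring. Qed.

Lemma scale4_inj p : p != 0 -> injective (scale4 p).
Proof.
move=> p0 [[[a b] c] d] [[[a' b'] c'] d'] [ea eb ec ed].
by congr (_, _, _, _); apply: (mulfI p0).
Qed.

Lemma eqv_scale4 p x y : eqv x y -> eqv (scale4 p x) (scale4 p y).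
Proof. by move=> [r [s [t [w [e ->]]]]]; exists r, s, t, w; rewrite sub4_scale4. Qed.

Lemma dvdf_eqv m x y : eqv x y -> dvdf m x = dvdf m y.
Proof.
have h u v : eqv u v -> dvdf m u -> dvdf m v.
  move=> [r [s [t [w [e ->]]]]] /dvdfP[z ->]; apply/dvdfP.
  by exists (sub4 r s t w z); rewrite sub4_scale4.
by move=> xy; apply/idP/idP; apply: h => //; exact: eqv_sym.
Qed.

Lemma disc4_scale4 p x : disc4 (scale4 p x) = p ^+ 4 * disc4 x.
Proof. by case: x => [[[a b] c] d]; rewrite /disc4 /=; ring. Qed.

Lemma hess_scale4 p x : [/\ hA (scale4 p x) = p ^+ 2 * hA x, hB (scale4 p x) = p ^+ 2 * hB x &
  hC (scale4 p x) = p ^+ 2 * hC x].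
Proof. by case: x => [[[a b] c] d]; split; rewrite /=; ring. Qed.

Lemma coprime_dvdz_mull (m p : nat) (a : int) : coprime m p -> (m %| p%:Z * a)%Z = (m %| a)%Z.
Proof. by move=> c; rewrite Gauss_dvdzr. Qed.

Lemma coprime_dvdz_exp (m p k : nat) (a : int) : coprime m p -> (m %| p%:Z ^+ k * a)%Z = (m %| a)%Z.
Proof.
by move=> c; rewrite Gauss_dvdzr // coprimezE abszX /= coprimeXr.
Qed.

(** Agreement on everything that the weights at primes other than p depend on. *)
Definition same_local (p : nat) (x y : form int) : Prop :=
  forall m : nat, coprime m p -> dvdf m x = dvdf m y /\ (m %| hcont x)%N = (m %| hcont y)%N.

Lemma same_local_scale4 p x : same_local p (scale4 p x) x.
Proof.
move=> m c; split.
  by case: x => [[[a b] c'] d] /=; rewrite !coprime_dvdz_mull.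
by rewrite !dvdn_hcont; have [-> -> ->] := hess_scale4 p x; rewrite !coprime_dvdz_exp.
Qed.

Lemma same_local_eqv p x y : eqv x y -> same_local p x y.
Proof. by move=> e m c; rewrite (dvdf_eqv m e) (hcont_eqv e). Qed.

Lemma same_local_trans p x y z : same_local p x y -> same_local p y z -> same_local p x z.
Proof. by move=> h1 h2 m c; have [-> ->] := h1 m c; exact: h2. Qed.

(** The form x(p u, v), the pullback of x to a sublattice of index p. *)
Definition up_form (p : int) (x : form int) : form int :=
  let: (a, b, c, d) := x in (p ^+ 3 * a, p ^+ 2 * b, p * c, d).

Lemma up_form_sub4 p r s t w x :
  up_form p (sub4 r s (p * t) w x) = sub4 r (p * s) t w (up_form p x).
Proof. by case: x => [[[a b] c] d]; rewrite /sub4 /up_form; congr (_, _, _, _); ring. Qed.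

Lemma up_form_eqv p r s t w x y : r * w - s * (p * t) = 1 -> y = sub4 r s (p * t) w x ->
  eqv (up_form p x) (up_form p y).
Proof.
by move=> e ->; exists r, (p * s), t, w; rewrite up_form_sub4; split=> //; rewrite -e; ring.
Qed.

Definition low_form (p : int) (x : form int) : form int :=
  let: (a, b, c, d) := x in (p ^+ 2 * a, p ^+ 2 * b, p * c, d).
(** p times [low_form p x] taken at (u / p, v): the discriminant drops by p^2 and p still divides
    the content. *)
Definition tr_form (p : int) (x : form int) : form int :=
  let: (a, b, c, d) := x in (a, p * b, p * c, p * d).

Lemma up_tr_form p x : up_form p (tr_form p x) = scale4 p (low_form p x).
Proof. by case: x => [[[a b] c] d]; congr (_, _, _, _); ring. Qed.

Lemma disc4_low_form p x : disc4 (low_form p x) = p ^+ 2 * disc4 (tr_form p x).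
Proof. by case: x => [[[a b] c] d]; rewrite /disc4 /=; ring. Qed.

Lemma disc4_up_form p x : disc4 (up_form p x) = p ^+ 6 * disc4 x.
Proof. by case: x => [[[a b] c] d]; rewrite /disc4 /=; ring. Qed.

Lemma same_local_low_form p x : same_local p (low_form p x) (tr_form p x).
Proof.
move=> m c; case: x => [[[a b] c'] d]; split.
  by rewrite /= !coprime_dvdz_exp // !coprime_dvdz_mull.
rewrite !dvdn_hcont /=.
have -> : (p%:Z ^+ 2 * b) ^+ 2 - p%:Z ^+ 2 * a * (p%:Z * c') =
    p%:Z ^+ 2 * ((p%:Z * b) ^+ 2 - a * (p%:Z * c')) by ring.
have -> : p%:Z ^+ 2 * b * (p%:Z * c') - p%:Z ^+ 2 * a * d =
    p%:Z * (p%:Z * b * (p%:Z * c') - a * (p%:Z * d)) by ring.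
have -> : (p%:Z * c') ^+ 2 - p%:Z ^+ 2 * b * d = (p%:Z * c') ^+ 2 - p%:Z * b * (p%:Z * d) by ring.
by rewrite coprime_dvdz_exp // coprime_dvdz_mull.
Qed.

Lemma same_local_up_form p x : same_local p (up_form p x) x.
Proof.
move=> m c; case: x => [[[a b] c'] d]; split.
  by rewrite /= !coprime_dvdz_exp // !coprime_dvdz_mull.
rewrite !dvdn_hcont /=.
have -> : (p%:Z ^+ 2 * b) ^+ 2 - p%:Z ^+ 3 * a * (p%:Z * c') =
    p%:Z ^+ 4 * (b ^+ 2 - a * c') by ring.
have -> : p%:Z ^+ 2 * b * (p%:Z * c') - p%:Z ^+ 3 * a * d =
    p%:Z ^+ 3 * (b * c' - a * d) by ring.
have -> : (p%:Z * c') ^+ 2 - p%:Z ^+ 2 * b * d = p%:Z ^+ 2 * (c' ^+ 2 - b * d) by ring.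
by rewrite !coprime_dvdz_exp.
Qed.

Lemma dvdn_hcont_tr p x : (p %| hcont (tr_form p x))%N.
Proof.
case: x => [[[a b] c] d]; rewrite dvdn_hcont /=; apply/and3P; split; apply/dvdzP.
- by exists (b * (p%:Z * b) - a * c); ring.
- by exists (b * (p%:Z * c) - a * d); ring.
- by exists (c * (p%:Z * c) - b * (p%:Z * d)); ring.
Qed.

(** A Hessian vanishing modulo p makes (a, b, c, d) a multiple of some (l^3, l^2 m, l m^2, m^3)
    modulo p; a substitution moves this triple root to l = 0. *)
Lemma triple_root_form (p : nat) x : prime p -> ~~ dvdf p x -> (p %| hcont x)%N ->
  exists a b c d, eqv x (p%:Z * a, p%:Z * b, p%:Z * c, d) /\ ~~ (p %| d)%Z.
Proof.
move=> pp px ph.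
have [[[[a b] c] d] xy pa] : exists2 y, eqv x y & (p %| coef0 y)%Z.
  have [pa|pa] := boolP (p %| coef0 x)%Z; first by exists x => //; exact: eqv_refl.
  case: x {px} ph pa => [[[a b] c] d] ph /= pa.
  have cop : coprimez a p.
    apply: coprimez_primes; rewrite ?prime_gt0 // => l pl.
    by rewrite dvdn_prime2 // => /eqP ->.
  have /coprimezP[[u v] /= huv] := cop.
  (* r is - b / a modulo p; a^2 times the new leading coefficient is congruent to (a r + b)^3. *)
  pose r := - (u * b).
  exists (sub4 r 1 (-1) 0 (a, b, c, d)); first by exists r, 1, (-1), 0; split=> //; ring.
  move: ph; rewrite dvdn_hcont /= => /and3P[/dvdzP[q1 e1] /dvdzP[q2 e2] /dvdzP[q3 e3]].
  have : (p %| a ^+ 2 * (a * r ^+ 3 + 3 * b * r ^+ 2 * 1 + 3 * c * r * 1 ^+ 2 + d * 1 ^+ 3))%Z.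
    have e : a * r = - b + (v * b) * p%:Z.
      by transitivity (- (u * a + v * p%:Z) * b + v * b * p%:Z); [rewrite /r; ring|rewrite huv; ring].
    have -> : a ^+ 2 * (a * r ^+ 3 + 3 * b * r ^+ 2 * 1 + 3 * c * r * 1 ^+ 2 + d * 1 ^+ 3) =
      (a * r) ^+ 3 + 3 * b * (a * r) ^+ 2 + 3 * (b ^+ 2 - (b ^+ 2 - a * c)) * (a * r)
        + (b * (b ^+ 2 - (b ^+ 2 - a * c)) - a * (b * c - a * d)) by ring.
    rewrite e e1 e2; set V := v * b; apply/dvdzP.
    exists (V * (3 * b ^+ 2 - 3 * b * (V * p%:Z) + (V * p%:Z) ^+ 2) + 3 * b * V * (V * p%:Z - 2 * b)
      + 3 * (b ^+ 2 - q1 * p%:Z) * V + 3 * q1 * b - b * q1 - a * q2).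
    ring.
  by rewrite prime_dvdz_mul // prime_dvdz_exp // (negbTE pa).
rewrite (dvdf_eqv _ xy) in px; rewrite -(hcont_eqv xy) in ph.
move: ph px pa; rewrite dvdn_hcont /= => /and3P[h1 h2 h3] px pa.
have pb : (p %| b)%Z.
  rewrite -(prime_dvdz_exp _ pp (isT : 0 < 2)%N) (_ : b ^+ 2 = (b ^+ 2 - a * c) + a * c); last ring.
  by rewrite rpredD // dvdz_mulr.
have pc : (p %| c)%Z.
  rewrite -(prime_dvdz_exp _ pp (isT : 0 < 2)%N) (_ : c ^+ 2 = (c ^+ 2 - b * d) + b * d); last ring.
  by rewrite rpredD // dvdz_mulr.
rewrite pa pb pc /= in px.
case/dvdzP: pa xy => a' ->; case/dvdzP: pb => b' ->; case/dvdzP: pc => c' -> xy.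
by exists a', b', c', d; rewrite ![p%:Z * _]mulrC.
Qed.

Lemma low_form_exists (p : nat) x : prime p -> ~~ dvdf p x -> (p ^ 2 %| hcont x)%N ->
  exists y, eqv x (low_form p y).
Proof.
move=> pp px ph2.
have ph : (p %| hcont x)%N by apply: dvdn_trans ph2; rewrite dvdn_exp.
have [a [b [c [d [xy pd]]]]] := triple_root_form pp px ph.
have p0 : p%:Z != 0 by rewrite -lt0n prime_gt0.
rewrite -(hcont_eqv xy) dvdn_hcont /= in ph2; case/and3P: ph2 => _.
have -> : (p ^ 2)%N%:Z = p%:Z * p%:Z by rewrite -mulnn PoszM.
have -> : p%:Z * b * (p%:Z * c) - p%:Z * a * d = p%:Z * (p%:Z * b * c - a * d) by ring.
have -> : (p%:Z * c) ^+ 2 - p%:Z * b * d = p%:Z * (p%:Z * c ^+ 2 - b * d) by ring.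
rewrite !dvdz_mul2l // => hB' hC'.
have pb : (p %| b)%Z.
  have : (p %| b * d)%Z.
    have -> : b * d = p%:Z * c ^+ 2 - (p%:Z * c ^+ 2 - b * d) by ring.
    by rewrite rpredB // dvdz_mulr.
  by rewrite prime_dvdz_mul // (negbTE pd) orbF.
have pa : (p %| a)%Z.
  have : (p %| a * d)%Z.
    have -> : a * d = p%:Z * b * c - (p%:Z * b * c - a * d) by ring.
    by rewrite rpredB // -mulrA dvdz_mulr.
  by rewrite prime_dvdz_mul // (negbTE pd) orbF.
case/dvdzP: pa xy => a' ->; case/dvdzP: pb => b' -> xy.
exists (a', b', c, d); move: xy; rewrite /low_form.
by congr (eqv x (_, _, _, _)); ring.
Qed.

Lemma canon_exists : exists canon : form int -> form int,
  (forall x, eqv x (canon x)) /\ forall x y, eqv x y -> canon x = canon y.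
Proof.
exists (fun x => xget (0, 0, 0, 0) [set y | eqv x y]%classic); split=> [x|x y xy].
  exact: (@xgetPex _ (0, 0, 0, 0) [set y | eqv x y]%classic (ex_intro _ x (eqv_refl x))).
congr (xget _ _); apply/funext => z /=; apply/propext; split.
  by apply: eqv_trans; exact: eqv_sym.
exact: eqv_trans.
Qed.

Section Weights.
Variable R : realType.

(* p^8 [wt p x] bounds the Fourier transform modulo p^2 of the set of forms nonmaximal at p: see [FT_nonmax]. *)
Definition wt (p : nat) (x : form int) : R :=
  if dvdf (p ^ 2) x then 4 / p%:R ^+ 2
  else if dvdf p x then 4 / p%:R ^+ 3
  else if (p ^ 2 %| hcont x)%N then 2 / p%:R ^+ 3
  else if (p %| hcont x)%N then p%:R ^- 5
  else 0.

Definition wts (P : seq nat) (x : form int) : R := \prod_(p <- P) wt p x.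

Lemma wt_ge0 p x : 0 <= wt p x.
Proof.
by rewrite /wt; do ?[case: ifP => _]; rewrite ?invr_ge0 ?divr_ge0 ?exprn_ge0.
Qed.

Lemma wts_ge0 P x : 0 <= wts P x.
Proof. by apply: prodr_ge0 => p _; exact: wt_ge0. Qed.

Lemma wts_same_local p P x y : prime p -> all prime P -> p \notin P -> same_local p x y ->
  wts P x = wts P y.
Proof.
move=> pp /allP aP pP h; rewrite /wts big_seq [RHS]big_seq; apply: eq_bigr => l lP.
have c : coprime l p.
  rewrite prime_coprime ?(aP _ lP) // dvdn_prime2 ?(aP _ lP) //.
  by apply: contra pP => /eqP <-.
have c2 : coprime (l ^ 2)%N p by exact: coprimeXl.
by rewrite /wt; have [-> ->] := h _ c; have [-> ->] := h _ c2.
Qed.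

Lemma sum_filter_map (p : nat) (P : seq nat) (f : form int -> form int) (s : seq (form int)) :
  prime p -> all prime P -> p \notin P -> {in s, forall x, same_local p x (f x)} ->
  \sum_(x <- s) wts P x = \sum_(x <- map f s) wts P x.
Proof.
move=> pp aP pP h; rewrite big_map big_seq [RHS]big_seq; apply: eq_bigr => x xs.
exact: wts_same_local (h x xs).
Qed.

(** Modulo p the form [tr_form p z] is a u^3 with a nonzero, so the equivalence preserves the factor
    u, that is p | t. Conjugated by diag(p, 1) it stays integral and relates the two [low_form]. *)
Lemma tr_form_eqv (p : nat) z z' : prime p -> ~~ dvdf p (tr_form p z) ->
  eqv (tr_form p z) (tr_form p z') -> eqv (low_form p z) (low_form p z').
Proof.
move=> pp pz [r [s [t [w [det1 e]]]]].
have p0 : p%:Z != 0 by rewrite -lt0n prime_gt0.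
have pt : (p %| t)%Z.
  case: z z' pz e => [[[a b] c] d] [[[a' b'] c'] d'] /= pz [_ _ _ e].
  have pa : ~~ (p %| a)%Z by apply: contra pz => ->; rewrite !dvdz_mulr.
  have : (p %| a * t ^+ 3)%Z.
    have -> : a * t ^+ 3 = p%:Z * (d' - (3 * b * t ^+ 2 * w + 3 * c * t * w ^+ 2 + d * w ^+ 3)).
      by rewrite mulrBr e; ring.
    by rewrite dvdz_mulr.
  by rewrite prime_dvdz_mul // (negbTE pa) prime_dvdz_exp.
case/dvdzP: pt det1 e => t' ->; rewrite [t' * _]mulrC => det1 e.
have [r1 [s1 [t1 [w1 [d1 e1]]]]] := up_form_eqv det1 e.
exists r1, s1, t1, w1; split=> //.
by apply: (scale4_inj p0); rewrite -up_tr_form e1 up_tr_form sub4_scale4.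
Qed.

Lemma tr_form_dvd (p : nat) z : dvdf p (tr_form p z) -> exists y, low_form p z = up_form p y.
Proof.
case: z => [[[a b] c] d] /= /and4P[/dvdzP[e ->] _ _ _].
by exists (e, b, c, d); congr (_, _, _, _); ring.
Qed.

(** Two substitutions whose second rows agree modulo p differ by one with lower left entry divisible
    by p, and such a substitution survives [up_form]. *)
Lemma up_form_keys (p : nat) c r s t w r' s' t' w' :
  r * w - s * t = 1 -> r' * w' - s' * t' = 1 -> (p %| t - t')%Z -> (p %| w - w')%Z ->
  eqv (up_form p (sub4 r s t w c)) (up_form p (sub4 r' s' t' w' c)).
Proof.
move=> d1 d2 /dvdzP[u hu] /dvdzP[v hv].
have et : t = t' + u * p%:Z by rewrite -hu; ring.
have ew : w = w' + v * p%:Z by rewrite -hv; ring.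
apply: (@up_form_eqv p (r' * w - s' * t) (s' * r - r' * s) (t' * v - w' * u) (w' * r - t' * s)).
  have -> : p%:Z * (t' * v - w' * u) = t' * w - w' * t by rewrite et ew; ring.
  by transitivity ((r * w - s * t) * (r' * w' - s' * t')); [ring|rewrite d1 d2].
have -> : p%:Z * (t' * v - w' * u) = t' * w - w' * t by rewrite et ew; ring.
rewrite sub4_comp; congr (sub4 _ _ _ _ _).
- by transitivity (r' * (r * w - s * t)); [rewrite d1 mulr1|ring].
- by transitivity (s' * (r * w - s * t)); [rewrite d1 mulr1|ring].
- by transitivity (t' * (r * w - s * t)); [rewrite d1 mulr1|ring].
- by transitivity (w' * (r * w - s * t)); [rewrite d1 mulr1|ring].
Qed.

Definition bnd (C : R) (P Q : seq nat) (Y : R) : R :=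
  C * 22 ^+ size P * 4 ^+ size Q * Y / ((\prod_(p <- P) p)%:R ^+ 7 * (\prod_(p <- Q) p)%:R ^+ 2).

Definition admissible (Q : seq nat) (Y : R) (x : form int) : Prop :=
  [/\ disc4 x != 0, (\prod_(p <- Q) p %| hcont x)%N & `|disc4 x|%:~R <= Y].

Section Step.
Variables (C : R) (p : nat) (P Q : seq nat).

Hypothesis pp : prime p.
Hypothesis aP : all prime P.
Hypothesis aQ : all prime Q.
Hypothesis pP : p \notin P.
Hypothesis pQ : p \notin Q.
Hypothesis IHQ : forall (s : seq (form int)) (Y : R), 0 <= Y -> ineqs s ->
  {in s, forall x, admissible Q Y x} -> \sum_(x <- s) wts P x <= bnd C P Q Y.
Hypothesis IHpQ : forall (s : seq (form int)) (Y : R), 0 <= Y -> ineqs s ->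
  {in s, forall x, admissible (p :: Q) Y x} -> \sum_(x <- s) wts P x <= bnd C P (p :: Q) Y.

Let p0 : 0 < p%:R :> R. Proof. by rewrite ltr0n prime_gt0. Qed.
Let pz : p%:Z != 0. Proof. by rewrite -lt0n prime_gt0. Qed.
Let cQp : coprime (\prod_(l <- Q) l) p.
Proof. by rewrite coprime_sym prod_prime_coprime. Qed.

Lemma admissible_local x y Y k : same_local p x y -> `|disc4 x| = p%:Z ^+ k * `|disc4 y| ->
  admissible Q Y x -> admissible Q (Y / p%:R ^+ k) y.
Proof.
move=> h e [Dx Qx Yx]; split.
- by apply: contraNneq Dx => Dy; rewrite -normr_eq0 e Dy normr0 mulr0.
- by have [_ <-] := h _ cQp.
- rewrite ler_pdivlMr ?exprn_gt0 // mulrC; move: Yx; rewrite e intrM.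
  by rewrite rmorphXn.
Qed.

Lemma step_scale (k : nat) (s : seq (form int)) (Y : R) : 0 <= Y -> ineqs s ->
  {in s, forall x, admissible Q Y x /\ dvdf (p ^ k) x} ->
  \sum_(x <- s) wts P x <= bnd C P Q (Y / p%:R ^+ (4 * k)).
Proof.
move=> Y0 si hs.
have /choice[f hf] x : exists y, x \in s -> x = scale4 (p ^ k)%N y.
  have [xs|xs] := boolP (x \in s); last by exists x.
  by have [_ /dvdfP[y ->]] := hs x xs; exists y.
have pk0 : (p ^ k)%N%:Z != 0 by rewrite -lt0n expn_gt0 prime_gt0.
have loc x : x \in s -> same_local p x (f x).
  move=> xs m cm; have := @same_local_scale4 (p ^ k)%N (f x) m.
  by rewrite -hf // coprimeXr // => /(_ isT).
rewrite (sum_filter_map pp aP pP loc); apply: IHQ.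
- by rewrite divr_ge0 // exprn_ge0 // ltW.
- apply: ineqs_map si => x y xs ys e.
  by rewrite (hf x xs) (hf y ys); exact: eqv_scale4.
- move=> _ /mapP[x xs ->]; have [ax _] := hs x xs.
  apply: admissible_local (loc x xs) _ ax.
  rewrite {1}(hf x xs) disc4_scale4 normrM normrX; congr (_ * _).
  by rewrite -(natz (p ^ k)) natrX natz normrX -exprM mulnC.
Qed.

(** Where p does not divide the transform [tr_form p z], the map is injective on classes and lands
    in content divisible by p at level Y / p^2. Otherwise x is an [up_form], the discriminant drops
    by p^6, and at most p^2 classes share an image. *)
Lemma step_low (s : seq (form int)) (Y : R) : 0 <= Y -> ineqs s ->
  {in s, forall x, [/\ admissible Q Y x, ~~ dvdf p x & (p ^ 2 %| hcont x)%N]} ->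
  \sum_(x <- s) wts P x <= bnd C P (p :: Q) (Y / p%:R ^+ 2) + p%:R ^+ 2 * bnd C P Q (Y / p%:R ^+ 6).
Proof.
move=> Y0 si hs.
have /choice[f hf] x : exists z, x \in s -> eqv x (low_form p z).
  have [xs|xs] := boolP (x \in s); last by exists x.
  by have [_ px ph] := hs x xs; have [z hz] := low_form_exists pp px ph; exists z.
pose D x := dvdf p (tr_form p (f x)).
rewrite (bigID D) /= addrC -(big_filter s (fun x => ~~ D x)) -(big_filter s D).
apply: lerD.
  set u := filter _ s; have us : {subset u <= s} by move=> x; rewrite mem_filter => /andP[].
  have loc x : x \in u -> same_local p x (tr_form p (f x)).
    move=> /us xs; exact: (@same_local_trans _ _ _ _ (@same_local_eqv p _ _ (hf x xs)) (@same_local_low_form _ _)).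
  rewrite (sum_filter_map pp aP pP loc); apply: IHpQ.
  - by rewrite divr_ge0 // exprn_ge0 // ltW.
  - apply: ineqs_map => [x y xu yu e|]; last exact: ineqs_filter.
    have := xu; rewrite mem_filter => /andP[Dx _].
    exact: eqv_trans (hf x (us _ xu)) (eqv_trans (tr_form_eqv pp Dx e) (eqv_sym (hf y (us _ yu)))).
  - move=> _ /mapP[x xu ->]; have [ax _ _] := hs x (us _ xu).
    have [|h1 h2 h3] := @admissible_local x (tr_form p (f x)) Y 2 (loc x xu) _ ax.
      by rewrite -(disc4_eqv (hf x (us _ xu))) disc4_low_form normrM normrX.
    split => //; rewrite big_cons Gauss_dvd ?dvdn_hcont_tr //.
    by rewrite coprime_sym.
set u := filter _ s; have us : {subset u <= s} by move=> x; rewrite mem_filter => /andP[].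
have /choice[g hg] x : exists y, x \in u -> eqv x (up_form p y).
  have [xu|xu] := boolP (x \in u); last by exists x.
  have := xu; rewrite mem_filter => /andP[/tr_form_dvd[y hy] _].
  by exists y => _; rewrite -hy; exact: hf (us _ xu).
have [canon [can1 can2]] := canon_exists.
(* Each g x is a substitution of the canonical member of its class; that member and the second row
   (t, w) modulo p determine the class of x, which gives the p^2 keys. *)
have /choice[h hh] x : exists h : int * int * int * int, let: (r, s, t, w) := h in
    r * w - s * t = 1 /\ g x = sub4 r s t w (canon (g x)).
  have [r [s' [t [w [det1 e]]]]] := eqv_sym (can1 (g x)).
  by exists (r, s', t, w).
pose res (z : int) := `|(z %% p)%Z|%N.
have resE z z' : res z = res z' -> (p %| z - z')%Z.
  rewrite /res => /(congr1 Posz); rewrite !gez0_abs ?modz_ge0 // => e.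
  by rewrite -eqz_mod_dvd; apply/eqP.
have resI z : res z \in iota 0 p.
  by rewrite mem_iota add0n -ltz_nat gez0_abs ?modz_ge0 // ltz_pmod // ltz_nat prime_gt0.
pose key x := let: (r, s, t, w) := h x in (res t, res w).
pose ks := [seq (i, j) | i <- iota 0 p, j <- iota 0 p].
have keyI x : key x \in ks.
  rewrite /key; case: (h x) => [[[r s'] t] w].
  by apply/allpairsP; exists (res t, res w); rewrite /= !resI.
have ksu : uniq ks by rewrite allpairs_uniq ?iota_uniq // => -[? ?] [? ?].
have ksz : (size ks)%:R = p%:R ^+ 2 :> R by rewrite size_allpairs size_iota natrM expr2.
have -> : \sum_(x <- u) wts P x = \sum_(kt <- ks) \sum_(x <- [seq x <- u | key x == kt]) wts P x.
  under [RHS]eq_bigr do rewrite big_filter big_mkcond /=.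
  rewrite exchange_big; apply: eq_bigr => x _ /=.
  rewrite (big_rem _ (keyI x)) /= eqxx big_seq big1 ?addr0 // => kt.
  by rewrite mem_rem_uniq // inE => /andP[/negbTE ktx _]; rewrite eq_sym ktx.
apply: (@le_trans _ _ (\sum_(kt <- ks) bnd C P Q (Y / p%:R ^+ 6))); last first.
  by rewrite big_const_seq count_predT iter_addr_0 -[_ *+ size ks]mulr_natl ksz.
apply: ler_sum => kt _; set v := filter _ u.
have vu : {subset v <= u} by move=> x; rewrite mem_filter => /andP[].
have loc x : x \in v -> same_local p x (g x).
  move=> /vu xu; exact: (@same_local_trans _ _ _ _ (@same_local_eqv p _ _ (hg x xu)) (@same_local_up_form _ _)).
rewrite (sum_filter_map pp aP pP loc); apply: IHQ.
- by rewrite divr_ge0 // exprn_ge0 // ltW.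
- apply: ineqs_map => [x y xv yv e|]; last by do 2!apply: ineqs_filter.
  have := xv; have := yv; rewrite !mem_filter => /andP[/eqP ky _] /andP[/eqP kx _].
  apply: eqv_trans (hg x (vu _ xv)) _; apply: eqv_trans (eqv_sym (hg y (vu _ yv))).
  have := hh x; have := hh y; move: kx ky; rewrite /key (can2 _ _ e).
  move: (canon (g y)) => c.
  case: (h x) (h y) => [[[r s'] t] w] [[[r1 s1] t1] w1] <- [] e1 e2 [d1 ey] [d2 ex].
  by rewrite ex ey; apply: up_form_keys => //; exact: resE.
- move=> _ /mapP[x xv ->]; have [ax _ _] := hs x (us _ (vu _ xv)).
  apply: admissible_local (loc x xv) _ ax.
  by rewrite -(disc4_eqv (hg x (vu _ xv))) disc4_up_form normrM normrX.
Qed.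
End Step.
End Weights.

Section WeightedCount.
Variable R : realType.

Lemma bnd_div (C : R) P Q Y (z : R) : bnd C P Q (Y / z) = bnd C P Q Y / z.
Proof. by rewrite /bnd; ring. Qed.

Lemma bnd_cons_level (C : R) p P Q Y : bnd C P (p :: Q) Y = 4 * bnd C P Q Y / p%:R ^+ 2.
Proof.
rewrite /bnd big_cons /= natrM exprMn (exprS 4).
by move: (_ ^+ 7) (_%:R ^+ 2) (_%:R ^+ 2) (22 ^+ _) (4 ^+ _) => *; rewrite !invfM; ring.
Qed.

Lemma bnd_cons_weight (C : R) p P Q Y : bnd C (p :: P) Q Y = 22 * bnd C P Q Y / p%:R ^+ 7.
Proof.
rewrite /bnd big_cons /= natrM exprMn (exprS 22).
by move: (_%:R ^+ 7) (_%:R ^+ 7) (_ ^+ 2) (22 ^+ _) (4 ^+ _) => *; rewrite !invfM; ring.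
Qed.

Lemma sum_indicator (s : seq (form int)) (c : pred (form int)) (g : form int -> R) :
  \sum_(x <- s) (c x)%:R * g x = \sum_(x <- filter c s) g x.
Proof.
rewrite big_filter [RHS]big_mkcond; apply: eq_bigr => x _.
by case: (c x); rewrite ?mul1r ?mul0r.
Qed.

(** With K the bound at the previous stage, the four cases of [wt] give 4 / p^2 times K / p^8, 4 /
    p^3 times K / p^4, 2 / p^3 times 5 K / p^4, and 1 / p^5 times 4 K / p^2. Over p^7 this is at
    most 22 K = (4 + 4 + 10 + 4) K. *)
Lemma weighted_step (C : R) (p : nat) (P Q : seq nat) (s : seq (form int)) (Y : R) :
  0 < C -> prime p -> all prime P -> all prime Q -> p \notin P -> p \notin Q ->
  (forall (s : seq (form int)) (Y : R), 0 <= Y -> ineqs s ->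
    {in s, forall x, admissible Q Y x} -> \sum_(x <- s) wts R P x <= bnd C P Q Y) ->
  (forall (s : seq (form int)) (Y : R), 0 <= Y -> ineqs s ->
    {in s, forall x, admissible (p :: Q) Y x} -> \sum_(x <- s) wts R P x <= bnd C P (p :: Q) Y) ->
  0 <= Y -> ineqs s -> {in s, forall x, admissible Q Y x} ->
  \sum_(x <- s) wts R (p :: P) x <= bnd C (p :: P) Q Y.
Proof.
move=> C0 pp aP aQ pP pQ IHQ IHpQ Y0 si hs.
have p0 : 0 < p%:R :> R by rewrite ltr0n prime_gt0.
have p1 : 1 <= p%:R :> R by rewrite ler1n prime_gt0.
pose c1 x := dvdf (p ^ 2) x; pose c2 x := dvdf (p ^ 1) x.
pose c3 x := ~~ dvdf p x && (p ^ 2 %| hcont x)%N.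
pose c4 x := (p %| hcont x)%N.
have e1 : \sum_(x <- filter c1 s) wts R P x <= bnd C P Q Y / p%:R ^+ 8.
  rewrite -bnd_div; apply: (@step_scale R C p P Q pp aP aQ pP pQ IHQ 2) => //.
    exact: ineqs_filter.
  by move=> x; rewrite mem_filter => /andP[? /hs].
have e2 : \sum_(x <- filter c2 s) wts R P x <= bnd C P Q Y / p%:R ^+ 4.
  rewrite -bnd_div; apply: (@step_scale R C p P Q pp aP aQ pP pQ IHQ 1) => //.
    exact: ineqs_filter.
  by move=> x; rewrite mem_filter => /andP[? /hs].
have e3 : \sum_(x <- filter c3 s) wts R P x <=
   4 * bnd C P Q Y / p%:R ^+ 2 / p%:R ^+ 2 + p%:R ^+ 2 * (bnd C P Q Y / p%:R ^+ 6).
  rewrite -bnd_cons_level -!bnd_div; apply: (@step_low R C p P Q pp aP aQ pP pQ IHQ IHpQ) => //.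
    exact: ineqs_filter.
  by move=> x; rewrite mem_filter => /andP[/andP[? ?] /hs].
have e4 : \sum_(x <- filter c4 s) wts R P x <= 4 * bnd C P Q Y / p%:R ^+ 2.
  rewrite -bnd_cons_level; apply: IHpQ => //; first exact: ineqs_filter.
  move=> x; rewrite mem_filter => /andP[px /hs[Dx Qx Yx]]; split=> //.
  by rewrite big_cons Gauss_dvd ?prod_prime_coprime // Qx andbT.
have K0 : 0 <= bnd C P Q Y.
  rewrite /bnd divr_ge0 //.
    by rewrite mulr_ge0 // mulr_ge0 ?exprn_ge0 // mulr_ge0 ?exprn_ge0 // ltW.
  by rewrite mulr_ge0 ?exprn_ge0.
rewrite bnd_cons_weight; move: e1 e2 e3 e4 K0; move: (bnd C P Q Y) => K e1 e2 e3 e4 K0.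
(* [wt] is bounded by the sum of its cases taken without exclusion; for instance [c2] contains
   [c1]. *)
apply: (@le_trans _ _ (\sum_(x <- s) (4 / p%:R ^+ 2 * ((c1 x)%:R * wts R P x) +
   4 / p%:R ^+ 3 * ((c2 x)%:R * wts R P x) + 2 / p%:R ^+ 3 * ((c3 x)%:R * wts R P x) +
   p%:R ^- 5 * ((c4 x)%:R * wts R P x)))).
  apply: ler_sum => x _; rewrite /wts big_cons -/(wts R P x).
  move: (wts R P x) (wts_ge0 R P x) => g g0.
  rewrite /wt /c1 /c2 /c3 /c4 expn1.
  have q2 : 0 <= p%:R ^- 2 :> R by rewrite invr_ge0 exprn_ge0.
  have q3 : 0 <= p%:R ^- 3 :> R by rewrite invr_ge0 exprn_ge0.
  have q5 : 0 <= p%:R ^- 5 :> R by rewrite invr_ge0 exprn_ge0.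
  have m2 : 0 <= p%:R ^- 2 * g by rewrite mulr_ge0.
  have m3 : 0 <= p%:R ^- 3 * g by rewrite mulr_ge0.
  have m5 : 0 <= p%:R ^- 5 * g by rewrite mulr_ge0.
  move: m2 m3 m5; move: (p%:R ^- 2) (p%:R ^- 3) (p%:R ^- 5) => u2 u3 u5 m2 m3 m5.
  case: (dvdf (p ^ 2) x) (dvdf p x) (p ^ 2 %| hcont x)%N (p %| hcont x)%N => [] [] [] [] /=; lra.
rewrite !big_split /= -!mulr_sumr !sum_indicator.
have iv k : 0 <= p%:R ^- k :> R by rewrite invr_ge0 exprn_ge0.
have f1 : 4 / p%:R ^+ 2 * \sum_(x <- filter c1 s) wts R P x <= 4 * (p%:R ^- 3 * (K / p%:R ^+ 7)).
  rewrite -mulrA ler_pM2l //; apply: (le_trans (ler_wpM2l (iv 2) e1)).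
  by rewrite le_eqVlt; apply/orP; left; apply/eqP; field; rewrite gt_eqF.
have f1' : p%:R ^- 3 * (K / p%:R ^+ 7) <= K / p%:R ^+ 7.
  by apply: ler_piMl; [rewrite mulr_ge0|rewrite invf_le1 ?exprn_gt0 ?exprn_ege1].
have f2 : 4 / p%:R ^+ 3 * \sum_(x <- filter c2 s) wts R P x <= 4 * (K / p%:R ^+ 7).
  rewrite -mulrA ler_pM2l //; apply: (le_trans (ler_wpM2l (iv 3) e2)).
  by rewrite le_eqVlt; apply/orP; left; apply/eqP; field; rewrite gt_eqF.
have f3 : 2 / p%:R ^+ 3 * \sum_(x <- filter c3 s) wts R P x <= 10 * (K / p%:R ^+ 7).
  have i3 : 0 <= 2 / p%:R ^+ 3 :> R by rewrite divr_ge0 // exprn_ge0.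
  apply: (le_trans (ler_wpM2l i3 e3)).
  by rewrite le_eqVlt; apply/orP; left; apply/eqP; field; rewrite gt_eqF.
have f4 : p%:R ^- 5 * \sum_(x <- filter c4 s) wts R P x <= 4 * (K / p%:R ^+ 7).
  apply: (le_trans (ler_wpM2l (iv 5) e4)).
  by rewrite le_eqVlt; apply/orP; left; apply/eqP; field; rewrite gt_eqF.
rewrite -mulrA; move: f1 f1' f2 f3 f4; move: (K / p%:R ^+ 7) (p%:R ^- 3 * _) => E1 E2.
move: (_ * \sum_(x <- filter c1 s) _) (_ * \sum_(x <- filter c2 s) _)
  (_ * \sum_(x <- filter c3 s) _) (_ * \sum_(x <- filter c4 s) _) => *.
lra.
Qed.

(** Q stays free in the induction on P because the step at p uses the statement for [p :: Q];
    [content_count] is the case of empty P. *)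
Lemma weighted_count : exists2 C : R, 0 < C &
  forall (P Q : seq nat) (s : seq (form int)) (Y : R), all prime P -> all prime Q ->
  uniq (P ++ Q) -> 0 <= Y -> ineqs s -> {in s, forall x, admissible Q Y x} ->
  \sum_(x <- s) wts R P x <= bnd C P Q Y.
Proof.
have [C C0 cc] := content_count R; exists C => // P.
elim: P => [|p P IH] Q s Y.
  move=> _ aQ uQ Y0 si hs; rewrite /bnd /= expr0 mulr1 big_nil expr1n mul1r.
  under eq_bigr do rewrite /wts big_nil.
  by rewrite big_const_seq count_predT iter_addr_0; exact: cc.
move=> /= /andP[pp aP] aQ /andP[]; rewrite mem_cat negb_or => /andP[pP pQ] uPQ Y0 si hs.
apply: weighted_step => // s1 Y1 Y10 si1 hs1; apply: IH => //=.
  by rewrite pp.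
by rewrite uniq_catC /= mem_cat negb_or pQ pP /= uniq_catC.
Qed.
End WeightedCount.

From mathcomp Require Import ring lra zify complex finmap.
From mathcomp Require Import all_boot all_order all_algebra.
From mathcomp Require Import all_classical all_reals all_analysis.
Require Import Defs.

Import Order.TTheory GRing.Theory Num.Theory.

Local Open Scope ring_scope.

(** * Fourier transforms of functions of the coefficients modulo N *)

Definition pairz (h y : form int) : int :=
  let: (a, b, c, d) := h in let: (y1, y2, y3, y4) := y in
  d * y1 - c * y2 + b * y3 - a * y4.

Section Characters.
Variable R : realType.
Local Notation C := R[i].

Definition ez (N : nat) (z : int) : C := expi (2 * pi * z%:~R / N%:R : R).

Lemma expiD (s t : R) : expi (s + t) = expi s * expi t.
Proof.
by rewrite /expi cosD sinD; apply/eqP; rewrite eq_complex /=; apply/andP; split; apply/eqP; ring.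
Qed.

Lemma ezD N z w : ez N (z + w) = ez N z * ez N w.
Proof. by rewrite /ez intrD -expiD; congr (expi _); ring. Qed.

Lemma ez0 N : ez N 0 = 1.
Proof. by rewrite /ez mulr0 mul0r /expi cos0 sin0. Qed.

Lemma expi_2pi_nat (k : nat) : expi (2 * pi * k%:R : R) = 1.
Proof.
elim: k => [|k IH]; first by rewrite mulr0 /expi cos0 sin0.
have -> : 2 * pi * k.+1%:R = 2 * pi * k%:R + pi *+ 2 :> R.
  by rewrite -addn1 natrD mulr2n; ring.
by rewrite /expi cosD2pi sinD2pi.
Qed.

Lemma ez_mul N (k : int) : (0 < N)%N -> ez N (k * N%:Z) = 1.
Proof.
move=> N0; have N0' : N%:R != 0 :> R by rewrite pnatr_eq0 -lt0n.
have posz (m : nat) : ez N (m%:Z * N%:Z) = 1.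
  by rewrite /ez intrM -!pmulrn mulrA mulfK // expi_2pi_nat.
case: (intP k) => [|m|m].
- by rewrite mul0r ez0.
- exact: posz.
- have h : ez N (m.+1%:Z * N%:Z) * ez N (- m.+1%:Z * N%:Z) = 1.
    by rewrite -ezD -mulrDl subrr mul0r ez0.
  by rewrite -h posz mul1r.
Qed.

Lemma ez_periodic N (z w : int) : (0 < N)%N -> (N %| z - w)%Z -> ez N z = ez N w.
Proof.
move=> N0 /dvdzP[k hk]; have -> : z = k * N%:Z + w by rewrite -hk; ring.
by rewrite ezD ez_mul // mul1r.
Qed.

Lemma norm_ez N z : `|ez N z| = 1.
Proof. by rewrite /ez /expi normc_def /= cos2Dsin2 sqrtr1. Qed.

Lemma cos_eq1 (t : R) : 0 <= t < 2 * pi -> cos t = 1 -> t = 0.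
Proof.
move=> /andP[t0 t2] ct; have p0 := pi_gt0 R.
have inj : {in `[0, pi] &, injective (@cos R)} by exact: cos_inj.
have [tp|tp] := leP t pi.
  by apply: inj; rewrite ?cos0 ?in_itv //= ?lexx ?t0 ?tp // ltW.
have : 2 * pi - t = 0.
  apply: inj; rewrite ?in_itv /= ?lexx ?(ltW p0) //; first by apply/andP; split; lra.
  rewrite cos0 -[RHS]ct -[RHS]cosN -[RHS]cosD2pi; congr cos.
  by rewrite mulr2n; ring.
lra.
Qed.

Lemma ez_eq1 N (z : int) : (0 < N)%N -> ez N z = 1 -> (N %| z)%Z.
Proof.
move=> N0 h; have N0' : 0 < N%:R :> R by rewrite ltr0n.
apply/dvdz_mod0P.
have : ez N (z %% N)%Z = 1.
  by rewrite -h; apply: ez_periodic => //; rewrite -eqz_mod_dvd modz_mod.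
have r0 : 0 <= (z %% N)%Z by rewrite modz_ge0 // -lt0n.
have rN : (z %% N)%Z < N%:Z by rewrite ltz_pmod.
move: (z %% N)%Z r0 rN => r r0 rN [hc _].
have p0 := pi_gt0 R.
have hr : 0 <= r%:~R :> R by rewrite ler0z.
have hrN : r%:~R < N%:R :> R by rewrite pmulrn ltr_int.
have b : 0 <= (2 * pi * r%:~R / N%:R : R) < 2 * pi.
  apply/andP; split; first by rewrite divr_ge0 // mulr_ge0 // mulr_ge0 // ltW.
  by rewrite ltr_pdivrMr // ltr_pM2l // mulr_gt0.
have /eqP := @cos_eq1 _ b hc; rewrite !mulf_eq0 invr_eq0 (gt_eqF N0') orbF.
by rewrite (gt_eqF p0) pnatr_eq0 /= intr_eq0 => /eqP.
Qed.
End Characters.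

Definition addf (f g : form int) : form int :=
  let: (a, b, c, d) := f in let: (a', b', c', d') := g in (a + a', b + b', c + c', d + d').

Definition congf (N : nat) (f g : form int) : Prop :=
  let: (a, b, c, d) := f in let: (a', b', c', d') := g in
  [/\ (N %| a - a')%Z, (N %| b - b')%Z, (N %| c - c')%Z & (N %| d - d')%Z].

Definition periodic_form (T : Type) (N : nat) (phi : form int -> T) : Prop :=
  forall f g, congf N f g -> phi f = phi g.

(** Under this invariance the decomposition y = N2 y1 + N1 y2 factors the transform modulo N1 N2
    without twisting the frequency h. *)
Definition unit_invariant (T : Type) (N : nat) (phi : form int -> T) : Prop :=
  forall (m : nat) f, coprime m N -> phi (scale4 m f) = phi f.

Lemma congf_sym N f g : congf N f g -> congf N g f.
Proof.
case: f => [[[a b] c] d]; case: g => [[[a' b'] c'] d'] [h1 h2 h3 h4].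
by split; rewrite -rpredN opprB.
Qed.

Lemma congf_trans N f g h : congf N f g -> congf N g h -> congf N f h.
Proof.
case: f => [[[a b] c] d]; case: g => [[[a' b'] c'] d']; case: h => [[[a1 b1] c1] d1].
move=> [h1 h2 h3 h4] [k1 k2 k3 k4].
have tr (x y z : int) : (N %| x - y)%Z -> (N %| y - z)%Z -> (N %| x - z)%Z.
  move=> u v; have -> : x - z = (x - y) + (y - z) by ring.
  exact: rpredD.
by split; apply: tr; eassumption.
Qed.

Lemma congf_addI N f f' g : congf N (addf f g) (addf f' g) -> congf N f f'.
Proof.
case: f => [[[a b] c] d]; case: f' => [[[a' b'] c'] d']; case: g => [[[a1 b1] c1] d1].
have e (u v w : int) : u + w - (v + w) = u - v by ring.
by rewrite /= !e.
Qed.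

Lemma pairz_congf N h f g : congf N f g -> (N %| pairz h f - pairz h g)%Z.
Proof.
case: h => [[[a b] c] d]; case: f => [[[y1 y2] y3] y4]; case: g => [[[z1 z2] z3] z4].
move=> [h1 h2 h3 h4].
have -> : pairz (a, b, c, d) (y1, y2, y3, y4) - pairz (a, b, c, d) (z1, z2, z3, z4) =
  d * (y1 - z1) + (- c) * (y2 - z2) + b * (y3 - z3) + (- a) * (y4 - z4) by rewrite /=; ring.
by rewrite !rpredD // dvdz_mull.
Qed.

Lemma pairz_add h f g : pairz h (addf f g) = pairz h f + pairz h g.
Proof.
case: h => [[[a b] c] d]; case: f => [[[y1 y2] y3] y4]; case: g => [[[z1 z2] z3] z4] /=; ring.
Qed.

Lemma pairz_scale4 h m f : pairz h (scale4 m f) = m * pairz h f.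
Proof. case: h => [[[a b] c] d]; case: f => [[[y1 y2] y3] y4] /=; ring. Qed.

Section Residues.
Variable N : nat.
Hypothesis N0 : (0 < N)%N.

Lemma mod_ord_subproof (z : int) : (`|(z %% N)%Z| < N)%N.
Proof.
by rewrite -ltz_nat gez0_abs ?modz_ge0 // -?lt0n // ltz_pmod.
Qed.

Definition mod_ord (z : int) : 'I_N := Ordinal (mod_ord_subproof z).

Lemma mod_ordE z : (mod_ord z : nat)%:Z = (z %% N)%Z.
Proof. by rewrite /= gez0_abs // modz_ge0 // -lt0n. Qed.

Definition mod_form (f : form int) : form 'I_N :=
  let: (a, b, c, d) := f in (mod_ord a, mod_ord b, mod_ord c, mod_ord d).

Lemma lift_mod_form f : congf N (lift_form (mod_form f)) f.
Proof.
case: f => [[[a b] c] d]; rewrite /mod_form /lift_form.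
by split; rewrite mod_ordE -eqz_mod_dvd modz_mod.
Qed.

Lemma lift_form_inj (y z : form 'I_N) : congf N (lift_form y) (lift_form z) -> y = z.
Proof.
case: y => [[[a b] c] d]; case: z => [[[a' b'] c'] d'] /= [h1 h2 h3 h4].
have eqI (i j : 'I_N) : (N %| i%:Z - j%:Z)%Z -> i = j.
  rewrite -eqz_mod_dvd !modz_small ?ltz_nat ?ltn_ord //.
  by move=> /eqP [] /val_inj.
by rewrite (eqI _ _ h1) (eqI _ _ h2) (eqI _ _ h3) (eqI _ _ h4).
Qed.
End Residues.

Section Fourier.
Variable R : realType.
Local Notation C := R[i].

Definition FT (N : nat) (phi : form int -> C) (h : form int) : C :=
  \sum_(y : form 'I_N) phi (lift_form y) * ez R N (pairz h (lift_form y)).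

Lemma FT_shift (N : nat) (phi : form int -> C) h v : (0 < N)%N -> periodic_form N phi ->
  FT N phi h = \sum_(y : form 'I_N) phi (addf (lift_form y) v) * ez R N (pairz h (addf (lift_form y) v)).
Proof.
move=> N0 per; rewrite /FT (reindex_inj (h := fun y => mod_form N0 (addf (lift_form y) v))) /=.
  apply: eq_bigr => y _; have e := lift_mod_form N0 (addf (lift_form y) v).
  by rewrite (per _ _ e) (ez_periodic _ N0 (pairz_congf h e)).
move=> y z e; apply: lift_form_inj; apply: (@congf_addI _ _ _ v).
apply: congf_trans (congf_sym (lift_mod_form N0 _)) _.
by rewrite e; exact: lift_mod_form.
Qed.

(* Shifting the summation variable by v multiplies the transform by [ez R N (pairz h v)]. *)
Lemma FT_orthogonal (N : nat) (phi : form int -> C) h v : (0 < N)%N -> periodic_form N phi ->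
  (forall f, phi (addf f v) = phi f) -> FT N phi h != 0 -> (N %| pairz h v)%Z.
Proof.
move=> N0 per st F0; apply: (@ez_eq1 R) => //.
apply: (mulfI F0); rewrite mulr1 [RHS](FT_shift h v N0 per) /FT mulr_suml.
by apply: eq_bigr => y _; rewrite st pairz_add ezD mulrA.
Qed.

Lemma FT_norm (N : nat) (b : form int -> bool) h :
  `|FT N (fun f => (b f)%:R) h| <= #|[set y : form 'I_N | b (lift_form y)]%SET|%:R.
Proof.
apply: le_trans (ler_norm_sum _ _ _) _.
rewrite -sum1_card natr_sum [leRHS]big_mkcond /=; apply: ler_sum => y _.
by rewrite normrM norm_ez mulr1 inE; case: (b _); rewrite ?normr1 ?normr0.
Qed.

Lemma FT_mul (N1 N2 : nat) (phi1 phi2 : form int -> C) h : (0 < N1)%N -> (0 < N2)%N ->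
  coprime N1 N2 -> periodic_form N1 phi1 -> periodic_form N2 phi2 ->
  unit_invariant N1 phi1 -> unit_invariant N2 phi2 ->
  FT (N1 * N2) (fun f => phi1 f * phi2 f) h = FT N1 phi1 h * FT N2 phi2 h.
Proof.
move=> N10 N20 cop per1 per2 inv1 inv2.
have N0 : (0 < N1 * N2)%N by rewrite muln_gt0 N10.
pose comb (y : form 'I_N1 * form 'I_N2) : form int :=
  addf (scale4 N2 (lift_form y.1)) (scale4 N1 (lift_form y.2)).
pose F y := mod_form N0 (comb y).
have dvdl f g : congf (N1 * N2) f g -> congf N1 f g.
  case: f => [[[a b] c] d]; case: g => [[[a' b'] c'] d'] [h1 h2 h3 h4].
  have tr (z : int) : ((N1 * N2)%N %| z)%Z -> (N1 %| z)%Z.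
    by rewrite !dvdzE; apply: dvdn_trans; rewrite /= dvdn_mulr.
  by split; apply: tr.
have dvdr f g : congf (N1 * N2) f g -> congf N2 f g.
  case: f => [[[a b] c] d]; case: g => [[[a' b'] c'] d'] [h1 h2 h3 h4].
  have tr (z : int) : ((N1 * N2)%N %| z)%Z -> (N2 %| z)%Z.
    by rewrite !dvdzE; apply: dvdn_trans; rewrite /= dvdn_mull.
  by split; apply: tr.
have comb1 y : congf N1 (comb y) (scale4 N2 (lift_form y.1)).
  rewrite /comb; case: (lift_form y.1) => [[[a b] c] d]; case: (lift_form y.2) => [[[a' b'] c'] d'] /=.
  by split; rewrite addrAC subrr add0r dvdz_mulr.
have comb2 y : congf N2 (comb y) (scale4 N1 (lift_form y.2)).
  rewrite /comb; case: (lift_form y.1) => [[[a b] c] d]; case: (lift_form y.2) => [[[a' b'] c'] d'] /=.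
  by split; rewrite -addrA subrr addr0 dvdz_mulr.
have scI (M m : nat) f g : coprime M m -> congf M (scale4 m f) (scale4 m g) -> congf M f g.
  move=> cm; case: f => [[[a b] c] d]; case: g => [[[a' b'] c'] d'] [].
  by rewrite -!mulrBr !Gauss_dvdzr.
have Finj : injective F.
  move=> y z e; have ez' : congf (N1 * N2) (comb y) (comb z).
    apply: congf_trans (congf_sym (lift_mod_form N0 _)) _.
    by rewrite -/(F y) e; exact: lift_mod_form.
  have h1 : y.1 = z.1.
    apply: lift_form_inj; apply: (scI _ N2) => //.
    by apply: congf_trans (congf_sym (comb1 y)) _; apply: congf_trans (dvdl _ _ ez') (comb1 z).
  have h2 : y.2 = z.2.
    apply: lift_form_inj; apply: (scI _ N1); first by rewrite coprime_sym.
    by apply: congf_trans (congf_sym (comb2 y)) _; apply: congf_trans (dvdr _ _ ez') (comb2 z).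
  by case: y z h1 h2 {e ez'} => [? ?] [? ?] /= -> ->.
have Fbij : bijective F.
  apply: inj_card_bij Finj _.
  by rewrite !card_prod !card_ord leq_eqVlt; apply/orP; left; apply/eqP; ring.
rewrite {1}/FT (reindex F) /=; last exact: onW_bij.
rewrite /FT big_distrlr pair_bigA /=; apply: eq_bigr => y _.
have e := lift_mod_form N0 (comb y).
rewrite (per1 _ _ (dvdl _ _ e)) (per2 _ _ (dvdr _ _ e)) (per1 _ _ (comb1 y)) (per2 _ _ (comb2 y)).
rewrite inv1 1?coprime_sym // inv2 //.
rewrite (ez_periodic _ N0 (pairz_congf h e)) /comb pairz_add !pairz_scale4 ezD.
have h1 : ez R (N1 * N2) (N2%:Z * pairz h (lift_form y.1)) = ez R N1 (pairz h (lift_form y.1)).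
  by congr expi; rewrite intrM natrM -pmulrn; field; rewrite !pnatr_eq0 -!lt0n N10 N20.
have h2 : ez R (N1 * N2) (N1%:Z * pairz h (lift_form y.2)) = ez R N2 (pairz h (lift_form y.2)).
  by congr expi; rewrite intrM natrM -pmulrn; field; rewrite !pnatr_eq0 -!lt0n N10 N20.
by rewrite h1 h2; ring.
Qed.
End Fourier.

(** * Double roots modulo p^2 and their dual lattices *)

Section LocalRoots.
Variable p : nat.
Hypothesis pp : prime p.

(* [r] runs over the projective line over F_p: [Some t] is the point (1 : t), and [None] is (0 : 1). *)
Definition double_root (r : option 'I_p) (f : form int) : bool :=
  let: (y1, y2, y3, y4) := f in
  if r is Some t then
    ((p ^ 2)%N %| y1 + y2 * t%:Z + y3 * t%:Z ^+ 2 + y4 * t%:Z ^+ 3)%Z &&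
    (p %| y2 + 2 * y3 * t%:Z + 3 * y4 * t%:Z ^+ 2)%Z
  else ((p ^ 2)%N %| y4)%Z && (p %| y3)%Z.

(* Modulo p^2, [orthL r] is dual to the lattice of forms with a double root at r, and [orthM r] to that of the
   forms which are moreover divisible by p. *)
Definition orthL (r : option 'I_p) (h : form int) : bool :=
  let: (a, b, c, d) := h in
  if r is Some t then
    [&& (p %| d * t%:Z + c)%Z, ((p ^ 2)%N %| d * t%:Z ^+ 2 + 2 * c * t%:Z + b)%Z &
        ((p ^ 2)%N %| c * t%:Z ^+ 2 + 2 * b * t%:Z + a)%Z]
  else [&& (p %| b)%Z, ((p ^ 2)%N %| c)%Z & ((p ^ 2)%N %| d)%Z].

Definition orthM (r : option 'I_p) (h : form int) : bool :=
  let: (a, b, c, d) := h in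
  if r is Some t then [&& (p %| d * t%:Z + c)%Z, (p %| c * t%:Z + b)%Z & (p %| b * t%:Z + a)%Z]
  else [&& (p %| b)%Z, (p %| c)%Z & (p %| d)%Z].

Let p0 : p%:Z != 0. Proof. by rewrite -lt0n prime_gt0. Qed.

Let p2E : (p ^ 2)%N%:Z = p%:Z ^+ 2. Proof. by rewrite -mulnn PoszM. Qed.

Lemma ord_diff_coprime (t t' : 'I_p) : t != t' -> coprimez (t%:Z - t'%:Z) p.
Proof.
move=> ne; rewrite coprimezE /= coprime_sym prime_coprime //.
apply: contra ne; rewrite -[(p %| _)%N]/((p%:Z %| t%:Z - t'%:Z)%Z).
by rewrite -eqz_mod_dvd !modz_small ?ltz_nat ?ltn_ord // => /eqP [] /val_inj ->.
Qed.

Lemma dvdp2_p (z : int) : ((p ^ 2)%N %| z)%Z -> (p %| z)%Z.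
Proof. by rewrite !dvdzE; apply: dvdn_trans; rewrite /= dvdn_exp. Qed.

(** Modulo p such h is proportional to (- t^3, t^2, - t, 1), or to (1, 0, 0, 0) at infinity, and the
    Hessian of these vanishes. *)
Lemma orthM_hcont r h : orthM r h -> (p %| hcont h)%N.
Proof.
case: h => [[[a b] c] d]; rewrite dvdn_hcont; case: r => [t|] /=.
  case/and3P => /dvdzP[u hu] /dvdzP[v hv] /dvdzP[w hw].
  apply/and3P; split; apply/dvdzP.
  - exists (b * v - c * w); rewrite mulrBl -!mulrA -hv -hw; ring.
  - exists (b * u - d * w); rewrite mulrBl -!mulrA -hu -hw; ring.
  - exists (c * u - d * v); rewrite mulrBl -!mulrA -hu -hv; ring.
case/and3P => /dvdzP[u ->] /dvdzP[v ->] /dvdzP[w ->]; apply/and3P; split; apply/dvdzP.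
- by exists (u ^+ 2 * p%:Z - a * v); ring.
- by exists (u * v * p%:Z - a * w); ring.
- by exists (v ^+ 2 * p%:Z - u * w * p%:Z); ring.
Qed.

Lemma orthL_hcont r h : orthL r h -> (p ^ 2 %| hcont h)%N.
Proof.
case: h => [[[a b] c] d]; rewrite dvdn_hcont; case: r => [t|] /=; rewrite p2E.
  case/and3P => /dvdzP[u hu] /dvdzP[v hv] /dvdzP[w hw].
  move: (t%:Z) (p%:Z) hu hv hw => T P hu hv hw.
  have ec : c = u * P - d * T by rewrite -hu; ring.
  have eb : b = v * P ^+ 2 - 2 * u * P * T + d * T ^+ 2 by rewrite -hv ec; ring.
  have ea : a = w * P ^+ 2 - 2 * v * P ^+ 2 * T + 3 * u * P * T ^+ 2 - d * T ^+ 3.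
    by rewrite -hw eb ec; ring.
  rewrite ea eb ec; apply/and3P; split; apply/dvdzP.
  - exists (v ^+ 2 * P ^+ 2 + u ^+ 2 * T ^+ 2 - 2 * u * v * P * T - u * w * P + d * w * T); ring.
  - exists (u * v * P + d * T * v - 2 * u ^+ 2 * T - d * w); ring.
  - exists (u ^+ 2 - d * v); ring.
case/and3P => /dvdzP[u ->] /dvdzP[v ->] /dvdzP[w ->]; apply/and3P; split; apply/dvdzP.
- by exists (u ^+ 2 - a * v); ring.
- by exists (u * v * p%:Z - a * w); ring.
- by exists (v ^+ 2 * p%:Z ^+ 2 - u * w * p%:Z); ring.
Qed.

Lemma mul_diff_dvdz (t t' : 'I_p) (k : nat) (z : int) : t != t' ->
  ((p ^ k)%N %| z * (t%:Z - t'%:Z))%Z -> ((p ^ k)%N %| z)%Z.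
Proof.
move=> ne; rewrite mulrC Gauss_dvdzr //.
have := ord_diff_coprime ne; rewrite !coprimezE /= => c; by rewrite coprime_sym coprimeXr.
Qed.

Lemma orthM_uniq r r' h : r != r' -> orthM r h -> orthM r' h -> dvdf p h.
Proof.
wlog: r r' / r' != None :> option 'I_p.
  move=> H ne o o'; case: (r' =P None) => [e|/eqP n]; last exact: H ne o o'.
  by apply: (H r' r) => //; [rewrite -e|rewrite eq_sym].
case: r' => // t' _; case: h => [[[a b] c] d]; case: r => [t|] ne /and3P[h1 h2 h3] /and3P[k1 k2 k3].
  have {}ne : t != t' by [].
  have E (x y : int) : (p %| x * t%:Z + y)%Z -> (p %| x * t'%:Z + y)%Z -> (p %| x)%Z /\ (p %| y)%Z.
    move=> u v; have dx : (p %| x)%Z.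
      apply: (@mul_diff_dvdz t t' 1) => //.
      have -> : x * (t%:Z - t'%:Z) = (x * t%:Z + y) - (x * t'%:Z + y) by ring.
      exact: rpredB.
    split=> //; have -> : y = (x * t%:Z + y) - x * t%:Z by ring.
    by rewrite rpredB // dvdz_mulr.
  have [d0 c0] := E _ _ h1 k1; have [_ b0] := E _ _ h2 k2; have [_ a0] := E _ _ h3 k3.
  by rewrite /= a0 b0 c0 d0.
rewrite /= h1 h2 h3 !andbT.
have -> : a = (b * t'%:Z + a) - b * t'%:Z by ring.
by rewrite rpredB // dvdz_mulr.
Qed.

Let dvdz_rem (m : nat) (x y : int) : (m %| x)%Z -> (m %| x + y)%Z -> (m %| y)%Z.
Proof. by move=> hx hxy; rewrite -(addKr x y) rpredD ?rpredN. Qed.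

Lemma orthL_uniq r r' h : r != r' -> orthL r h -> orthL r' h -> dvdf (p ^ 2) h.
Proof.
wlog: r r' / r' != None :> option 'I_p.
  move=> H ne o o'; case: (r' =P None) => [e|/eqP n]; last exact: H ne o o'.
  by apply: (H r' r) => //; [rewrite -e|rewrite eq_sym].
case: r' => // t' _; case: h => [[[a b] c] d]; case: r => [t|] ne /and3P[h1 h2 h3] /and3P[k1 k2 k3].
  have {}ne : t != t' by [].
  have {}h1 : (p %| d * t%:Z + c)%Z by [].
  have {}k1 : (p %| d * t'%:Z + c)%Z by [].
  have d1 : (p %| d)%Z.
    apply: (@mul_diff_dvdz t t' 1) => //.
    have -> : d * (t%:Z - t'%:Z) = (d * t%:Z + c) - (d * t'%:Z + c) by ring.
    exact: rpredB.
  have c1 : (p %| c)%Z.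
    have -> : c = (d * t%:Z + c) - d * t%:Z by ring.
    by rewrite rpredB // dvdz_mulr.
  have e1 : ((p ^ 2)%N %| d * (t%:Z + t'%:Z) + 2 * c)%Z.
    apply: (mul_diff_dvdz ne).
    have -> : (d * (t%:Z + t'%:Z) + 2 * c) * (t%:Z - t'%:Z) =
      (d * t%:Z ^+ 2 + 2 * c * t%:Z + b) - (d * t'%:Z ^+ 2 + 2 * c * t'%:Z + b) by ring.
    exact: rpredB.
  have e2 : ((p ^ 2)%N %| c * (t%:Z + t'%:Z) + 2 * b)%Z.
    apply: (mul_diff_dvdz ne).
    have -> : (c * (t%:Z + t'%:Z) + 2 * b) * (t%:Z - t'%:Z) =
      (c * t%:Z ^+ 2 + 2 * b * t%:Z + a) - (c * t'%:Z ^+ 2 + 2 * b * t'%:Z + a) by ring.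
    exact: rpredB.
  have cd : ((p ^ 2)%N %| c + d * t'%:Z)%Z.
    apply: (mul_diff_dvdz ne).
    have -> : (c + d * t'%:Z) * (t%:Z - t'%:Z) =
      (c * (t%:Z + t'%:Z) + 2 * b) - 2 * (d * t%:Z ^+ 2 + 2 * c * t%:Z + b)
      + (2 * t%:Z - t'%:Z) * (d * (t%:Z + t'%:Z) + 2 * c) by ring.
    by rewrite rpredD ?rpredB // dvdz_mull.
  have d2 : ((p ^ 2)%N %| d)%Z.
    apply: (mul_diff_dvdz ne).
    have -> : d * (t%:Z - t'%:Z) = (d * (t%:Z + t'%:Z) + 2 * c) - 2 * (c + d * t'%:Z) by ring.
    by rewrite rpredB // dvdz_mull.
  have c2 : ((p ^ 2)%N %| c)%Z.
    have -> : c = (c + d * t'%:Z) - d * t'%:Z by ring.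
    by rewrite rpredB // dvdz_mulr.
  have b2 : ((p ^ 2)%N %| b)%Z by apply: dvdz_rem k2; rewrite rpredD ?(dvdz_mulr _ d2) // -mulrA dvdz_mull ?dvdz_mulr.
  by rewrite /= b2 c2 d2 !andbT; apply: dvdz_rem k3; rewrite rpredD ?(dvdz_mulr _ c2) // -mulrA dvdz_mull ?dvdz_mulr.
have b2 : ((p ^ 2)%N %| b)%Z.
  by apply: dvdz_rem k2; rewrite rpredD ?(dvdz_mulr _ h3) // -mulrA dvdz_mull ?dvdz_mulr.
rewrite /= b2 h2 h3 !andbT; apply: dvdz_rem k3.
by rewrite rpredD ?(dvdz_mulr _ h2) // -mulrA dvdz_mull ?dvdz_mulr.
Qed.

(** The multiplicities of two distinct double roots would add up to 4, too many for a nonzero cubic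
    form over F_p. *)
Lemma double_root_uniq r r' f : r != r' -> double_root r f -> double_root r' f -> dvdf p f.
Proof.
wlog: r r' / r' != None :> option 'I_p.
  move=> H ne o o'; case: (r' =P None) => [e|/eqP n]; last exact: H ne o o'.
  by apply: (H r' r) => //; [rewrite -e|rewrite eq_sym].
case: r' => // t' _; case: f => [[[a b] c] d]; case: r => [t|] ne /andP[/dvdp2_p h1 h2] /andP[/dvdp2_p k1 k2].
  have {}ne : t != t' by [].
  have div z : (p %| z * (t%:Z - t'%:Z))%Z -> (p %| z)%Z by exact: (@mul_diff_dvdz t t' 1).
  have e : (p %| b + c * (t%:Z + t'%:Z) + d * (t%:Z ^+ 2 + t%:Z * t'%:Z + t'%:Z ^+ 2))%Z.
    apply: div.
    have -> : (b + c * (t%:Z + t'%:Z) + d * (t%:Z ^+ 2 + t%:Z * t'%:Z + t'%:Z ^+ 2)) * (t%:Z - t'%:Z) =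
      (a + b * t%:Z + c * t%:Z ^+ 2 + d * t%:Z ^+ 3) - (a + b * t'%:Z + c * t'%:Z ^+ 2 + d * t'%:Z ^+ 3).
      by ring.
    exact: rpredB.
  have e1 : (p %| c + d * (t%:Z + 2 * t'%:Z))%Z.
    apply: div; move: (rpredB e k2); congr (_ %| _)%Z; ring.
  have e2 : (p %| c + d * (2 * t%:Z + t'%:Z))%Z.
    apply: div; move: (rpredB h2 e); congr (_ %| _)%Z; ring.
  have d0 : (p %| d)%Z by apply: div; move: (rpredB e2 e1); congr (_ %| _)%Z; ring.
  have c0 : (p %| c)%Z by move: e1; rewrite rpredDr // dvdz_mulr.
  have b0 : (p %| b)%Z.
    by move: e; rewrite rpredDr ?dvdz_mulr // rpredDr // dvdz_mulr.
  by rewrite /= b0 c0 d0 !andbT; move: h1; do 3?[rewrite rpredDr ?dvdz_mulr //].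
have b0 : (p %| b)%Z.
  move: k2; rewrite -addrA rpredDr // rpredD //; last by rewrite -mulrA dvdz_mull ?dvdz_mulr.
  by rewrite -mulrA dvdz_mull ?dvdz_mulr.
by rewrite /= b0 h1 h2 !andbT; move: k1; do 3?[rewrite rpredDr ?dvdz_mulr //].
Qed.

End LocalRoots.

Section Nonmaximal.
Variable p : nat.
Hypothesis pp : prime p.

Lemma double_rootD r f v : double_root r v -> @double_root p r (addf f v) = double_root r f.
Proof.
case: f => [[[a b] c] d]; case: v => [[[a' b'] c'] d']; case: r => [t|] /andP[h1 h2]; rewrite /double_root /addf.
  have -> : a + a' + (b + b') * t%:Z + (c + c') * t%:Z ^+ 2 + (d + d') * t%:Z ^+ 3 =
    (a + b * t%:Z + c * t%:Z ^+ 2 + d * t%:Z ^+ 3) + (a' + b' * t%:Z + c' * t%:Z ^+ 2 + d' * t%:Z ^+ 3) by ring.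
  have -> : b + b' + 2 * (c + c') * t%:Z + 3 * (d + d') * t%:Z ^+ 2 =
    (b + 2 * c * t%:Z + 3 * d * t%:Z ^+ 2) + (b' + 2 * c' * t%:Z + 3 * d' * t%:Z ^+ 2) by ring.
  by congr andb; apply: rpredDr.
by congr andb; apply: rpredDr.
Qed.

Lemma dvdfD m f v : dvdf m v -> dvdf m (addf f v) = dvdf m f.
Proof.
case: f => [[[a b] c] d]; case: v => [[[a' b'] c'] d'] /and4P[h1 h2 h3 h4].
by rewrite /dvdf /addf !rpredDr.
Qed.

Lemma congf_addf N f g : congf N f g -> exists v, f = addf g (scale4 N v).
Proof.
case: f => [[[a b] c] d]; case: g => [[[a' b'] c'] d'] [].
move=> /dvdzP[k1 h1] /dvdzP[k2 h2] /dvdzP[k3 h3] /dvdzP[k4 h4].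
exists (k1, k2, k3, k4); rewrite /= ![N%:Z * _]mulrC -h1 -h2 -h3 -h4.
by congr (_, _, _, _); ring.
Qed.

Lemma double_root_scale4 r f : @double_root p r (scale4 (p ^ 2)%N f).
Proof.
have h (x : int) : (p %| (p ^ 2)%N%:Z * x)%Z by rewrite dvdz_mulr // dvdzE /= dvdn_exp.
case: f => [[[a b] c] d]; case: r => [t|]; rewrite /double_root /scale4; last by rewrite dvdz_mulr // h.
have -> : (p ^ 2)%N%:Z * a + (p ^ 2)%N%:Z * b * t%:Z + (p ^ 2)%N%:Z * c * t%:Z ^+ 2 + (p ^ 2)%N%:Z * d * t%:Z ^+ 3 =
  (p ^ 2)%N%:Z * (a + b * t%:Z + c * t%:Z ^+ 2 + d * t%:Z ^+ 3) by ring.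
have -> : (p ^ 2)%N%:Z * b + 2 * ((p ^ 2)%N%:Z * c) * t%:Z + 3 * ((p ^ 2)%N%:Z * d) * t%:Z ^+ 2 =
  (p ^ 2)%N%:Z * (b + 2 * c * t%:Z + 3 * d * t%:Z ^+ 2) by ring.
by rewrite h dvdz_mulr.
Qed.

Lemma double_root_periodic r : periodic_form (p ^ 2) (@double_root p r).
Proof. by move=> f g /congf_addf[v ->]; rewrite double_rootD // double_root_scale4. Qed.

Lemma dvdf_periodic : periodic_form (p ^ 2) (dvdf p).
Proof.
move=> f g /congf_addf[v ->]; rewrite dvdfD //; case: v => [[[a b] c] d] /=.
by rewrite !dvdz_mulr // dvdzE /= dvdn_exp.
Qed.

Lemma dvdf_unit : unit_invariant (p ^ 2) (dvdf p).
Proof.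
move=> m [[[a b] c] d] cop; rewrite /= !coprime_dvdz_mull //;
by move: cop; rewrite coprime_pexpr // coprime_sym.
Qed.

Lemma double_root_unit r : unit_invariant (p ^ 2) (@double_root p r).
Proof.
move=> m [[[a b] c] d] cop2.
have cop : coprime p m by move: cop2; rewrite coprime_pexpr // coprime_sym.
rewrite coprime_sym in cop2.
case: r => [t|]; rewrite /double_root /scale4; last by rewrite !coprime_dvdz_mull.
have -> : m%:Z * a + m%:Z * b * t%:Z + m%:Z * c * t%:Z ^+ 2 + m%:Z * d * t%:Z ^+ 3 =
  m%:Z * (a + b * t%:Z + c * t%:Z ^+ 2 + d * t%:Z ^+ 3) by ring.
have -> : m%:Z * b + 2 * (m%:Z * c) * t%:Z + 3 * (m%:Z * d) * t%:Z ^+ 2 =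
  m%:Z * (b + 2 * c * t%:Z + 3 * d * t%:Z ^+ 2) by ring.
by rewrite !coprime_dvdz_mull.
Qed.

Definition nonmax (f : form int) : bool := dvdf p f || [exists r, @double_root p r f].

Lemma nonmax_periodic : periodic_form (p ^ 2) nonmax.
Proof.
move=> f g fg; rewrite /nonmax (dvdf_periodic fg); congr orb.
by apply: eq_existsb => r; rewrite (double_root_periodic r fg).
Qed.

Lemma nonmax_unit : unit_invariant (p ^ 2) nonmax.
Proof.
move=> m f cop; rewrite /nonmax dvdf_unit //; congr orb.
by apply: eq_existsb => r; rewrite double_root_unit.
Qed.

(** Inclusion-exclusion stops early: a form not divisible by p has at most one double root, and on
    forms divisible by p the two sums cancel. *)
Lemma nonmax_decomp (R : pzRingType) f : (nonmax f)%:R =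
  \sum_(r : option 'I_p) (double_root r f)%:R - \sum_(r : option 'I_p) (double_root r f && dvdf p f)%:R
  + (dvdf p f)%:R :> R.
Proof.
rewrite /nonmax; case df: (dvdf p f) => /=.
  rewrite (eq_bigr (fun r => (double_root r f && true)%:R)) ?subrr ?add0r // => r _.
  by rewrite andbT.
rewrite addr0 [X in _ - X]big1 ?subr0 => [|r _]; last by rewrite andbF.
case: existsP => [[r0 h0]|h]; last first.
  by rewrite big1 // => r _; case E: (double_root r f) => //; case: h; exists r.
rewrite (bigD1 r0) //= h0 big1 ?addr0 // => r ne; case E: (double_root r f) => //.
by have := double_root_uniq pp ne E h0; rewrite df.
Qed.

End Nonmaximal.

(** By Euler's relation, f at (r, s) and its derivative along (t, w) vanishing modulo p make both
    partial derivatives vanish modulo p. Moving (r, s) by a multiple of p then changes f by a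
    multiple of p^2, so the row may be replaced by the standard representative of its point. *)
Lemma row_root (p : nat) (a b c d r s t w e : int) : prime p -> r * w - s * t = e -> e ^+ 2 = 1 ->
  ((p ^ 2)%N %| a * r ^+ 3 + b * r ^+ 2 * s + c * r * s ^+ 2 + d * s ^+ 3)%Z ->
  (p %| 3 * a * r ^+ 2 * t + b * (r ^+ 2 * w + 2 * r * s * t)
     + c * (2 * r * s * w + s ^+ 2 * t) + 3 * d * s ^+ 2 * w)%Z ->
  exists i : option 'I_p, double_root i (a, b, c, d).
Proof.
move=> pp he e2 h1 h2.
have p2E : (p ^ 2)%N%:Z = p%:Z ^+ 2 by rewrite -mulnn PoszM.
have h1p := dvdp2_p h1.
have unit (z : int) : (p %| e * z)%Z -> (p %| z)%Z.
  by move=> h; rewrite -[z]mul1r -e2 expr2 -mulrA dvdz_mull.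
have [pr|pr] := boolP (p %| r)%Z.
  have ps : ~~ (p %| s)%Z.
    apply/negP => ps; have : (p %| e * e)%Z by rewrite -he !(rpredB, dvdz_mulr).
    by rewrite -expr2 e2 dvdz1 /= => /eqP p1; move: pp; rewrite p1.
  have cs (k : nat) (z : int) : ((p ^ k)%N %| s * z)%Z -> ((p ^ k)%N %| z)%Z.
    rewrite Gauss_dvdzr // coprimezE /=; apply: coprimeXl.
    by rewrite prime_coprime // -[(p %| _)%N]/((p %| s)%Z).
  have pfu : (p %| 3 * a * r ^+ 2 + 2 * b * r * s + c * s ^+ 2)%Z.
    apply: unit; rewrite -he.
    move: (rpredB (dvdz_mull (3 * w) h1p) (dvdz_mull s h2)); congr (_ %| _)%Z; ring.
  have pc : (p %| c)%Z.
    apply: (cs 1%N); apply: (cs 1%N); have [k hk] := dvdzP pr.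
    move: (rpredB pfu (dvdz_mull (3 * a * r + 2 * b * s) pr)); congr (_ %| _)%Z; ring.
  exists None; apply/andP; split=> //.
  have [k hk] := dvdzP pr; have [l hl] := dvdzP pc.
  do 3!apply: (cs 2); move: h1; rewrite hk hl p2E => h1.
  have h3 : (p%:Z ^+ 2 %| p%:Z ^+ 2 * (a * k ^+ 3 * p%:Z + b * k ^+ 2 * s + l * k * s ^+ 2))%Z by rewrite dvdz_mulr.
  move: (rpredB h1 h3); congr (_ %| _)%Z; ring.
have cr (k : nat) (z : int) : ((p ^ k)%N %| r * z)%Z -> ((p ^ k)%N %| z)%Z.
  rewrite Gauss_dvdzr // coprimezE /=; apply: coprimeXl.
  by rewrite prime_coprime // -[(p %| _)%N]/((p %| r)%Z).
have pfv : (p %| b * r ^+ 2 + 2 * c * r * s + 3 * d * s ^+ 2)%Z.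
  apply: unit; rewrite -he.
  move: (rpredB (dvdz_mull r h2) (dvdz_mull (3 * t) h1p)); congr (_ %| _)%Z; ring.
have [m hm] : exists m : 'I_p, (p %| s - r * m%:Z)%Z.
  have /coprimezP[[u v] /= huv] : coprimez r p.
    by rewrite coprimezE /= coprime_sym prime_coprime // -[(p %| _)%N]/((p %| r)%Z).
  exists (mod_ord (prime_gt0 pp) (u * s)); rewrite mod_ordE.
  have hq := divz_eq (u * s) p.
  apply/dvdzP; exists (v * s + r * (u * s %/ p)%Z).
  have -> : ((u * s) %% p)%Z = u * s - (u * s %/ p)%Z * p by rewrite [X in X - _]hq addrAC subrr add0r.
  transitivity (s * (u * r + v * p) - r * (u * s) + r * (u * s %/ p)%Z * p); [by rewrite huv; ring|ring].
have [k hk] := dvdzP hm.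
have es : s = r * m%:Z + k * p by rewrite -hk; ring.
have pB : (p %| b * r ^+ 2 + 2 * c * r * (r * m%:Z) + 3 * d * (r * m%:Z) ^+ 2)%Z.
  move: (rpredB pfv (dvdz_mull (2 * c * r * k + 3 * d * k * (2 * r * m%:Z + k * p%:Z)) (dvdzz p))).
  by rewrite es; congr (_ %| _)%Z; ring.
exists (Some m); apply/andP; split; last first.
  apply: (cr 1%N); apply: (cr 1%N); move: pB; congr (_ %| _)%Z; ring.
do 3!apply: (cr 2).
have [l hl] := dvdzP pB.
have h3 : ((p ^ 2)%N %| p%:Z ^+ 2 * (k * l + (c * r + 3 * d * r * m%:Z) * k ^+ 2 + d * k ^+ 3 * p%:Z))%Z.
  by rewrite p2E dvdz_mulr.
move: (rpredB h1 h3); congr (_ %| _)%Z.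
have -> : p%:Z ^+ 2 * (k * l + (c * r + 3 * d * r * m%:Z) * k ^+ 2 + d * k ^+ 3 * p%:Z) =
  k * p%:Z * (l * p%:Z) + p%:Z ^+ 2 * ((c * r + 3 * d * r * m%:Z) * k ^+ 2 + d * k ^+ 3 * p%:Z) by ring.
by rewrite -hl es; ring.
Qed.

Definition mx22 (r s t w : int) : 'M[int]_2 :=
  \matrix_(i, j) (if i == 0 then (if j == 0 then r else s) else (if j == 0 then t else w)).

Lemma mx22E r s t w : [/\ mx22 r s t w 0 0 = r, mx22 r s t w 0 1 = s, mx22 r s t w 1 0 = t & mx22 r s t w 1 1 = w].
Proof. by split; rewrite mxE. Qed.

Lemma det_int2 (g : 'M[int]_2) : \det g = g 0 0 * g 1 1 - g 0 1 * g 1 0.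
Proof.
rewrite (expand_det_row _ 0) !big_ord_recl big_ord0 /cofactor !det_mx11 !mxE /= addr0 !expr0 expr1 !mul1r mulN1r mulrN.
by congr (g _ _ * g _ _ - g _ _ * g _ _); apply/val_inj.
Qed.

Lemma nonmaxP (p : nat) f : prime p -> ~ U p f <-> nonmax p f.
Proof.
move=> pp; split.
  move=> nU; apply/negPn/negP => nm; apply: nU; move: nm; rewrite /nonmax negb_or => /andP[nd nr].
  split; first by case: f nd {nr} => [[[a b] c] d] nd; exact/negP.
  move=> [g]; rewrite unitmxE; case: f nr {nd} => [[[a b] c] d] /existsP nr ug /andP[h1 h2].
  apply: nr; apply: (row_root pp _ _ h1 h2); first exact: erefl.
  have [h hh] : exists h : int, h * (g 0 0 * g 1 1 - g 0 1 * g 1 0) = 1.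
    by exists (\det g)^-1; rewrite -det_int2 mulVr.
  move: (_ - _) hh => e he; have /eqP := congr1 absz he; rewrite abszM muln_eq1 => /andP[_ /eqP e1].
  by rewrite -[e ^+ 2]real_normK ?num_real // -abszE e1.
move=> /orP[df|/existsP[r hr]] [h1 h2]; first by case: f df h1 {h2} => [[[a b] c] d] df; case.
apply: h2; case: f hr {h1} => [[[a b] c] d]; case: r => [t|] /andP[k1 k2].
  have [e1 e2 e3 e4] := mx22E 1 t%:Z 0 1.
  exists (mx22 1 t%:Z 0 1); first by rewrite unitmxE det_int2 e1 e2 e3 e4 mulr0 subr0 mulr1 unitr1.
  rewrite /act e1 e2 e3 e4; apply/andP; split.
    by move: k1; congr (_ %| _)%Z; ring.
  by move: k2; congr (_ %| _)%Z; ring.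
have [e1 e2 e3 e4] := mx22E 0 1 1 0.
exists (mx22 0 1 1 0); first by rewrite unitmxE det_int2 e1 e2 e3 e4 mulr0 sub0r mulr1 unitrN unitr1.
rewrite /act e1 e2 e3 e4; apply/andP; split.
  by move: k1; congr (_ %| _)%Z; ring.
by move: k2; congr (_ %| _)%Z; ring.
Qed.

(** * Local Fourier bounds *)

Section Counting.
Variable p : nat.
Hypothesis pp : prime p.
Local Notation N := (p ^ 2)%N.

Let p0 : (0 < p)%N. Proof. exact: prime_gt0. Qed.
Let N0 : (0 < N)%N. Proof. by rewrite expn_gt0 p0. Qed.

Lemma ord_div_subproof (i : 'I_N) : (i %/ p < p)%N.
Proof. by rewrite ltn_divLR // mulnn. Qed.

Definition ord_div (i : 'I_N) : 'I_p := Ordinal (ord_div_subproof i).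

Lemma ord_congr (i j : 'I_N) : (N %| i%:Z - j%:Z)%Z -> i = j.
Proof.
by rewrite -eqz_mod_dvd !modz_small ?ltz_nat ?ltn_ord // => /eqP [] /val_inj.
Qed.

Lemma ord_div_inj (i j : 'I_N) : (p %| i%:Z - j%:Z)%Z -> ord_div i = ord_div j -> i = j.
Proof.
rewrite -eqz_mod_dvd !modz_nat eqz_nat => /eqP h /(congr1 val) /= e.
by apply: val_inj; rewrite /= (divn_eq i p) (divn_eq j p) e h.
Qed.

Lemma ord_div_inj0 (i j : 'I_N) : (p %| i%:Z)%Z -> (p %| j%:Z)%Z -> ord_div i = ord_div j -> i = j.
Proof. by move=> hi hj; apply: ord_div_inj; exact: rpredB. Qed.

Lemma card_le_inj (T T' : finType) (A : {set T}) (f : T -> T') :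
  {in A &, injective f} -> (#|A| <= #|T'|)%N.
Proof. by move=> inj; rewrite -(card_in_imset inj) max_card. Qed.

Lemma card_dvdf : (#|[set y : form 'I_N | dvdf p (lift_form y)]%SET| <= p ^ 4)%N.
Proof.
pose F (y : form 'I_N) := let: (a, b, c, d) := y in (ord_div a, ord_div b, ord_div c, ord_div d).
have -> : (p ^ 4 = #|{: 'I_p * 'I_p * 'I_p * 'I_p}|)%N by rewrite !card_prod !card_ord; ring.
apply: (card_le_inj (f := F)) => -[[[a b] c] d] [[[a' b'] c'] d'].
rewrite !inE => /and4P[h1 h2 h3 h4] /and4P[k1 k2 k3 k4] [e1 e2 e3 e4].
by congr (_, _, _, _); apply: ord_div_inj0 => //; apply: val_inj.
Qed.

(** At a finite root the third and fourth coefficients are free, the derivative fixes the second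
    modulo p, and the value fixes the first. *)
Lemma card_double_root r : (#|[set y : form 'I_N | double_root (p := p) r (lift_form y)]%SET| <= p ^ 5)%N.
Proof.
pose F (y : form 'I_N) := let: (a, b, c, d) := y in
  if r is Some _ then (ord_div b, c, d) else (ord_div c, a, b).
have -> : (p ^ 5 = #|{: 'I_p * 'I_N * 'I_N}|)%N by rewrite !card_prod !card_ord; ring.
apply: (card_le_inj (f := F)) => -[[[a b] c] d] [[[a' b'] c'] d'].
rewrite !inE /F; case: r {F} => [t|] /andP[h1 h2] /andP[k1 k2] [e1 e2 e3].
  have ec : c = c' by [].
  have ed : d = d' by [].
  have eb : b = b'.
    apply: ord_div_inj; last exact: val_inj.
    by move: (rpredB h2 k2); rewrite ec ed; congr (_ %| _)%Z; ring.
  have -> : a = a'; last by rewrite eb ec ed.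
  apply: ord_congr; move: (rpredB h1 k1); rewrite eb ec ed; congr (_ %| _)%Z; ring.
have ea : a = a' by [].
have eb : b = b' by [].
rewrite ea eb; congr (_, _, _, _); first by apply: ord_div_inj0 => //; apply: val_inj.
by apply: ord_congr; exact: rpredB.
Qed.

Lemma card_double_root_dvdf r :
  (#|[set y : form 'I_N | double_root (p := p) r (lift_form y) && dvdf p (lift_form y)]%SET| <= p ^ 3)%N.
Proof.
pose F (y : form 'I_N) := let: (a, b, c, d) := y in
  if r is Some _ then (ord_div b, ord_div c, ord_div d) else (ord_div a, ord_div b, ord_div c).
have -> : (p ^ 3 = #|{: 'I_p * 'I_p * 'I_p}|)%N by rewrite !card_prod !card_ord; ring.
apply: (card_le_inj (f := F)) => -[[[a b] c] d] [[[a' b'] c'] d'].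
rewrite !inE /F => /andP[h /and4P[h1 h2 h3 h4]] /andP[k /and4P[k1 k2 k3 k4]].
case: r {F} h k => [t|] /andP[u1 u2] /andP[v1 v2] [e1 e2 e3].
  have eb : b = b' by apply: ord_div_inj0 => //; apply: val_inj.
  have ec : c = c' by apply: ord_div_inj0 => //; apply: val_inj.
  have ed : d = d' by apply: ord_div_inj0 => //; apply: val_inj.
  have -> : a = a'; last by rewrite eb ec ed.
  apply: ord_congr; move: (rpredB u1 v1); rewrite eb ec ed; congr (_ %| _)%Z; ring.
have -> : d = d' by apply: ord_congr; exact: rpredB.
by congr (_, _, _, _); apply: ord_div_inj0 => //; apply: val_inj.
Qed.

Variable R : realType.
Local Notation ind b := (fun f : form int => (b f)%:R : R[i]).

(** Applied to indicators of lattices, whose transform is the number of points on the dual lattice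
    and 0 elsewhere, so the trivial bound loses nothing. *)
Lemma FT_bound (b : form int -> bool) h (o : bool) (m : nat) :
  (#|[set y : form 'I_N | b (lift_form y)]%SET| <= m)%N ->
  (FT N (ind b) h != 0 -> o) -> `|FT N (ind b) h| <= (m * o)%:R.
Proof.
move=> hm ho; have [e|/ho ->] := eqVneq (FT N (ind b) h) 0; first by rewrite e normr0.
by rewrite muln1; apply: le_trans (FT_norm R N b h) _; rewrite ler_nat.
Qed.

Let pN (z : int) : (N %| p%:Z * z)%Z -> (p %| z)%Z.
Proof. by rewrite -mulnn PoszM dvdz_mul2l // eqz_nat -lt0n. Qed.

Lemma FT_dvdf h : `|FT N (ind (dvdf p)) h| <= (p ^ 4 * dvdf p h)%:R.
Proof.
apply: FT_bound; first exact: card_dvdf.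
move=> F0.
have per : periodic_form N (ind (dvdf p)) by move=> f g fg; rewrite (dvdf_periodic fg).
have orth v : dvdf p v -> (N %| pairz h v)%Z.
  by move=> hv; apply: (FT_orthogonal N0 per _ F0) => f; rewrite dvdfD.
case: h {F0} orth => [[[a b] c] d] orth.
have pp' := dvdzz p.
apply/and4P; split; apply: pN.
- by have /orth : dvdf p (0, 0, 0, - p%:Z); [rewrite /= ?rpredN !dvdz0 pp'|congr (_ %| _)%Z; rewrite /=; ring].
- by have /orth : dvdf p (0, 0, p%:Z, 0); [rewrite /= ?rpredN !dvdz0 pp'|congr (_ %| _)%Z; rewrite /=; ring].
- by have /orth : dvdf p (0, - p%:Z, 0, 0); [rewrite /= ?rpredN !dvdz0 pp'|congr (_ %| _)%Z; rewrite /=; ring].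
- by have /orth : dvdf p (p%:Z, 0, 0, 0); [rewrite /= ?rpredN !dvdz0 pp'|congr (_ %| _)%Z; rewrite /=; ring].
Qed.

(** The three test forms at each r generate the lattice of forms with a double root at r modulo p^2;
    each gives one condition of [orthL]. *)
Lemma FT_double_root r h : `|FT N (ind (double_root (p := p) r)) h| <= (p ^ 5 * orthL r h)%:R.
Proof.
apply: FT_bound; first exact: card_double_root.
move=> F0.
have per : periodic_form N (ind (double_root (p := p) r)).
  by move=> f g fg; rewrite (double_root_periodic r fg).
have orth v : double_root r v -> (N %| pairz h v)%Z.
  by move=> hv; apply: (FT_orthogonal N0 per _ F0) => f; rewrite double_rootD.
have z (m : nat) x : x = 0 -> (m %| x)%Z by move=> ->; exact: dvdz0.
have zp (k x : int) : x = p%:Z * k -> (p %| x)%Z by move=> ->; exact: dvdz_mulr.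
case: h {F0 per} orth => [[[a b] c] d]; case: r => [t|] orth; apply/and3P; split.
- apply: pN; have /orth : double_root (Some t) (p%:Z * t%:Z, - p%:Z, 0, 0).
    by apply/andP; split; [apply: z; ring|apply: (zp (-1)); ring].
  by congr (_ %| _)%Z; rewrite /=; ring.
- have /orth : double_root (Some t) (t%:Z ^+ 2, - (2 * t%:Z), 1, 0).
    by apply/andP; split; apply: z; ring.
  by congr (_ %| _)%Z; rewrite /=; ring.
- have /orth : double_root (Some t) (0, - t%:Z ^+ 2, 2 * t%:Z, - 1).
    by apply/andP; split; apply: z; ring.
  by congr (_ %| _)%Z; rewrite /=; ring.
- by apply: pN; have /orth : double_root (p := p) None (0, 0, p%:Z, 0); [rewrite /= dvdz0 dvdzz|congr (_ %| _)%Z; rewrite /=; ring].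
- by have /orth : double_root (p := p) None (0, -1, 0, 0); [rewrite /= !dvdz0|congr (_ %| _)%Z; rewrite /=; ring].
- by have /orth : double_root (p := p) None (1, 0, 0, 0); [rewrite /= !dvdz0|congr (_ %| _)%Z; rewrite /=; ring].
Qed.

Lemma FT_double_root_dvdf r h :
  `|FT N (ind (fun f => double_root (p := p) r f && dvdf p f)) h| <= (p ^ 3 * orthM r h)%:R.
Proof.
apply: (@FT_bound (fun f => double_root (p := p) r f && dvdf p f)); first exact: card_double_root_dvdf.
move=> F0.
have per : periodic_form N (ind (fun f => double_root (p := p) r f && dvdf p f)).
  by move=> f g fg; rewrite (double_root_periodic r fg) (dvdf_periodic fg).
have orth v : double_root r v && dvdf p v -> (N %| pairz h v)%Z.
  by move=> /andP[hv kv]; apply: (FT_orthogonal N0 per _ F0) => f; rewrite double_rootD // dvdfD.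
have pp' := dvdzz p.
have t0 (t : 'I_p) : (p %| p%:Z * t%:Z)%Z by rewrite dvdz_mulr.
have np : (p %| - p%:Z)%Z by rewrite rpredN.
have z (m : nat) x : x = 0 -> (m %| x)%Z by move=> ->; exact: dvdz0.
have zp (k x : int) : x = p%:Z * k -> (p %| x)%Z by move=> ->; exact: dvdz_mulr.
case: h {F0 per} orth => [[[a b] c] d]; case: r => [t|] orth; apply/and3P; split; apply: pN.
- have /orth : double_root (Some t) (p%:Z * t%:Z, - p%:Z, 0, 0) && dvdf p (p%:Z * t%:Z, - p%:Z, 0, 0).
    rewrite /dvdf t0 np !dvdz0 !andbT; apply/andP; split; first by apply: z; ring.
    by apply: (zp (-1)); ring.
  by congr (_ %| _)%Z; rewrite /=; ring.
- have /orth : double_root (Some t) (0, - (p%:Z * t%:Z), p%:Z, 0) && dvdf p (0, - (p%:Z * t%:Z), p%:Z, 0).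
    rewrite /dvdf rpredN t0 pp' !dvdz0 !andbT; apply/andP; split; first by apply: z; ring.
    by apply: (zp t%:Z); ring.
  by congr (_ %| _)%Z; rewrite /=; ring.
- have /orth : double_root (Some t) (0, 0, p%:Z * t%:Z, - p%:Z) && dvdf p (0, 0, p%:Z * t%:Z, - p%:Z).
    rewrite /dvdf t0 np !dvdz0 !andbT; apply/andP; split; first by apply: z; ring.
    by apply: (zp (- t%:Z ^+ 2)); ring.
  by congr (_ %| _)%Z; rewrite /=; ring.
- by have /orth : double_root (p := p) None (0, 0, p%:Z, 0) && dvdf p (0, 0, p%:Z, 0);
    [rewrite /= !dvdz0 pp'|congr (_ %| _)%Z; rewrite /=; ring].
- by have /orth : double_root (p := p) None (0, - p%:Z, 0, 0) && dvdf p (0, - p%:Z, 0, 0);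
    [rewrite /= !dvdz0 np|congr (_ %| _)%Z; rewrite /=; ring].
- by have /orth : double_root (p := p) None (p%:Z, 0, 0, 0) && dvdf p (p%:Z, 0, 0, 0);
    [rewrite /= !dvdz0 pp'|congr (_ %| _)%Z; rewrite /=; ring].
Qed.
End Counting.

Section PrimeBound.
Variables (R : realType) (p : nat).
Hypothesis pp : prime p.
Local Notation N := (p ^ 2)%N.
Local Notation ind b := (fun f : form int => (b f)%:R : R[i]).

Lemma FT_nonmax_decomp h : FT N (ind (nonmax p)) h =
  \sum_(r : option 'I_p) FT N (ind (double_root r)) h
  - \sum_(r : option 'I_p) FT N (ind (fun f => double_root r f && dvdf p f)) h + FT N (ind (dvdf p)) h.
Proof.
rewrite /FT [in X in _ = X - _ + _]exchange_big [in X in _ = _ - X + _]exchange_big /= -sumrB -big_split /=.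
apply: eq_bigr => y _; rewrite (nonmax_decomp pp) mulrDl mulrBl !mulr_suml.
by [].
Qed.

Lemma FT_nonmax_count h : `|FT N (ind (nonmax p)) h| <=
  (p ^ 5 * (\sum_(r : option 'I_p) orthL r h) + p ^ 3 * (\sum_(r : option 'I_p) orthM r h)
   + p ^ 4 * dvdf p h)%:R.
Proof.
rewrite FT_nonmax_decomp !natrD; apply: le_trans (ler_normD _ _) _.
apply: lerD; last exact: FT_dvdf.
apply: le_trans (ler_normB _ _) _; rewrite !big_distrr !natr_sum /=.
apply: lerD; apply: le_trans (ler_norm_sum _ _ _) _; apply: ler_sum => r _.
  exact: FT_double_root.
exact: FT_double_root_dvdf.
Qed.

Lemma sum_bool_le1 (T : finType) (b : pred T) : (forall r r', r != r' -> b r -> b r' -> false) ->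
  (\sum_r b r <= [exists r, b r])%N.
Proof.
move=> u; case: existsP => [[r0 h0]|h]; last first.
  by rewrite big1 // => r _; case E: (b r) => //; case: h; exists r.
rewrite (bigD1 r0) //= h0 big1 // => r ne; case E: (b r) => //.
by have := u _ _ ne E h0.
Qed.

Lemma sum_option_le (b : option 'I_p -> bool) : (\sum_r b r <= p.+1)%N.
Proof.
have -> : p.+1 = (\sum_(r : option 'I_p) 1)%N by rewrite sum1_card card_option card_ord.
by apply: leq_sum => r _; case: (b r).
Qed.

(** The cases differ in how many of the p + 1 points r contribute. If p^2 | h, all may, and the
    total is at most 4 p^6. If only p | h, one r counts in [orthL], total at most 4 p^5. If p does
    not divide h, one r counts in each sum, total at most 2 p^5; without p^2 | content only p^3
    remains, and without p | content nothing. *)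
Lemma FT_nonmax h : `|FT N (ind (nonmax p)) h| <= real_complex R (p%:R ^+ 8 * wt R p h).
Proof.
apply: le_trans (FT_nonmax_count h) _.
have p2 : (1 < p)%N := prime_gt1 pp.
have p0 : p%:R != 0 :> R by rewrite pnatr_eq0 -lt0n prime_gt0.
suff H (m : nat) : (p ^ 5 * (\sum_(r : option 'I_p) orthL r h) + p ^ 3 * (\sum_(r : option 'I_p) orthM r h)
   + p ^ 4 * dvdf p h <= m)%N -> m%:R = p%:R ^+ 8 * wt R p h ->
   (p ^ 5 * (\sum_(r : option 'I_p) orthL r h) + p ^ 3 * (\sum_(r : option 'I_p) orthM r h)
   + p ^ 4 * dvdf p h)%:R <= real_complex R (p%:R ^+ 8 * wt R p h) :> R[i].
  have l1 := sum_option_le (fun r => orthL r h); have l2 := sum_option_le (fun r => orthM r h).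
  have e6 : (p ^ 6 = p * p ^ 5)%N by rewrite -expnS.
  have e5 : (p ^ 5 = p * p ^ 4)%N by rewrite -expnS.
  have e4 : (p ^ 4 = p * p ^ 3)%N by rewrite -expnS.
  move: H; rewrite /wt; have [d2|nd2] := boolP (dvdf (p ^ 2) h).
    move/(_ (4 * p ^ 6)%N); apply; last by rewrite natrM natrX; field.
    have d1 : (dvdf p h <= 1)%N by case: dvdf.
    apply: leq_trans (_ : (p ^ 5 * p.+1 + p ^ 3 * p.+1 + p ^ 4 * 1 <= _)%N).
      by rewrite !leq_add // leq_mul2l ?l1 ?l2 ?d1 orbT.
    nia.
  have u1 : (\sum_(r : option 'I_p) orthL r h <= [exists r : option 'I_p, orthL r h])%N.
    by apply: (@sum_bool_le1 _ (fun r => orthL r h)) => r r' ne o o'; have := orthL_uniq pp ne o o'; rewrite (negbTE nd2).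
  have u1' : (\sum_(r : option 'I_p) orthL r h <= 1)%N by apply: leq_trans u1 _; case: existsP.
  have [d1|nd1] := boolP (dvdf p h).
    move/(_ (4 * p ^ 5)%N); apply; last by rewrite natrM natrX; field.
    apply: leq_trans (_ : (p ^ 5 * 1 + p ^ 3 * p.+1 + p ^ 4 * 1 <= _)%N).
      by rewrite !leq_add // leq_mul2l ?u1' ?l2 orbT.
    nia.
  have u2 : (\sum_(r : option 'I_p) orthM r h <= [exists r : option 'I_p, orthM r h])%N.
    by apply: (@sum_bool_le1 _ (fun r => orthM r h)) => r r' ne o o'; have := orthM_uniq pp ne o o'; rewrite (negbTE nd1).
  have u2' : (\sum_(r : option 'I_p) orthM r h <= 1)%N by apply: leq_trans u2 _; case: existsP.
  have [c2|nc2] := boolP (p ^ 2 %| hcont h)%N.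
    move/(_ (2 * p ^ 5)%N); apply; last by rewrite natrM natrX; field.
    rewrite muln0 addn0; apply: leq_trans (_ : (p ^ 5 * 1 + p ^ 3 * 1 <= _)%N).
      by rewrite leq_add // leq_mul2l ?u1' ?u2' orbT.
    nia.
  have z1 : (\sum_(r : option 'I_p) orthL r h = 0)%N.
    apply/eqP; rewrite -leqn0; apply: leq_trans u1 _; case: existsP => // -[r].
    by move/orthL_hcont; rewrite (negbTE nc2).
  rewrite z1 !muln0 add0n addn0.
  have [c1|nc1] := boolP (p %| hcont h)%N.
    move/(_ (p ^ 3)%N); apply; last by rewrite natrX; field.
    by rewrite -[leqRHS]muln1 leq_mul2l u2' orbT.
  have z2 : (\sum_(r : option 'I_p) orthM r h = 0)%N.
    apply/eqP; rewrite -leqn0; apply: leq_trans u2 _; case: existsP => // -[r].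
    by move/orthM_hcont; rewrite (negbTE nc1).
  by rewrite z2 muln0 mulr0 => /(_ 0%N); apply.
move=> hm <-; rewrite rmorph_nat ler_nat; exact: hm.
Qed.
End PrimeBound.

(** * The transform modulo q^2 *)

Section Modulus.
Variable R : realType.
Local Notation ind b := (fun f : form int => (b f)%:R : R[i]).

Lemma periodic_form_mod (T : Type) (M N : nat) (phi : form int -> T) : (M %| N)%N ->
  periodic_form M phi -> periodic_form N phi.
Proof.
move=> MN per f g fg; apply: per; case: f g fg => [[[a b] c] d] [[[a' b'] c'] d'] [h1 h2 h3 h4].
have tr (x : int) : (N %| x)%Z -> (M %| x)%Z by rewrite !dvdzE; apply: dvdn_trans.
by split; apply: tr.
Qed.

Lemma FT_nonmaxs (P : seq nat) h : all prime P -> uniq P ->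
  `|FT (\prod_(p <- P) p ^ 2) (ind (fun f => all (fun p => nonmax p f) P)) h| <=
  real_complex R ((\prod_(p <- P) p%:R ^+ 8) * wts R P h).
Proof.
elim: P => [|p P IH] /= => [_ _|/andP[pp aP] /andP[pP uP]].
  rewrite /wts !big_nil mulr1; apply: le_trans (FT_norm R 1 (fun=> true) h) _.
  rewrite rmorph1 lern1; apply: leq_trans (max_card _) _.
  by rewrite !card_prod !card_ord.
have prod0 : (0 < \prod_(p <- P) p ^ 2)%N.
  rewrite big_seq; apply: prodn_cond_gt0 => i iP.
  by rewrite expn_gt0 prime_gt0 // (allP aP).
have cop : coprime (p ^ 2) (\prod_(p <- P) p ^ 2).
  rewrite big_seq; elim/big_ind: _ => [|x y|i iP]; [exact: coprimen1|by rewrite coprimeMr => -> ->|].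
  rewrite coprimeXl // coprimeXr // prime_coprime // dvdn_prime2 //; last exact: (allP aP).
  by apply: contra pP => /eqP ->.
rewrite !big_cons; pose b2 f := all (fun p => nonmax p f) P.
have -> : (fun f => (nonmax p f && all (fun p => nonmax p f) P)%:R) =
    (fun f => (nonmax p f)%:R * (b2 f)%:R) :> (form int -> R[i]).
  by apply: funext => f; rewrite -natrM mulnb.
have iN i : i \in P -> (i ^ 2 %| \prod_(p <- P) p ^ 2)%N.
  by move=> iP; rewrite (perm_big _ (perm_to_rem iP)) big_cons dvdn_mulr.
rewrite FT_mul //; first last.
- move=> m f cm; congr (_%:R); congr (nat_of_bool _); apply: eq_in_all => i iP.
  apply: nonmax_unit; apply: coprime_dvdr (iN i iP) cm.
- by move=> m f cm; congr (_%:R); congr (nat_of_bool _); apply: nonmax_unit.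
- move=> f g fg; congr (_%:R); congr (nat_of_bool _); apply: eq_in_all => i iP.
  by apply: (periodic_form_mod (iN i iP)) fg; apply: nonmax_periodic.
- by move=> f g fg; congr (_%:R); congr (nat_of_bool _); apply: nonmax_periodic fg.
- by rewrite expn_gt0 prime_gt0.
rewrite normrM {1}/wts big_cons mulrACA rmorphM /=.
by apply: ler_pM; rewrite ?normr_ge0 ?FT_nonmax ?IH.
Qed.

Lemma squarefree_prod (q : nat) : (0 < q)%N -> squarefree q -> q = (\prod_(p <- primes q) p)%N.
Proof.
move=> q0 sq; rewrite {1}(prod_prime_decomp q0) prime_decompE big_map /=.
apply: eq_big_seq => p; rewrite mem_primes => /and3P[pp _ pq].
suff -> : logn p q = 1%N by rewrite expn1.
apply/eqP; rewrite eqn_leq; apply/andP; split; last by rewrite -pfactor_dvdn.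
rewrite leqNgt; apply/negP; rewrite -pfactor_dvdn // => /sq p1.
by move: pp; rewrite p1.
Qed.

Lemma cmod_le (z : R[i]) (x : R) : `|z| <= real_complex R x -> cmod z <= x.
Proof. by rewrite /cmod lecE => /andP[_]. Qed.

Definition emb (h : form int) : form int := let: (a, b, c, d) := h in (a, 3 * b, 3 * c, d).

Lemma pairing_emb h y : pairing R (emb h) y = (pairz h y)%:~R.
Proof.
case: h => [[[a b] c] d]; case: y => [[[y1 y2] y3] y4]; rewrite /pairing /emb /pairz.
by rewrite !(intrD, intrB, intrM); field.
Qed.

Lemma Phi_nonmax (q : nat) (y : form 'I_(q ^ 2)) : (0 < q)%N ->
  Phi R y = (all (fun p => nonmax p (lift_form y)) (primes q))%:R.
Proof.
move=> q0; rewrite /Phi indicE; congr (_%:R); congr (nat_of_bool _).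
apply/idP/allP => [|h].
  rewrite inE => h p; rewrite mem_primes => /and3P[pp _ pq].
  by apply/nonmaxP => //; exact: h.
rewrite inE => p pp pq; apply/nonmaxP => //; apply: h.
by rewrite mem_primes pp q0.
Qed.

Lemma Phihat_le (q : nat) h : (0 < q)%N -> squarefree q ->
  cmod (Phihat R q (emb h)) <= wts R (primes q) h.
Proof.
move=> q0 sq; apply: cmod_le.
have q0' : (q%:R : R) != 0 by rewrite pnatr_eq0 -lt0n.
have FTE : \sum_(y : form 'I_(q ^ 2)) real_complex R (Phi R y) *
     expi (2 * pi * pairing R (emb h) (lift_form y) / q%:R ^+ 2) =
  FT (q ^ 2) (ind (fun f => all (fun p => nonmax p f) (primes q))) h.
  apply: eq_bigr => y _; rewrite Phi_nonmax // rmorph_nat; congr (_ * _).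
  by rewrite /ez pairing_emb natrX.
have q2E : (q ^ 2 = \prod_(p <- primes q) p ^ 2)%N.
  by rewrite {1}(squarefree_prod q0 sq) (big_morph (fun x => x ^ 2)%N (fun x y => expnMn x y 2) (exp1n 2)).
have q8E : q%:R ^+ 8 = \prod_(p <- primes q) p%:R ^+ 8 :> R.
  by rewrite {1}(squarefree_prod q0 sq) natr_prod prodrXl.
rewrite /Phihat FTE normrM normfV normrX normr_nat.
rewrite -ler_pdivlMl ?invr_gt0 ?exprn_gt0 ?ltr0n // invrK.
apply: le_trans.
  have aP : all prime (primes q) by apply/allP => p; rewrite mem_primes => /andP[].
  by rewrite q2E; apply: FT_nonmaxs aP (primes_uniq q).
by rewrite -q8E rmorphM rmorphXn rmorph_nat.
Qed.
End Modulus.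

Local Open Scope classical_set_scope.
Local Open Scope ring_scope.

(** * Orbits and the zeta coefficients *)

Lemma omega_bound (R : realType) (c eps : R) : 1 <= c -> 0 < eps ->
  exists2 K : R, 0 < K & forall q : nat, (0 < q)%N -> c ^+ size (primes q) <= K * q%:R `^ eps.
Proof.
move=> c1 e0; have c0 : 0 < c by exact: lt_le_trans c1.
(* Primes p >= M satisfy c <= p^eps; the smaller ones number at most M and contribute at most
   c^M. *)
pose M := Num.bound (c `^ eps^-1).
have hM (p : nat) : (M <= p)%N -> c <= p%:R `^ eps.
  move=> Mp; have h : c `^ eps^-1 <= p%:R.
    apply: le_trans (_ : M%:R <= _); last by rewrite ler_nat.
    by apply: ltW; apply: archi_boundP; exact: powR_ge0.
  have := ge0_ler_powR (ltW e0) _ _ h; rewrite -powRrM mulVf ?gt_eqF // powRr1 ?(ltW c0) //.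
  by apply; rewrite ?nnegrE ?powR_ge0.
exists (c ^+ M); first by rewrite exprn_gt0.
move=> q q0.
have prodq : (\prod_(p <- primes q) p <= q)%N.
  rewrite {2}(prod_prime_decomp q0) prime_decompE big_map /= big_seq [leqRHS]big_seq.
  apply: leq_prod => p; rewrite mem_primes => /and3P[pp _ pq].
  by rewrite -[leqLHS]expn1; apply: leq_pexp2l; rewrite ?(prime_gt0 pp) // -pfactor_dvdn.
have prodP : \prod_(p <- primes q) p%:R `^ eps = (\prod_(p <- primes q) p)%:R `^ eps.
  elim: (primes q) => [|p s IH]; first by rewrite !big_nil powR1.
  by rewrite !big_cons natrM powRM ?ler0n // IH.
have cpow (s : seq nat) : \prod_(p <- s) c = c ^+ size s.
  by elim: s => [|x s IH]; rewrite ?big_nil // big_cons IH exprS.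
rewrite -cpow.
apply: (@le_trans _ _ (\prod_(p <- primes q) ((if (p < M)%N then c else 1) * p%:R `^ eps))).
  rewrite big_seq [leRHS]big_seq; apply: ler_prod => p; rewrite mem_primes => /and3P[pp _ pq].
  rewrite (ltW c0) /=; case: ltnP => hp; last by rewrite mul1r hM.
  rewrite ler_peMr ?(ltW c0) // -[leLHS](congr1 (@^~ eps) (powR1 R)).
  by apply: ge0_ler_powR; rewrite ?nnegrE ?(ltW e0) ?ler1n ?prime_gt0.
rewrite big_split /= prodP; apply: ler_pM.
- by apply: prodr_ge0 => p _; case: ifP => // _; exact: ltW.
- exact: powR_ge0.
- rewrite -big_mkcond -big_filter cpow.
  apply: ler_weXn2l => //; rewrite -[leqRHS](size_iota 0 M); apply: uniq_leq_size.
    by rewrite filter_uniq // primes_uniq.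
  by move=> p; rewrite mem_filter mem_iota add0n => /andP[].
- by apply: ge0_ler_powR; rewrite ?nnegrE ?(ltW e0) ?ler_nat ?ler0n.
Qed.

Lemma act_emb (g : 'M[int]_2) h :
  act g (emb h) = emb (sub4 (g 0 0) (g 0 1) (g 1 0) (g 1 1) h).
Proof. by case: h => [[[a b] c] d]; rewrite /act /emb /sub4; congr (_, _, _, _); ring. Qed.

Lemma Disc_emb h : Disc (emb h) = - 27 * disc4 h.
Proof. by case: h => [[[a b] c] d]; rewrite /Disc /disc4 /=; ring. Qed.

Definition unemb (x : form int) : form int :=
  let: (a, b, c, d) := x in (a, (b %/ 3)%Z, (c %/ 3)%Z, d).

Lemma unembK x : dual_lattice x -> emb (unemb x) = x.
Proof.
case: x => [[[a b] c] d] /andP[hb hc]; rewrite /emb /unemb.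
by rewrite ![3 * _]mulrC !divzK.
Qed.

Lemma embK : cancel emb unemb.
Proof. by case=> [[[a b] c] d]; rewrite /emb /unemb !mulKz. Qed.

Lemma orbit_emb h x : SL2Z_orbit (emb h) x <-> exists2 h', eqv h h' & x = emb h'.
Proof.
split=> [[g gd <-]|[h' [r [s [t [w [e ->]]]]] ->]].
  rewrite act_emb; eexists; last by [].
  by exists (g 0 0), (g 0 1), (g 1 0), (g 1 1); split => //; rewrite -gd det_int2.
have [e1 e2 e3 e4] := mx22E r s t w.
by exists (mx22 r s t w); rewrite ?act_emb /SL2Z /= ?det_int2 e1 e2 e3 e4.
Qed.

Lemma orbit_eqv h h' : eqv h h' -> SL2Z_orbit (emb h) = SL2Z_orbit (emb h').
Proof.
move=> e; apply/seteqP; split=> x /orbit_emb[k hk ->]; apply/orbit_emb; exists k => //.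
  exact: eqv_trans (eqv_sym e) hk.
exact: eqv_trans e hk.
Qed.

Section Assembly.
Variables (R : realType) (q : nat) (e : bool).

Let orbits (mu : R) := [set SL2Z_orbit x | x in forms_at q e mu].
Let rep (O : set (form int)) : form int := unemb (xget (0, 0, 0, 0) O).

Lemma rep_spec mu O : orbits mu O -> [/\ O = SL2Z_orbit (emb (rep O)), xget (0, 0, 0, 0) O = emb (rep O),
  disc4 (rep O) != 0 & `|Disc (emb (rep O))|%:~R / q%:R ^+ 8 = mu].
Proof.
move=> [x [dx d0 hmu] <-]; have ex := unembK dx; move: (unemb x) ex => h ex.
subst x.
have /orbit_emb [k hk ek] : SL2Z_orbit (emb h) (xget (0, 0, 0, 0) (SL2Z_orbit (emb h))).
  by apply: xgetPex; exists (emb h); apply/orbit_emb; exists h => //; exact: eqv_refl.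
have -> : rep (SL2Z_orbit (emb h)) = k by rewrite /rep ek embK.
have dk := disc4_eqv hk.
split=> //; first exact: orbit_eqv.
- move: d0; rewrite Disc_emb dk; by apply: contraTneq => ->; rewrite mulr0 ltxx.
- by rewrite -hmu !Disc_emb dk.
Qed.

Lemma cmodD (x y : R[i]) : cmod (x + y) <= cmod x + cmod y.
Proof. by have := ler_normD x y; rewrite lecE => /andP[_]. Qed.

Lemma cmod_sum (T : Type) (s : seq T) (F : T -> R[i]) :
  cmod (\sum_(i <- s) F i) <= \sum_(i <- s) cmod (F i).
Proof.
elim: s => [|x s IH]; first by rewrite !big_nil /cmod normr0.
by rewrite !big_cons; apply: le_trans (cmodD _ _) _; rewrite lerD2l.
Qed.

(** Used to discard the orders of stabilizers; n = 0 is covered, the quotient being then 0. *)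
Lemma cmod_div_nat (z : R[i]) (n : nat) : cmod (z / n%:R) <= cmod z.
Proof.
suff : `|z / n%:R| <= `|z| by rewrite lecE => /andP[_].
rewrite normrM; apply: ler_piMr => //; rewrite normfV normr_nat.
by case: n => [|n]; rewrite ?invr0 // invf_le1 ?ler1n ?ltr0n.
Qed.

(** The list is the finite support over which the big operator is evaluated. *)
Lemma cmod_fsbig (T : choiceType) (A : set T) (F : T -> R[i]) : exists s : seq T,
  [/\ uniq s, {in s, forall x, A x} & cmod (\sum_(x \in A) F x) <= \sum_(x <- s) cmod (F x)].
Proof.
exists (finite_support 0 A F); split; [exact: finite_support_uniq| |exact: cmod_sum].
by case: finite_supportP => // Y YA _ _ x /YA.
Qed.

Lemma bcoef_le mu : exists s : seq (set (form int)), [/\ uniq s, {in s, forall O, orbits mu O} &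
  cmod (bcoef q e mu) <= \sum_(O <- s) cmod (Phihat R q (emb (rep O)))].
Proof.
rewrite /bcoef; have [s [us sO h]] := cmod_fsbig (orbits mu) (fun O =>
  let x := xget (0, 0, 0, 0) O in Phihat R q x / #|` fset_set (Stab x)|%:R).
exists s; split=> //; apply: le_trans h _; rewrite big_seq [leRHS]big_seq; apply: ler_sum => O /sO.
by move=> /rep_spec[_ hx _ _]; rewrite /= hx; exact: cmod_div_nat.
Qed.

Lemma orbit_list (A : seq R) : uniq A -> exists s : seq (form int),
  [/\ ineqs s, {in s, forall h, disc4 h != 0 /\ `|Disc (emb h)|%:~R / q%:R ^+ 8 \in A} &
    \sum_(mu <- A) cmod (bcoef q e mu) <= \sum_(h <- s) cmod (Phihat R q (emb h))].
Proof.
move=> uA; have /choice[L hL] := bcoef_le.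
exists (map rep (flatten (map L A))).
have Lspec Z : Z \in flatten (map L A) -> exists2 mu, mu \in A & orbits mu Z.
  move=> /flatten_mapP[mu muA OL]; exists mu => //; have [_ h _] := hL mu; exact: h.
have uL : uniq (flatten (map L A)).
  elim: A uA Lspec => [//|mu A IH] /andP[muA uA] Lspec /=; rewrite cat_uniq IH //.
  - have [-> _ _] := hL mu; rewrite /= andbT; apply/hasPn => Z.
    (* An orbit cannot be listed for two values of mu, since mu is recovered from the discriminant
       of its representative. *)
    move=> /flatten_mapP[mu' mu'A OL']; apply/negP => OL.
    have [_ h _] := hL mu; have [_ h' _] := hL mu'.
    have [_ _ _ e1] := rep_spec (h _ OL); have [_ _ _ e2] := rep_spec (h' _ OL').
    by move: muA; rewrite -e1 e2 mu'A.
  - by move=> Z /flatten_mapP[mu' mu'A OL']; exists mu' => //; have [_ h' _] := hL mu'; exact: h'.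
split.
- rewrite /ineqs; elim: (flatten (map L A)) uL Lspec => [//|Z s IH] /andP[Os us] Lspec /=.
  apply/andP; split; last by apply: IH => // T' h; apply: Lspec; rewrite in_cons h orbT.
  apply/allP => _ /mapP[T' Ts ->]; apply/asboolPn => /orbit_eqv ee.
  have [mu _ /rep_spec[hO _ _ _]] := Lspec Z (mem_head _ _).
  have [|mu' _ /rep_spec[hT' _ _ _]] := Lspec T'; first by rewrite in_cons Ts orbT.
  by move: Os; rewrite hO ee -hT' Ts.
- move=> _ /mapP[Z /Lspec[mu muA /rep_spec[_ _ d0 e1]] ->]; split=> //.
  by rewrite e1.
rewrite big_map; elim: A {uA Lspec uL} => [|mu A IH] /=; first by rewrite !big_nil.
by rewrite big_cons big_cat; apply: lerD => //; have [] := hL mu.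
Qed.
End Assembly.

Theorem theorem3p1 (R : realType) (e : bool) (eps : R) (heps : 0 < eps) :
  exists C : R, 0 < C /\
    forall (q : nat) (X : R), (0 < q)%N -> squarefree q -> 0 < X ->
      (\esum_(mu in [set mu : R | positive_multiples q mu /\ (mu < X)%R])
          (cmod (bcoef q e mu))%:E
        <= (C * q%:R `^ (1 + eps) * X)%:E)%E.
Proof.
have [C C0 hC] := weighted_count R.
have [K K0 hK] := @omega_bound R 22 eps (ltac:(lra)) heps.
exists (C * K); split=> [|q X q0 sq X0]; first exact: mulr_gt0.
have qR : 0 < q%:R :> R by rewrite ltr0n.
(* The sum over all mu is the supremum of the sums over finite sets A. *)
apply: ub_ereal_sup => _ [A [finA AX] <-].
rewrite fsbig_finite //= sumEFin lee_fin.
have [s [ins hs hsum]] := orbit_list q e (fset_uniq (fset_set A)).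
apply: le_trans hsum _.
apply: (@le_trans _ _ (\sum_(h <- s) wts R (primes q) h)).
  by apply: ler_sum => h _; exact: Phihat_le.
have aP : all prime (primes q) by apply/allP => p; rewrite mem_primes => /andP[].
have qX : 0 <= q%:R ^+ 8 * X by rewrite mulr_ge0 // ?exprn_ge0 // ltW.
have adm : {in s, forall h, admissible [::] (q%:R ^+ 8 * X) h}.
  move=> h /hs[d0]; rewrite in_fset_set // inE => /AX[_ hX]; split=> //.
    by rewrite big_nil dvd1n.
  (* |Disc| is 27 |disc4|, so the bound for |Disc| passes to |disc4|. *)
  move: hX; rewrite ltr_pdivrMr ?exprn_gt0 // mulrC => /ltW; apply: le_trans.
  by rewrite ler_int Disc_emb normrM ler_peMl.
(* No condition on the content at the start: Q is empty and P consists of the primes of q, whose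
   product is q since q is squarefree. Then q^8 X / q^7 = q X, and 22^omega(q) is absorbed by
   q^eps. *)
have := hC (primes q) [::] s _ aP isT _ qX ins adm; rewrite cats0 primes_uniq => /(_ isT) h.
apply: le_trans h _; rewrite /bnd big_nil mulr1 expr1n mulr1 -(squarefree_prod q0 sq).
have -> : C * 22 ^+ size (primes q) * (q%:R ^+ 8 * X) / q%:R ^+ 7 = C * 22 ^+ size (primes q) * q%:R * X.
  by field; rewrite gt_eqF.
rewrite powRD ?(gt_eqF qR) ?implybT // powRr1 ?(ltW qR) //.
have -> : C * K * (q%:R * q%:R `^ eps) * X = C * (K * q%:R `^ eps) * q%:R * X by ring.
by rewrite !ler_pM2r // ler_pM2l // hK.
Qed.
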